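(* Let $d\ge 2$ and $\alpha >1/2$. Then there is a constant $C$ depending only on $d$ and $\alpha$ such that, for all $f\in\dot H^{-1/2}(\mathbb{R}^d)$, $$\int_{\mathbb{R}^{d+1}}|e^{t\mathcal{R}_1\Delta} f(x)|^2 \frac{dx\,dt}{(1+|x|^2)^\alpha}\le C\,\|f\|_{\dot{H}^{-1/2}(\mathbb{R}^d)}^2 .$$
   Context: The Fourier transform is $\widehat f(\xi)=\int_{\mathbb{R}^d} f(y)e^{-iy\cdot\xi}\,dy$. The propagator is $$e^{t\mathcal{R}_1\Delta} f(x):= \frac{1}{(2\pi)^d}\int_{\mathbb{R}^d} e^{i\xi\cdot x}e^{ i\xi_1|\xi|t}\widehat{f}(\xi)\,d\xi ,$$ i.e. the Fourier multiplier operator with symbol $e^{it\xi_1|\xi|}$. The homogeneous Sobolev norm is $\|f\|_{\dot{H}^s}:=\|(-\Delta)^{s/2}f\|_{L^2}$, where $(-\Delta)^{s}f:=(|\cdot|^{2s}\widehat{f}\,)^{\vee}$. *)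

(* Defs.v *)
From HB Require Import structures.
From mathcomp Require Import all_boot all_order all_algebra complex.
From mathcomp Require Import all_classical all_reals all_analysis.
Set Implicit Arguments.
Unset Strict Implicit.
Unset Printing Implicit Defensive.
Import Order.TTheory GRing.Theory Num.Theory.
Import numFieldNormedType.Exports.
Import ComplexField.Normc.
Local Open Scope classical_set_scope.
Local Open Scope ring_scope.

(* Points of R^d are row vectors 'rV[R]_d, with the sigma-algebra generated by
   the coordinates, i.e. the Borel sets. *)
Definition measure_rV_display : measure_display.
Proof. exact: default_measure_display. Qed.

Definition measurable_rV (R : realType) (n : nat) : set (set 'rV[R]_n) :=
  g_sigma_preimage (fun (i : 'I_n) (x : 'rV[R]_n) => x ord0 i).

Fact measurable_rV0 (R : realType) (n : nat) : @measurable_rV R n set0.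
Proof. exact: sigma_algebra0. Qed.

Fact measurable_rVC (R : realType) (n : nat) (A : set 'rV[R]_n) :
  measurable_rV A -> measurable_rV (~` A).
Proof. exact: sigma_algebraC. Qed.

Fact measurable_rV_bigcup (R : realType) (n : nat) (F : (set 'rV[R]_n)^nat) :
  (forall i, measurable_rV (F i)) -> measurable_rV (\bigcup_i (F i)).
Proof. exact: sigma_algebra_bigcup. Qed.

HB.instance Definition _ (R : realType) (n : nat) :=
  @isMeasurable.Build measure_rV_display 'rV[R]_n (@measurable_rV R n)
    (@measurable_rV0 R n) (@measurable_rVC R n) (@measurable_rV_bigcup R n).

Lemma measurable_rV_coord (R : realType) (n : nat) (i : 'I_n) :
  measurable_fun setT (fun x : 'rV[R]_n => x ord0 i).
Proof.
move=> _ Y mY; rewrite setTI; apply: sub_sigma_algebra => /=.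
rewrite -bigcup_seq/=; exists i => /=; first by rewrite mem_index_enum.
by exists Y => //; rewrite setTI.
Qed.

Lemma measurable_fun_rVP d (T : measurableType d) (R : realType) (n : nat)
    (f : T -> 'rV[R]_n) :
  (forall i, measurable_fun setT (fun x => f x ord0 i)) ->
  measurable_fun setT f.
Proof.
move=> mf _ Y mY.
have : preimage_set_system setT f (@measurable_rV R n) (setT `&` f @^-1` Y).
  by exists Y.
rewrite -g_sigma_preimage_comp; apply: smallest_sub.
  exact: sigma_algebra_measurable.
elim/big_ind: _ => [//|A B sA sB|i _]; first by rewrite subUset.
by move=> _ [B mB <-]; exact: mf.
Qed.

Definition rV_cons (R : realType) (n : nat) (p : R * 'rV[R]_n) : 'rV[R]_n.+1 :=
  row_mx p.1%:M p.2.

Lemma measurable_rV_cons (R : realType) (n : nat) :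
  measurable_fun setT (@rV_cons R n).
Proof.
apply: measurable_fun_rVP => i; case: (split_ordP (i : 'I_(1 + n))) => j ->.
- rewrite [X in measurable_fun _ X](_ : _ = fst); first exact: measurable_fst.
  by apply/funext => p; rewrite [LHS]row_mxEl (ord1 j) mxE eqxx mulr1n.
- rewrite [X in measurable_fun _ X](_ : _ = (fun x : 'rV[R]_n => x ord0 j) \o snd).
    exact: measurableT_comp (measurable_rV_coord j) measurable_snd.
  by apply/funext => p; rewrite [LHS]row_mxEr.
Qed.

(* Lebesgue measure on R^n: a point mass for n = 0, and the product of the
   Lebesgue measures on R and R^n (carried over by rV_cons) for n + 1. *)
Fixpoint lebesgue_rV (R : realType) (n : nat) : set 'rV[R]_n -> \bar R :=
  if n is n'.+1 then
    pushforward (@lebesgue_measure R \x^ @lebesgue_rV R n')%E (@rV_cons R n')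
  else \d_(0 : 'rV[R]_0).

Lemma lebesgue_rV_measure (R : realType) (n : nat) :
  [/\ @lebesgue_rV R n set0 = 0%E, forall A, (0 <= @lebesgue_rV R n A)%E
    & semi_sigma_additive (@lebesgue_rV R n)].
Proof.
elim: n => [|n [m0 m_ge0 m_add]] /=.
  by split => [||]; [exact: measure0|exact: measure_ge0
                    |exact: measure_semi_sigma_additive].
pose m : {measure set 'rV[R]_n -> \bar R} :=
  HB.pack (@lebesgue_rV R n) (isMeasure.Build _ _ _ _ m0 m_ge0 m_add).
pose pm := @measure_function_pushforward__canonical__measure_function_Measure
  _ _ _ _ _ (@lebesgue_measure R \x^ m)%E _ (@measurable_rV_cons R n).
split => [||]; [exact: (@measure0 _ _ _ pm)|exact: (@measure_ge0 _ _ _ pm)|].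
exact: (@measure_semi_sigma_additive _ _ _ pm).
Qed.

HB.instance Definition _ (R : realType) (n : nat) :=
  isMeasure.Build _ _ _ (@lebesgue_rV R n)
    (let: And3 m0 _ _ := lebesgue_rV_measure R n in m0)
    (let: And3 _ m_ge0 _ := lebesgue_rV_measure R n in m_ge0)
    (let: And3 _ _ m_add := lebesgue_rV_measure R n in m_add).

Definition dotp (R : realType) (d : nat) (x y : 'rV[R]_d) : R :=
  \sum_(i < d) x ord0 i * y ord0 i.

(* The library's norm on 'rV[R]_d is the sup norm. *)
Definition enorm (R : realType) (d : nat) (x : 'rV[R]_d) : R :=
  Num.sqrt (dotp x x).

Definition expi (R : realType) (theta : R) : R[i] :=
  Complex (cos theta) (sin theta).

(* Complex-valued functions are measured, integrated and differentiated
   through their real and imaginary parts. *)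
Definition cmeasurable d (T : measurableType d) (R : realType) (g : T -> R[i]) :
    Prop :=
  measurable_fun setT (fun x => complex.Re (g x)) /\
  measurable_fun setT (fun x => complex.Im (g x)).

Definition cintegrable d (T : measurableType d) (R : realType)
    (mu : {measure set T -> \bar R}) (g : T -> R[i]) : Prop :=
  mu.-integrable setT (fun x => (complex.Re (g x))%:E) /\
  mu.-integrable setT (fun x => (complex.Im (g x))%:E).

Definition cintegral d (T : measurableType d) (R : realType)
    (mu : {measure set T -> \bar R}) (g : T -> R[i]) : R[i] :=
  Complex (\int[mu]_x complex.Re (g x)) (\int[mu]_x complex.Im (g x)).

(* Iterated partial derivative in the coordinate directions listed in s. *)
Definition partials (R : realType) (d : nat) (s : seq 'I_d)
    (f : 'rV[R]_d -> R) : 'rV[R]_d -> R :=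
  foldr (fun i g => 'D_(delta_mx ord0 i : 'rV[R]_d) g) f s.

Definition real_schwartz (R : realType) (d : nat) (f : 'rV[R]_d -> R) : Prop :=
  forall s : seq 'I_d,
    [/\ continuous (partials s f),
        forall (i : 'I_d) x, derivable (partials s f) x (delta_mx ord0 i)
      & forall k : nat, exists M : R,
          forall x, (1 + enorm x) ^+ k * `|partials s f x| <= M].

Definition schwartz (R : realType) (d : nat) (phi : 'rV[R]_d -> R[i]) : Prop :=
  real_schwartz (fun x => complex.Re (phi x)) /\
  real_schwartz (fun x => complex.Im (phi x)).

Definition cpartials (R : realType) (d : nat) (s : seq 'I_d)
    (phi : 'rV[R]_d -> R[i]) (x : 'rV[R]_d) : R[i] :=
  Complex (partials s (fun y => complex.Re (phi y)) x)
          (partials s (fun y => complex.Im (phi y)) x).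

Definition fourier (R : realType) (d : nat) (phi : 'rV[R]_d -> R[i])
    (xi : 'rV[R]_d) : R[i] :=
  cintegral (@lebesgue_rV R d) (fun y => phi y * expi (- dotp y xi)).

Definition inv_fourier (R : realType) (d : nat) (phi : 'rV[R]_d -> R[i])
    (x : 'rV[R]_d) : R[i] :=
  (((2 * pi) ^- d)%:C)%C *
  cintegral (@lebesgue_rV R d) (fun xi => phi xi * expi (dotp x xi)).

(* Distributions are functionals on all functions, of which only the values on
   Schwartz functions matter. *)
Definition functional (R : realType) (d : nat) : Type :=
  ('rV[R]_d -> R[i]) -> R[i].

(* Linearity on Schwartz functions, and continuity: a bound by one of the
   Schwartz seminorms sup_{|s| <= N, x} (1 + |x|)^N |D^s phi(x)|. *)
Definition tempered (R : realType) (d : nat) (f : functional R d) : Prop :=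
  [/\ forall phi psi, schwartz phi -> schwartz psi ->
        f (fun x => phi x + psi x) = f phi + f psi,
      forall (c : R[i]) phi, schwartz phi -> f (fun x => c * phi x) = c * f phi
    & exists (K : R) (N : nat), forall phi, schwartz phi ->
        forall M : R,
          (forall (s : seq 'I_d) x, (size s <= N)%N ->
             (1 + enorm x) ^+ N * normc (cpartials s phi x) <= M) ->
          normc (f phi) <= K * M].

(* The measurable functions that define a tempered distribution through
   an absolutely convergent pairing with Schwartz functions. *)
Definition tempered_fun (R : realType) (d : nat) (g : 'rV[R]_d -> R[i]) :
    Prop :=
  cmeasurable g /\
  forall phi, schwartz phi ->
    cintegrable (@lebesgue_rV R d) (fun x => g x * phi x).

Definition of_fun (R : realType) (d : nat) (g : 'rV[R]_d -> R[i]) :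
    functional R d :=
  fun phi => cintegral (@lebesgue_rV R d) (fun x => g x * phi x).

Definition represented_by (R : realType) (d : nat) (f : functional R d)
    (g : 'rV[R]_d -> R[i]) : Prop :=
  tempered_fun g /\ forall phi, schwartz phi -> f phi = of_fun g phi.

Definition dfourier (R : realType) (d : nat) (f : functional R d) :
    functional R d :=
  fun phi => f (fourier phi).

Definition dinv_fourier (R : realType) (d : nat) (f : functional R d) :
    functional R d :=
  fun phi => f (inv_fourier phi).

(* The Fourier multiplier operator with symbol m, which sends f to
   the inverse Fourier transform of m f^, as the relation
   "the image of f is v": it requires f^ and m f^ to be functions. *)
Definition multiplier (R : realType) (d : nat) (m : 'rV[R]_d -> R[i])
    (f v : functional R d) : Prop :=
  exists g : 'rV[R]_d -> R[i],
    [/\ represented_by (dfourier f) g, tempered_fun (fun xi => m xi * g xi)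
      & forall phi, schwartz phi ->
          v phi = dinv_fourier (of_fun (fun xi => m xi * g xi)) phi].

(* v = (- Delta)^s f *)
Definition frac_laplacian (R : realType) (d : nat) (s : R)
    (f v : functional R d) : Prop :=
  multiplier (fun xi => ((enorm xi `^ (2 * s))%:C)%C) f v.

(* v = e^{t R_j Delta} f, where R_j is the Riesz transform in direction j. *)
Definition riesz_propagator (R : realType) (d : nat) (j : 'I_d) (t : R)
    (f v : functional R d) : Prop :=
  multiplier (fun xi => expi (t * (xi ord0 j * enorm xi))) f v.

Definition L2norm (R : realType) (d : nat) (h : 'rV[R]_d -> R[i]) : \bar R :=
  ('N[@lebesgue_rV R d]_2%:E[(fun x => (normc (h x))%:E)])%E.

(* ||f||_{\dot H^s} = ||(- Delta)^{s/2} f||_{L^2}: the functions h representing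
   (- Delta)^{s/2} f are all almost everywhere equal, so the infimum is over a
   single value; it is +oo when there is no such function. *)
Definition sobolev_norm (R : realType) (d : nat) (s : R) (f : functional R d) :
    \bar R :=
  ereal_inf [set L2norm h | h in
    [set h | exists v, frac_laplacian (s / 2) f v /\ represented_by v h]].

Definition homogeneous_sobolev (R : realType) (d : nat) (s : R)
    (f : functional R d) : Prop :=
  tempered f /\ (sobolev_norm s f < +oo)%E.

(* Main.v *)
Require Import Defs.
From HB Require Import structures.
From mathcomp Require Import all_boot all_order all_algebra complex.
From mathcomp Require Import all_classical all_reals all_analysis.
From mathcomp Require Import measurable_realfun ring lra.
Import Order.TTheory GRing.Theory Num.Theory.
Import numFieldNormedType.Exports.
Import ComplexField.Normc.
Local Open Scope classical_set_scope.
Local Open Scope ring_scope.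
Set Implicit Arguments.
Unset Strict Implicit.
Unset Printing Implicit Defensive.


Section measurability.
Context d (T : measurableType d) (R : realType).
Implicit Types f g : T -> R.

Lemma meas_cst (c : R) : measurable_fun [set: T] (fun=> c).
Proof. exact: measurable_cst. Qed.

Lemma meas_add f g : measurable_fun setT f -> measurable_fun setT g ->
  measurable_fun setT (fun x => f x + g x).
Proof. exact: measurable_funD. Qed.

Lemma meas_opp f : measurable_fun setT f -> measurable_fun setT (fun x => - f x).
Proof. by move=> mf; exact: (measurableT_comp (@oppr_measurable R setT) mf). Qed.

Lemma meas_mul f g : measurable_fun setT f -> measurable_fun setT g ->
  measurable_fun setT (fun x => f x * g x).
Proof. exact: measurable_funM. Qed.

Lemma meas_exp f n : measurable_fun setT f -> measurable_fun setT (fun x => f x ^+ n).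
Proof. exact: measurable_funX. Qed.

Lemma meas_cont (h : R -> R) f : continuous h -> measurable_fun setT f ->
  measurable_fun setT (fun x => h (f x)).
Proof. by move=> /continuous_measurable_fun mh mf; exact: (measurableT_comp mh mf). Qed.

Lemma meas_norm f : measurable_fun setT f -> measurable_fun setT (fun x => `|f x|).
Proof. by move=> mf; exact: (measurableT_comp (@normr_measurable R setT) mf). Qed.

Lemma meas_expR f : measurable_fun setT f -> measurable_fun setT (fun x => expR (f x)).
Proof. by apply: meas_cont; exact: continuous_expR. Qed.

Lemma meas_cos f : measurable_fun setT f -> measurable_fun setT (fun x => cos (f x)).
Proof. by apply: meas_cont; exact: continuous_cos. Qed.

Lemma meas_sin f : measurable_fun setT f -> measurable_fun setT (fun x => sin (f x)).
Proof. by apply: meas_cont; exact: continuous_sin. Qed.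

Lemma meas_sqrt f : measurable_fun setT f -> measurable_fun setT (fun x => Num.sqrt (f x)).
Proof. by apply: meas_cont; exact: sqrt_continuous. Qed.

Lemma meas_powR f p : measurable_fun setT f -> measurable_fun setT (fun x => f x `^ p).
Proof. by move=> mf; exact: (measurableT_comp (measurable_powR p) mf). Qed.

Lemma meas_inv f : (forall x, 0 <= f x) -> measurable_fun setT f ->
  measurable_fun setT (fun x => (f x)^-1).
Proof.
move=> f0 mf; rewrite (_ : (fun _ => _) = (fun x => f x `^ (- 1))); first exact: meas_powR.
by apply/funext => x; rewrite powR_inv1.
Qed.

Lemma meas_sum n (F : 'I_n -> T -> R) : (forall i, measurable_fun setT (F i)) ->
  measurable_fun setT (fun x => \sum_i F i x).
Proof. by move=> mF; exact: measurable_sum. Qed.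

Lemma meas_prod n (F : 'I_n -> T -> R) : (forall i, measurable_fun setT (F i)) ->
  measurable_fun setT (fun x => \prod_i F i x).
Proof. by move=> mF; apply: measurable_prod => *; exact: mF. Qed.

End measurability.

Ltac meas := repeat (first [ done | exact: meas_cst | exact: measurable_id
  | apply: meas_expR | apply: meas_cos | apply: meas_sin | apply: meas_sqrt
  | apply: meas_norm | apply: meas_exp | apply: meas_opp | apply: meas_add
  | apply: meas_mul ]).

Section realint.
Context d (T : measurableType d) (R : realType) (mu : {measure set T -> \bar R}).
Implicit Types f g : T -> R.

Definition rint f : Prop := mu.-integrable setT (EFin \o f).

Lemma rint_meas f : rint f -> measurable_fun setT f.
Proof. by move=> /measurable_int /measurable_EFinP. Qed.

Lemma rint_le f g : measurable_fun setT f -> rint g ->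
  (forall x, `|f x| <= g x) -> rint f.
Proof.
move=> mf ig fg; apply: (le_integrable measurableT _ _ ig).
  exact/measurable_EFinP.
by move=> x _ /=; rewrite lee_fin (le_trans (fg x))// ler_norm.
Qed.

Lemma rint_ltyP f : measurable_fun setT f ->
  (\int[mu]_x (`|f x|)%:E < +oo)%E -> rint f.
Proof. by move=> mf h; apply/integrableP; split => //; exact/measurable_EFinP. Qed.

Lemma rint_lty f : rint f -> (\int[mu]_x (`|f x|)%:E < +oo)%E.
Proof. by move/integrableP => []. Qed.

Lemma rintD f g : rint f -> rint g -> rint (fun x => f x + g x).
Proof. by move=> fi gi; exact: (integrableD measurableT fi gi). Qed.

Lemma rintB f g : rint f -> rint g -> rint (fun x => f x - g x).
Proof. by move=> fi gi; exact: (integrableB measurableT fi gi). Qed.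

Lemma rintZ k f : rint f -> rint (fun x => k * f x).
Proof. by move=> fi; exact: (integrableZl measurableT k fi). Qed.

Lemma rint_norm f : rint f -> rint (fun x => `|f x|).
Proof. exact: integrable_norm. Qed.

Lemma rintE f : rint f -> (\int[mu]_x (f x)%:E = (\int[mu]_x f x)%:E)%E.
Proof. by move=> fi; rewrite /Rintegral fineK//; exact: integrable_fin_num. Qed.

Lemma rint_dct_ae (f_ : nat -> T -> R) f g :
  (forall n, measurable_fun setT (f_ n)) -> measurable_fun setT f -> rint g ->
  {ae mu, forall x, f_ ^~ x @ \oo --> f x} ->
  {ae mu, forall x, forall n, `|f_ n x| <= g x} ->
  rint f /\ (fun n => \int[mu]_x f_ n x) @ \oo --> \int[mu]_x f x.
Proof.
move=> mf_ mf ig cf fg.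
have mf_' n : measurable_fun setT (EFin \o f_ n) by exact/measurable_EFinP.
have mf' : measurable_fun setT (EFin \o f) by exact/measurable_EFinP.
have cf' : {ae mu, forall x, setT x -> (fun n => (EFin \o f_ n) x) @ \oo --> (EFin \o f) x}.
  by apply: filterS cf => x h _; apply: cvg_EFin; [exact: nearW|exact: h].
have fg' : {ae mu, forall x n, setT x -> (`|(EFin \o f_ n) x| <= (EFin \o g) x)%E}.
  by apply: filterS fg => x h n _; rewrite lee_fin.
have [fi _ h] := dominated_convergence measurableT mf_' mf' cf' ig fg'.
split => //; apply: fine_cvg; rewrite fineK ?integrable_fin_num//.
Qed.

Lemma rint_dct (f_ : nat -> T -> R) f g :
  (forall n, measurable_fun setT (f_ n)) -> rint g ->
  (forall x, f_ ^~ x @ \oo --> f x) -> (forall n x, `|f_ n x| <= g x) ->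
  rint f /\ (fun n => \int[mu]_x f_ n x) @ \oo --> \int[mu]_x f x.
Proof.
move=> mf ig cf fg; apply: (@rint_dct_ae _ _ g) => //; try exact: aeW.
by apply: measurable_fun_cvg mf _ => x _; exact: cf.
Qed.

End realint.

Section fub.
Context d1 d2 (T1 : measurableType d1) (T2 : measurableType d2) (R : realType).
Variable m1 : {sigma_finite_measure set T1 -> \bar R}.
Variable m2 : {sigma_finite_measure set T2 -> \bar R}.
Implicit Types f : T1 -> T2 -> R.

Lemma integral_prod2 (f : T1 * T2 -> \bar R) : (\int[m1 \x^ m2]_p f p = \int[m1 \x m2]_p f p)%E.
Proof.
apply: eq_measure_integral => A mA _; apply/esym.
by apply: product_measure_unique => // *; exact: product_measure2E.
Qed.

(* iterated bound implies integrability *)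
Lemma rint_prod f (g : T1 -> R) : measurable_fun setT (fun p => f p.1 p.2) -> rint m1 g ->
  (forall x, \int[m2]_y `|f x y|%:E <= (g x)%:E)%E ->
  rint (m1 \x m2)%E (fun p => f p.1 p.2).
Proof.
move=> mf ig fg; apply: rint_ltyP => //.
rewrite fubini_tonelli1//=; last first.
  exact/measurable_EFinP/meas_norm.
apply: le_lt_trans (rint_lty ig); apply: ge0_le_integral => //.
- by move=> x _; apply: integral_ge0.
- apply: (@measurable_fun_fubini_tonelli_F _ _ _ _ _ m2 (fun p => (`|f p.1 p.2|)%:E)) => //.
  exact/measurable_EFinP/meas_norm.
- by apply/measurable_EFinP; apply: meas_norm; exact: rint_meas ig.
- by move=> x _; rewrite (le_trans (fg x))// lee_fin ler_norm.
Qed.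

Lemma rint_ae f : rint (m1 \x m2)%E (fun p => f p.1 p.2) ->
  {ae m1, forall x, rint m2 (f x)}.
Proof. by move=> /ae_integrable1. Qed.

Lemma rint_fubini f : rint (m1 \x m2)%E (fun p => f p.1 p.2) ->
  (forall x, rint m2 (f x)) -> (forall y, rint m1 (f ^~ y)) ->
  [/\ rint m1 (fun x => \int[m2]_y f x y)%R,
      rint m2 (fun y => \int[m1]_x f x y)%R &
   \int[m1]_x \int[m2]_y f x y = \int[m2]_y \int[m1]_x f x y].
Proof.
move=> fi f2 f1.
have h1 := integrable_fubini_F fi.
have mf : measurable_fun setT (fun p : T1 * T2 => (f p.1 p.2)%:E).
  by apply/measurable_EFinP; exact: (rint_meas fi).
have mG := measurable_fubini_G fi.
split.
- have E : EFin \o (fun x => \int[m2]_y f x y)%R = fubini_F m2 (fun p => (f p.1 p.2)%:E).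
    by apply/funext => x; rewrite /fubini_F/= rintE.
  by rewrite /rint E.
- have E : EFin \o (fun y => \int[m1]_x f x y)%R = fubini_G m1 (fun p => (f p.1 p.2)%:E).
    by apply/funext => y; rewrite /fubini_G/= rintE.
  apply: rint_ltyP; first by apply/measurable_EFinP; rewrite E; exact: mG.
  apply: le_lt_trans ((integrable21ltyP m1 m2 mf).1 fi).
  apply: ge0_le_integral => //.
  + by apply/measurable_EFinP/meas_norm/measurable_EFinP; rewrite E; exact: mG.
  + apply: (@measurable_fun_fubini_tonelli_G _ _ _ _ _ m1 (fun p => `|(f p.1 p.2)%:E|%E)) => //.
    exact: measurableT_comp.
  + move=> y _; rewrite -[X in (X <= _)%E]/(`|(\int[m1]_x f x y)%:E|)%E -rintE//.
    by apply: le_abse_integral => //; apply/measurable_EFinP; exact: (rint_meas (f1 y)).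
- rewrite /Rintegral; congr fine.
  under eq_integral do rewrite -/(Rintegral _ _ _) -rintE//.
  under [RHS]eq_integral do rewrite -/(Rintegral _ _ _) -rintE//.
  exact: (Fubini fi).
Qed.

End fub.

Section rV.
Context {R : realType}.

Lemma rV_cons0 n (p : R * 'rV[R]_n) : rV_cons p ord0 ord0 = p.1.
Proof.
rewrite /rV_cons (_ : ord0 = lshift n ord0 :> 'I_(1 + n)); last exact/val_inj.
by rewrite [LHS]row_mxEl mxE eqxx mulr1n.
Qed.

Lemma rV_consS n (p : R * 'rV[R]_n) (j : 'I_n) : rV_cons p ord0 (lift ord0 j) = p.2 ord0 j.
Proof.
rewrite /rV_cons (_ : lift ord0 j = rshift 1 j :> 'I_(1 + n)); last exact/val_inj.
by rewrite [LHS]row_mxEr.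
Qed.

Definition rV_tail n (x : 'rV[R]_n.+1) : 'rV[R]_n := \row_j x ord0 (lift ord0 j).

Lemma rV_cons_tail n (x : 'rV[R]_n.+1) : rV_cons (x ord0 ord0, rV_tail x) = x.
Proof.
apply/rowP => j; case: (unliftP ord0 j) => [k ->|->]; rewrite ?rV_consS ?rV_cons0//=.
by rewrite mxE.
Qed.

Lemma rV_tail_cons n (p : R * 'rV[R]_n) : rV_tail (rV_cons p) = p.2.
Proof. by apply/rowP => j; rewrite mxE rV_consS. Qed.

Lemma measurable_rV_tail n : measurable_fun setT (@rV_tail n).
Proof.
apply: measurable_fun_rVP => j.
rewrite (_ : (fun _ => _) = (fun x : 'rV[R]_n.+1 => x ord0 (lift ord0 j))).
  exact: measurable_rV_coord.
by apply/funext => x; rewrite mxE.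
Qed.

Definition cube n (i : nat) : set 'rV[R]_n := [set x | forall j, `|x ord0 j| <= i%:R].

Lemma measurable_cube n i : measurable (@cube n i).
Proof.
have -> : @cube n i = \bigcap_(j in [set: 'I_n]) [set x : 'rV[R]_n | `|x ord0 j| <= i%:R].
  by apply/seteqP; split => [x h j _|x h j]; [exact: h|exact: (h j I)].
apply: fin_bigcap_measurable => // j _.
rewrite -[X in measurable X]setTI.
have /(_ measurableT `]-oo, i%:R]%classic) := meas_norm (@measurable_rV_coord R n j).
by move=> /(_ (measurable_itv _)); rewrite set_itvE.
Qed.

Lemma cube_lty n i : (@lebesgue_rV R n (@cube n i) < +oo)%E.
Proof.
elim: n => [|n IH]; first by rewrite /= diracE; case: (_ \in _); rewrite ltry.
rewrite /= /pushforward.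
have -> : @rV_cons R n @^-1` @cube n.+1 i = `[- i%:R, i%:R]%classic `*` @cube n i.
  apply/seteqP; split => [[s y]/= h|[s y]/= [h1 h2] j].
    split; first by have := h ord0; rewrite rV_cons0/= ler_norml in_itv/=.
    by move=> j; have := h (lift ord0 j); rewrite rV_consS.
  case: (unliftP ord0 j) => [k ->|->]; rewrite ?rV_consS ?rV_cons0//=.
  by move: h1; rewrite in_itv/= ler_norml.
rewrite product_measure2E//; last exact: measurable_cube.
by apply: lte_mul_pinfty => //; rewrite /= lebesgue_measure_itv/=; case: ifP.
Qed.

Lemma sigma_finite_rV n : sigma_finite setT (@lebesgue_rV R n).
Proof.
exists (@cube n); last by move=> i; split; [exact: measurable_cube|exact: cube_lty].
apply/seteqP; split => // x _.
exists (Num.truncn (\sum_j `|x ord0 j|)).+1 => // j.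
apply: le_trans (ltW (truncnS_gt _)).
by rewrite (bigD1 j)//= lerDl sumr_ge0.
Qed.

HB.instance Definition _ n :=
  Measure_isSigmaFinite.Build _ _ _ (@lebesgue_rV R n) (sigma_finite_rV n).

(* Tonelli for R^{n+1} *)
Lemma integral_rVS n (F : 'rV[R]_n.+1 -> \bar R) : measurable_fun setT F ->
  (forall x, 0 <= F x)%E ->
  (\int[@lebesgue_rV R n.+1]_x F x =
   \int[@lebesgue_measure R]_s \int[@lebesgue_rV R n]_y F (rV_cons (s, y)))%E.
Proof.
move=> mF F0.
have -> : (\int[@lebesgue_rV R n.+1]_x F x =
  \int[pushforward (@lebesgue_measure R \x^ @lebesgue_rV R n) (@rV_cons R n)]_x F x)%E by [].
rewrite ge0_integral_pushforward//; last exact: measurable_rV_cons.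
rewrite preimage_setT integral_prod2 fubini_tonelli1//.
- exact: (measurableT_comp mF (@measurable_rV_cons R n)).
- by move=> x; exact: F0.
Qed.

End rV.

Section translation.
Context {R : realType}.

Lemma rV_consD n (s t : R) (y z : 'rV[R]_n) :
  rV_cons (s, y) + rV_cons (t, z) = rV_cons (s + t, y + z).
Proof.
apply/rowP => j; rewrite [LHS]mxE; case: (unliftP ord0 j) => [k ->|->].
  by rewrite !rV_consS/= mxE.
by rewrite !rV_cons0.
Qed.

Lemma integral_shift1 (c : R) (F : R -> \bar R) : measurable_fun setT F ->
  (forall x, 0 <= F x)%E ->
  (\int[@lebesgue_measure R]_s F (s + c)%R = \int[@lebesgue_measure R]_s F s)%E.
Proof.
move=> mF F0.
pose h : measurableTypeR R -> measurableTypeR R := fun s => s + c.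
have mc : measurable_fun setT h.
  by apply: meas_add => //; exact: meas_cst.
transitivity (\int[pushforward (@lebesgue_measure R) h]_s F s)%E.
  by rewrite ge0_integral_pushforward// preimage_setT.
apply: eq_measure_integral => A mA _; apply/esym.
apply: (@lebesgue_measure_unique R (pushforward (@lebesgue_measure R) h)) => // _ [[a b]] _ <- /=.
rewrite /pushforward/h.
rewrite (_ : _ @^-1` _ = `]a - c, b - c]%classic); last first.
  by apply/seteqP; split => x /=; rewrite !in_itv/= ltrBlDr lerBrDr.
rewrite !lebesgue_measure_itv/= !lte_fin ltrD2r.
by case: ifP => // _; rewrite -!EFinB; congr (_%:E); ring.
Qed.

Lemma integral_shift n (v : 'rV[R]_n) (F : 'rV[R]_n -> \bar R) : measurable_fun setT F ->
  (forall x, 0 <= F x)%E ->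
  (\int[@lebesgue_rV R n]_x F (x + v)%R = \int[@lebesgue_rV R n]_x F x)%E.
Proof.
elim: n v F => [|n IH] v F mF F0.
  by apply: eq_integral => x _; congr F; rewrite [x]thinmx0 [v]thinmx0 addr0.
have mcons := @measurable_rV_cons R n.
have mFs s : measurable_fun setT (fun y => F (rV_cons (s, y))).
  by apply: measurableT_comp => //; exact: measurableT_comp.
have mv : measurable_fun setT (fun x : 'rV[R]_n.+1 => x + v).
  apply: measurable_fun_rVP => i.
  rewrite (_ : (fun _ => _) = fun x : 'rV[R]_n.+1 => x ord0 i + v ord0 i).
    by apply: meas_add; [exact: measurable_rV_coord|exact: meas_cst].
  by apply/funext => x; rewrite mxE.
rewrite !integral_rVS//; last exact: (measurableT_comp mF mv).
rewrite -(@integral_shift1 (v ord0 ord0) (fun s => \int[_]_y F (rV_cons (s, y))))%E; last 2 first.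
- apply: (@measurable_fun_fubini_tonelli_F _ _ _ _ _ (@lebesgue_rV R n) (F \o (@rV_cons R n))) => //=.
  exact: measurableT_comp.
- by move=> s; apply: integral_ge0.
apply: eq_integral => s _.
rewrite -[RHS](IH (rV_tail v)) => //; apply: eq_integral => y _; congr F.
by rewrite -[in LHS](rV_cons_tail v) rV_consD.
Qed.

End translation.

Section basics.
Context {R : realType}.
Local Notation mu n := (@lebesgue_rV R n).

Lemma rint_rVSP n (f : 'rV[R]_n.+1 -> R) :
  rint (@lebesgue_measure R \x mu n)%E (fun p => f (rV_cons p)) -> measurable_fun setT f ->
  rint (mu n.+1) f.
Proof.
move=> fi mf; apply: rint_ltyP => //.
rewrite integral_rVS//; last exact/measurable_EFinP/meas_norm.
have := rint_lty fi; rewrite fubini_tonelli1//.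
by apply/measurable_EFinP; apply: meas_norm; exact: (rint_meas fi).
Qed.

Lemma rint_tensor n (f : 'rV[R]_n.+1 -> R) (p : R -> R) (q : 'rV[R]_n -> R) :
  rint (@lebesgue_measure R) p -> rint (mu n) q ->
  measurable_fun setT f ->
  (forall s y, f (rV_cons (s, y)) = p s * q y) ->
  rint (mu n.+1) f /\ \int[mu n.+1]_x f x =
    (\int[@lebesgue_measure R]_s p s) * (\int[mu n]_y q y).
Proof.
move=> ip iq mf fE.
have mfc : measurable_fun setT (fun z => f (rV_cons z)).
  exact: (measurableT_comp mf (@measurable_rV_cons R n)).
have ifc : rint (@lebesgue_measure R \x mu n)%E (fun z => f (rV_cons (z.1, z.2))).
  apply: (@rint_prod _ _ _ _ _ (@lebesgue_measure R) (mu n) (fun s y => f (rV_cons (s, y))) (fun s => `|p s| * \int[mu n]_y `|q y|)).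
  - by apply: (eq_measurable_fun (fun z => f (rV_cons z))) => // -[].
  - under eq_fun do rewrite mulrC; apply: rintZ; exact: rint_norm.
  - move=> s; under eq_integral do rewrite fE normrM.
    under eq_integral do rewrite -/(_ * _)%R EFinM.
    rewrite ge0_integralZl//; last by apply/measurable_EFinP; apply: meas_norm; exact: (rint_meas iq).
    by rewrite EFinM -rintE//; exact: rint_norm.
have ifc' : rint (@lebesgue_measure R \x mu n)%E (fun z => f (rV_cons z)).
  by apply: eq_integrable ifc => // -[].
split; first exact: rint_rVSP.
have -> : \int[mu n.+1]_x f x = fine (\int[pushforward (@lebesgue_measure R \x^ mu n) (@rV_cons R n)]_x (f x)%:E)%E by [].
rewrite integral_pushforward//; last 3 first.
- exact: measurable_rV_cons.
- exact/measurable_EFinP.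
- rewrite preimage_setT; apply/integrableP; split; first exact/measurable_EFinP.
  by rewrite integral_prod2; have /integrableP[] := ifc'.
rewrite preimage_setT integral_prod2 -integral12_prod_meas1//.
have E s : fubini_F (mu n) (EFin \o f \o @rV_cons R n) s = ((p s) * \int[mu n]_y q y)%:E.
  rewrite /fubini_F/=; under eq_integral do rewrite fE EFinM.
  by rewrite integralZl// EFinM -rintE.
transitivity (fine (\int[@lebesgue_measure R]_s (p s * \int[mu n]_y q y)%:E)%E).
  by congr fine; apply: eq_integral => s _; exact: E.
by rewrite -RintegralZr.
Qed.


Lemma rintegral_shift n (v : 'rV[R]_n) (f : 'rV[R]_n -> R) : rint (mu n) f ->
  rint (mu n) (fun x => f (x + v)) /\ \int[mu n]_x f (x + v) = \int[mu n]_x f x.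
Proof.
move=> fi; have mf := rint_meas fi.
have mv : measurable_fun setT (fun x : 'rV[R]_n => x + v).
  apply: measurable_fun_rVP => i.
  rewrite (_ : (fun _ => _) = fun x : 'rV[R]_n => x ord0 i + v ord0 i).
    by apply: meas_add; [exact: measurable_rV_coord|exact: meas_cst].
  by apply/funext => x; rewrite mxE.
split.
  apply: rint_ltyP; first exact: (measurableT_comp mf mv).
  rewrite (@integral_shift _ _ v (fun x => `|f x|%:E))//; first exact: rint_lty.
  exact/measurable_EFinP/meas_norm.
rewrite /Rintegral; congr fine; rewrite [LHS]integralE [RHS]integralE.
have mf' : measurable_fun setT (fun x => (f x)%:E) by exact/measurable_EFinP.
have Hp := integral_shift v (measurable_funepos mf') (fun x => funepos_ge0 _ x).
have Hn := integral_shift v (measurable_funeneg mf') (fun x => funeneg_ge0 _ x).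
by congr (_ - _)%E; [apply: etrans Hp|apply: etrans Hn]; apply: eq_integral => x _; rewrite ?funeposE ?funenegE.
Qed.

Lemma rV_continuous_measurable n (f : 'rV[R]_n -> R) : continuous f ->
  measurable_fun setT f.
Proof.
move=> cf.
pose q (k : nat) (x : 'rV[R]_n) : 'rV[int]_n := \row_j Num.floor (x ord0 j * k.+1%:R).
pose g (k : nat) (u : 'rV[int]_n) : 'rV[R]_n := \row_j ((u ord0 j)%:~R / k.+1%:R).
apply: (@measurable_fun_cvg _ _ _ setT (fun k x => f (g k (q k x)))).
  move=> k _ Y mY; rewrite setTI.
  rewrite (_ : _ @^-1` Y = \bigcup_u (if pselect (Y (f (g k u))) then [set x | q k x = u] else set0)); last first.
    apply/seteqP; split => [x Yx|x [u _]].
      by exists (q k x) => //; case: pselect.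
    by case: pselect => //= Yu qx; rewrite qx.
  apply: countable_bigcupT_measurable => [|u]; first exact: countableP.
  case: pselect => [Yu|nYu] /=; last exact: measurable0.
  have -> : [set x | q k x = u] = \bigcap_(j in [set: 'I_n])
      [set x : 'rV[R]_n | x ord0 j * k.+1%:R \in `[(u ord0 j)%:~R, (u ord0 j + 1)%:~R[ ].
    apply/seteqP; split => [x <- j _|x h].
      by rewrite /= in_itv/= mxE real_floor_itv ?num_real.
    apply/rowP => j; rewrite mxE; apply: floor_def.
    by have := h j I; rewrite /= in_itv/=.
  apply: fin_bigcap_measurable => // j _.
  rewrite -[X in measurable X]setTI.
  have m : measurable_fun setT (fun x : 'rV[R]_n => x ord0 j * k.+1%:R).
    by apply: meas_mul; [exact: measurable_rV_coord|exact: meas_cst].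
  by have := m measurableT _ (measurable_itv `[(u ord0 j)%:~R, (u ord0 j + 1)%:~R[).
move=> x _; apply: (@cvg_comp _ _ _ (fun k => g k (q k x)) f _ (nbhs x) _ _ (cf x)).
apply/cvg_ballP => e e0; near=> k; split => // i j.
rewrite ord1 /ball/= !mxE.
have k0 : 0 < k.+1%:R :> R by rewrite ltr0n.
have /andP[h1 h2] := real_floor_itv (num_real (x ord0 j * k.+1%:R)).
rewrite -[X in `|X - _|](mulfK (lt0r_neq0 k0)) -mulrBl normrM normfV (gtr0_norm k0).
rewrite ger0_norm ?subr_ge0// ltr_pdivrMr//.
have ke : 1 <= e * k.+1%:R.
  rewrite -ler_pdivrMr// div1r ltW//; near: k.
  exact: (near_infty_natSinv_lt (PosNum e0)).
apply: lt_le_trans ke; rewrite ltrBlDl; apply: lt_le_trans h2 _.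
by rewrite intrD.
Unshelve. all: by end_near. Qed.

Definition Q n (x : 'rV[R]_n) : R := 1 + dotp x x.

Lemma dotp_cons n (s t : R) (x y : 'rV[R]_n) :
  dotp (rV_cons (s, x)) (rV_cons (t, y)) = s * t + dotp x y.
Proof.
rewrite /dotp big_ord_recl !rV_cons0/=; congr (_ + _).
by apply: eq_bigr => j _; rewrite !rV_consS.
Qed.

Lemma dotpC n (x y : 'rV[R]_n) : dotp x y = dotp y x.
Proof. by apply: eq_bigr => j _; rewrite mulrC. Qed.

Lemma dotpDl n (x y z : 'rV[R]_n) : dotp (x + y) z = dotp x z + dotp y z.
Proof. by rewrite /dotp -big_split/=; apply: eq_bigr => j _; rewrite mxE mulrDl. Qed.

Lemma dotpNl n (x z : 'rV[R]_n) : dotp (- x) z = - dotp x z.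
Proof. by rewrite /dotp -sumrN; apply: eq_bigr => j _; rewrite mxE mulNr. Qed.

Lemma dotpDr n (x y z : 'rV[R]_n) : dotp z (x + y) = dotp z x + dotp z y.
Proof. by rewrite dotpC dotpDl !(dotpC z). Qed.

Lemma dotpNr n (x z : 'rV[R]_n) : dotp z (- x) = - dotp z x.
Proof. by rewrite dotpC dotpNl (dotpC z). Qed.

Lemma dotpNN n (x : 'rV[R]_n) : dotp (- x) (- x) = dotp x x.
Proof. by rewrite dotpNl dotpNr opprK. Qed.

Lemma dotp_ge0 n (x : 'rV[R]_n) : 0 <= dotp x x.
Proof. by apply: sumr_ge0 => j _; rewrite -expr2 sqr_ge0. Qed.

Lemma Q_ge1 n (x : 'rV[R]_n) : 1 <= Q x.
Proof. by rewrite /Q lerDl dotp_ge0. Qed.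

Lemma Q_gt0 n (x : 'rV[R]_n) : 0 < Q x.
Proof. exact: lt_le_trans ltr01 (Q_ge1 x). Qed.

Lemma Q_ge0 n (x : 'rV[R]_n) : 0 <= Q x.
Proof. exact/ltW/Q_gt0. Qed.

Lemma meas_dotp d (T : measurableType d) n (f g : T -> 'rV[R]_n) :
  measurable_fun setT f -> measurable_fun setT g ->
  measurable_fun setT (fun t => dotp (f t) (g t)).
Proof.
move=> mf mg; rewrite /dotp; apply: meas_sum => i; apply: meas_mul.
  exact: (measurableT_comp (@measurable_rV_coord R n i) mf).
exact: (measurableT_comp (@measurable_rV_coord R n i) mg).
Qed.

Lemma meas_Q n : measurable_fun setT (@Q n).
Proof. by apply: meas_add; [exact: meas_cst|exact: meas_dotp]. Qed.

Lemma rint_Q1 : rint (@lebesgue_measure R) (fun s => (1 + s ^+ 2)^-1).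
Proof.
have c : continuous (fun s : R => (1 + s ^+ 2)^-1) by exact: continuous_oneDsqrV.
apply: rint_ltyP; first exact: continuous_measurable_fun.
under eq_integral => s _ do rewrite ger0_norm ?invr_ge0 ?addr_ge0 ?sqr_ge0//.
rewrite ge0_symfun_integralT//; last 2 first.
- by move=> s; rewrite invr_ge0 addr_ge0 ?sqr_ge0.
- by move=> s; rewrite /= sqrrN.
rewrite -set_itvcy.
rewrite (_ : (\int[_]_(x in _) _)%E = (pi / 2)%:E); last exact: integral0y_oneDsqr.
by rewrite -EFinM ltry.
Qed.

Lemma rint_Q n : rint (mu n) (fun x => (Q x) ^- n).
Proof.
elim: n => [|n IH].
  rewrite (_ : (fun _ => _) = cst 1); last by apply/funext => x; rewrite expr0 invr1.
  apply: rint_ltyP => //; rewrite (eq_integral (cst 1%:E)); last by move=> x _; rewrite /= normr1.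
  by rewrite integral_cst//= mul1e diracE in_setT ltry.
have [] := @rint_tensor n (fun x => (1 + x ord0 ord0 ^+ 2)^-1 * (Q (rV_tail x)) ^- n) _ _ rint_Q1 IH.
- apply: meas_mul; apply: meas_inv.
  + by move=> x; rewrite addr_ge0 ?sqr_ge0.
  + by apply: meas_add; [exact: meas_cst|apply: meas_exp; exact: measurable_rV_coord].
  + by move=> x; rewrite exprn_ge0 ?Q_ge0.
  + by apply: meas_exp; exact: (measurableT_comp (@meas_Q n) (@measurable_rV_tail R n)).
- by move=> s y; rewrite rV_cons0 rV_tail_cons.
move=> ii _; apply: rint_le ii _.
  apply: meas_inv; last by apply: meas_exp; exact: meas_Q.
  by move=> x; rewrite exprn_ge0 ?Q_ge0.
move=> x; rewrite ger0_norm; last by rewrite invr_ge0 exprn_ge0 ?Q_ge0.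
rewrite -invfM lef_pV2 ?posrE ?mulr_gt0 ?exprn_gt0 ?Q_gt0//; last first.
  by rewrite ltr_wpDr ?sqr_ge0.
rewrite -[x in leRHS]rV_cons_tail [leRHS]exprS; apply: ler_pM.
- by rewrite addr_ge0 ?sqr_ge0.
- by rewrite exprn_ge0 ?Q_ge0.
- by rewrite /Q dotp_cons expr2 lerD2l lerDl dotp_ge0.
apply: lerXn2r; rewrite ?nnegrE ?Q_ge0//.
by rewrite /Q dotp_cons lerD2l lerDr -expr2 sqr_ge0.
Qed.

Lemma rint_QX n k : (n <= k)%N -> rint (mu n) (fun x => (Q x) ^- k).
Proof.
move=> nk; apply: rint_le (rint_Q n) _.
  apply: meas_inv; last by apply: meas_exp; exact: meas_Q.
  by move=> x; rewrite exprn_ge0 ?Q_ge0.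
move=> x; rewrite ger0_norm; last by rewrite invr_ge0 exprn_ge0 ?Q_ge0.
rewrite lef_pV2 ?posrE ?exprn_gt0 ?Q_gt0//.
by apply: ler_weXn2l => //; exact: Q_ge1.
Qed.

Lemma ae_neq0 n : {ae mu n.+1, forall x, dotp x x != 0}.
Proof.
have m0 : measurable [set x : 'rV[R]_n.+1 | x ord0 ord0 = 0].
  rewrite -[X in measurable X]setTI.
  exact: (@measurable_rV_coord R n.+1 ord0 measurableT _ (measurable_set1 0)).
exists [set x : 'rV[R]_n.+1 | x ord0 ord0 = 0]; split => //.
  rewrite /= /pushforward (_ : _ @^-1` _ = [set 0 : R] `*` setT); last first.
    by apply/seteqP; split => [[s y]|[s y]]; rewrite /= rV_cons0//= => -[].
  by rewrite product_measure2E//= ?lebesgue_measure_set1 ?mul0e.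
move=> x /= /negP; rewrite negbK => /eqP h; apply/eqP.
have := h; rewrite -[x]rV_cons_tail dotp_cons rV_cons0/= => /eqP.
by rewrite paddr_eq0 ?dotp_ge0 -?expr2 ?sqr_ge0// sqrf_eq0 => /andP[].
Qed.

End basics.

Ltac measd := repeat (first [ progress meas | exact: measurable_cst
  | apply: meas_dotp | apply: meas_Q ]).

Section der.
Context {R : realType}.
Implicit Types (f g : R -> R) (x df dg : R).

Lemma drv_eq f x df dg : is_derive x 1 f df -> df = dg -> is_derive x 1 f dg.
Proof. by move=> h <-. Qed.

Lemma drv_cst c x : is_derive x 1 (fun=> c : R) 0.
Proof. exact: is_derive_cst. Qed.

Lemma drv_id x : is_derive x 1 (fun y : R => y) 1.
Proof. exact: is_derive_id. Qed.

Lemma drv_add f g x df dg : is_derive x 1 f df -> is_derive x 1 g dg ->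
  is_derive x 1 (fun y => f y + g y) (df + dg).
Proof. by move=> hf hg; exact: is_deriveD. Qed.

Lemma drv_mul f g x df dg : is_derive x 1 f df -> is_derive x 1 g dg ->
  is_derive x 1 (fun y => f y * g y) (df * g x + f x * dg).
Proof.
move=> hf hg; apply: (drv_eq (@is_deriveM _ _ f g x 1 df dg hf hg)).
by rewrite /GRing.scale/= addrC mulrC.
Qed.

Lemma drv_opp f x df : is_derive x 1 f df -> is_derive x 1 (fun y => - f y) (- df).
Proof. by move=> hf; exact: is_deriveN. Qed.

Lemma drv_comp (h : R -> R) f x df dh : is_derive (f x) 1 h dh -> is_derive x 1 f df ->
  is_derive x 1 (fun y => h (f y)) (dh * df).
Proof. by move=> hh hf; exact: is_derive1_comp. Qed.

Lemma drv_exp f x df : is_derive x 1 f df ->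
  is_derive x 1 (fun y => expR (f y)) (expR (f x) * df).
Proof. by move=> hf; exact: (drv_comp (is_derive_expR _) hf). Qed.

Lemma drv_cos f x df : is_derive x 1 f df ->
  is_derive x 1 (fun y => cos (f y)) (- sin (f x) * df).
Proof. by move=> hf; exact: (drv_comp (is_derive_cos _) hf). Qed.

Lemma drv_sin f x df : is_derive x 1 f df ->
  is_derive x 1 (fun y => sin (f y)) (cos (f x) * df).
Proof. by move=> hf; exact: (drv_comp (is_derive_sin _) hf). Qed.

Lemma drv_cvg f x df : is_derive x 1 f df -> {for x, continuous f}.
Proof.
move=> h; have d : derivable f x 1 by case: h.
exact/differentiable_continuous/derivable1_diffP.
Qed.

Lemma drv_continuous f (df : R -> R) : (forall x, is_derive x 1 f (df x)) -> continuous f.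
Proof.
move=> h x; have d : derivable f x 1 by case: (h x).
exact/differentiable_continuous/derivable1_diffP.
Qed.

(* the integral over the line of a derivative vanishing at infinity *)
Lemma rintegral_der0 f (df : R -> R) : (forall x, is_derive x 1 f (df x)) ->
  continuous df -> rint (@lebesgue_measure R) df ->
  (fun n : nat => f n%:R - f (- n%:R)) @ \oo --> 0 ->
  \int[@lebesgue_measure R]_x df x = 0.
Proof.
move=> hf cdf idf f0.
pose k n x := df x * \1_(`[- n.+1%:R, n.+1%:R]%classic : set R) x.
have mI n : measurable_fun setT (\1_(`[- n.+1%:R, n.+1%:R]%classic : set R) : R -> R).
  exact: measurable_indic.
have [||||_ h] := @rint_dct _ _ _ (@lebesgue_measure R) k df (fun x => `|df x|).
- by move=> n; apply: meas_mul => //; exact: continuous_measurable_fun.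
- exact: rint_norm.
- move=> x; apply: cvg_near_cst; near=> n.
  rewrite /k indicE mem_set ?mulr1//= in_itv/= -ler_norml.
  near: n; exists (Num.truncn `|x|) => // n /= hn.
  by rewrite (le_trans (ltW (truncnS_gt _)))// ler_nat ltnS.
- by move=> n x; rewrite /k normrM indicE; case: (_ \in _); rewrite ?normr1 ?normr0 ?mulr1 ?mulr0.
have E n : \int[@lebesgue_measure R]_x k n x = f n.+1%:R - f (- n.+1%:R).
  have lt : - n.+1%:R < n.+1%:R :> R by rewrite gtrN.
  have cf := drv_continuous hf.
  have FTC := @continuous_FTC2 R df f _ _ lt (continuous_subspaceT cdf).
  rewrite /Rintegral.
  rewrite (_ : (\int[_]_x _)%E = (f n.+1%:R)%:E - (f (- n.+1%:R))%:E)%E//.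
  rewrite -FTC; last 2 first.
  - split; first by move=> x _; case: (hf x).
      by apply: cvg_at_right_filter; exact: cf.
    by apply: cvg_at_left_filter; exact: cf.
  - by move=> x _; rewrite derive1E; case: (hf x).
  rewrite [RHS]integral_mkcond; apply: eq_integral => x _.
  rewrite /k patchE indicE; case: ifPn => [xi|xi]; first by rewrite ?xi mulr1.
  by rewrite ?(negbTE xi) mulr0.
apply: (cvg_unique (@Rhausdorff R) h).
rewrite (_ : (fun n => _) = (fun n => f n.+1%:R - f (- n.+1%:R))); last by apply/funext.
by have := f0; rewrite -(cvg_shiftS (fun n : nat => f n%:R - f (- n%:R))).
Unshelve. all: by end_near. Qed.

End der.

Section gauss1.
Context {R : realType}.
Local Notation leb := (@lebesgue_measure R).

Definition g1 (a x : R) : R := expR (- (a * x ^+ 2 / 2)).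
Definition gc (a : R) : R := Num.sqrt (2 * pi / a).

Lemma gc_gt0 a : 0 < a -> 0 < gc a.
Proof. by move=> a0; rewrite sqrtr_gt0 divr_gt0// mulr_gt0// pi_gt0. Qed.

Lemma gcV a : 0 < a -> gc a * gc a^-1 = 2 * pi.
Proof.
move=> a0; have p0 : 0 <= 2 * pi :> R by rewrite mulr_ge0 ?pi_ge0.
rewrite /gc -sqrtrM ?divr_ge0 ?(ltW a0)//.
have -> : 2 * pi / a * (2 * pi / a^-1) = (2 * pi) ^+ 2 by field; rewrite gt_eqF.
by rewrite sqrtr_sqr ger0_norm.
Qed.

Lemma meas_g1 a : measurable_fun setT (g1 a).
Proof.
apply: meas_expR; apply: meas_opp; apply: meas_mul; last exact: meas_cst.
by apply: meas_mul; [exact: meas_cst|apply: meas_exp; exact: measurable_id].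
Qed.

Lemma g1_ge0 a x : 0 <= g1 a x. Proof. exact: expR_ge0. Qed.

Lemma drv_g1 (a x : R) : is_derive x 1 (g1 a) (- (a * x) * g1 a x).
Proof.
have h := drv_opp (drv_mul (drv_cst (a / 2) x) (drv_mul (drv_id x) (drv_id x))).
rewrite /g1 (_ : (fun y => expR _) = (fun y => expR (- (a / 2 * (y * y))))).
  apply: drv_eq (drv_exp h) _ => /=.
  rewrite (_ : a * x ^+ 2 / 2 = a / 2 * (x * x)); last by field.
  by field.
by apply/funext => y; congr expR; field.
Qed.

Lemma int_g1 a : 0 < a -> rint leb (g1 a) /\ \int[leb]_x g1 a x = gc a.
Proof.
move=> a0; pose s := Num.sqrt a^-1.
have s0 : s != 0 by rewrite gt_eqF// sqrtr_gt0 invr_gt0.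
have s2 : s ^+ 2 = a^-1 by rewrite sqr_sqrtr// invr_ge0 ltW.
have E x : g1 a x = gc a * normal_pdf 0 s x.
  rewrite normal_pdfE// /normal_peak /normal_fun s2 subr0 mulrA.
  rewrite (_ : (_ * pi *+ 2) = 2 * pi / a); last by field; rewrite gt_eqF.
  rewrite divff ?mul1r ?gt_eqF ?gc_gt0// /g1; congr expR.
  by field; rewrite gt_eqF.
have i : rint leb (normal_pdf 0 s) by exact: integrable_normal_pdf.
split; first by rewrite (_ : g1 a = fun x => gc a * normal_pdf 0 s x); [exact: rintZ|exact/funext].
under eq_Rintegral do rewrite E.
by rewrite RintegralZl// /Rintegral integral_normal_pdf mulr1.
Qed.

Lemma g1_lin a x : 0 < a -> `|x| * g1 a x <= (1 + 4 / a) * g1 (a / 2) x.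
Proof.
move=> a0.
have -> : g1 a x = expR (- (a * x ^+ 2 / 4)) * g1 (a / 2) x.
  by rewrite /g1 -expRD; congr expR; field.
rewrite mulrA; apply: ler_wpM2r; first exact: g1_ge0.
rewrite expRN -ler_pdivlMr ?invr_gt0 ?expR_gt0// invrK.
have h1 : `|x| <= 1 + x ^+ 2.
  have h1 := sqr_ge0 (x - 1); have h2 := sqr_ge0 (x + 1).
  by rewrite ler_norml; apply/andP; split; nra.
apply: (le_trans h1).
have h2 := expR_ge1Dx (a * x ^+ 2 / 4).
apply: le_trans (ler_wpM2l _ h2); last by rewrite addr_ge0// divr_ge0// ltW.
rewrite (_ : (1 + 4 / a) * (1 + a * x ^+ 2 / 4) = 1 + x ^+ 2 + 4 / a + a * x ^+ 2 / 4); last by field; rewrite gt_eqF.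
have a0' := ltW a0.
by rewrite -addrA lerDl addr_ge0 ?divr_ge0 // mulr_ge0// sqr_ge0.
Qed.

Lemma int_g1_cos (a b z : R) : 0 < a ->
  \int[leb]_y (g1 a y * cos (y * z + b)) = cos b * gc a * g1 a^-1 z.
Proof.
move=> a0; have [ig Ig] := int_g1 a0.
have mlin (u : R) : measurable_fun setT (fun y : R => y * u + b).
  by meas.
have icos u : rint leb (fun y => g1 a y * cos (y * u + b)).
  apply: rint_le ig _; first by meas; exact: meas_g1.
  by move=> x; rewrite normrM (ger0_norm (g1_ge0 _ _)) ler_piMr ?g1_ge0// cos_max.
have [ig2 _] := @int_g1 (a / 2) (divr_gt0 a0 (ltr0Sn _ 1)).
have ix : rint leb (fun y => (1 + 4 / a) * g1 (a / 2) y) by exact: rintZ.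
have isin u : rint leb (fun y => y * g1 a y * sin (y * u + b)).
  apply: rint_le ix _.
    by meas; exact: meas_g1.
  move=> x; rewrite normrM; apply: le_trans (g1_lin x a0).
  by rewrite normrM (ger0_norm (g1_ge0 _ _)) ler_piMr ?mulr_ge0 ?g1_ge0// sin_max.
pose F u := \int[leb]_y (g1 a y * cos (y * u + b)).
have dlin y (u : R) : is_derive u 1 (fun u : R => y * u + b) y.
  by apply: drv_eq (drv_add (drv_mul (drv_cst y u) (drv_id u)) (drv_cst b u)) _ => /=; ring.
have dcos y (u : R) : is_derive u 1 (fun u => g1 a y * cos (y * u + b)) (- (y * g1 a y * sin (y * u + b))).
  by apply: drv_eq (drv_mul (drv_cst (g1 a y) u) (drv_cos (dlin y u))) _ => /=; ring.
have dF u : is_derive (u : R) 1 F (- (u / a) * F u).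
  have Iu : `]u - 1, u + 1[%classic u by rewrite /= in_itv/= ltrBlDr !ltrDl ltr01.
  have G0 y : 0 <= (1 + 4 / a) * g1 (a / 2) y.
    by rewrite mulr_ge0 ?g1_ge0// addr_ge0// divr_ge0// ltW.
  pose f (u y : R) := g1 a y * cos (y * u + b).
  have derf1 (x y : R) : (`]u - 1, u + 1[%classic : set R) x -> setT y -> derivable (f^~ y) x 1.
    by move=> _ _; case: (dcos y x).
  have d1 x y : partial1of2 f x y = - (y * g1 a y * sin (y * x + b)).
    by rewrite partial1of2E; case: (dcos y x).
  have ub x y : (`]u - 1, u + 1[%classic : set R) x -> setT y ->
      `|partial1of2 f x y| <= (1 + 4 / a) * g1 (a / 2) y.
    move=> _ _; rewrite d1 normrN normrM; apply: le_trans (g1_lin y a0).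
    by rewrite normrM (ger0_norm (g1_ge0 _ _)) ler_piMr ?mulr_ge0 ?g1_ge0// sin_max.
  have h1 := differentiation_under_integral measurableT Iu (fun x _ => icos x) derf1 G0 ix ub.
  have h2 := derivable_under_integral measurableT Iu (fun x _ => icos x) derf1 G0 ix ub.
  apply: DeriveDef; first exact: h2.
  rewrite -derive1E [LHS]h1; under eq_Rintegral do rewrite d1.
  (* integration by parts *)
  pose h y := g1 a y * sin (y * u + b).
  have dh y : is_derive (y : R) 1 h (- a * (y * g1 a y * sin (y * u + b)) + u * (g1 a y * cos (y * u + b))).
    have l : is_derive (y : R) 1 (fun y : R => y * u + b) u.
      by apply: drv_eq (drv_add (drv_mul (drv_id y) (drv_cst u y)) (drv_cst b y)) _ => /=; ring.
    by apply: drv_eq (drv_mul (drv_g1 a y) (drv_sin l)) _ => /=; ring.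
  have := rintegral_der0 dh.
  rewrite RintegralD//; last 2 first.
  - by apply: rintZ; exact: isin.
  - by apply: rintZ; exact: icos.
  rewrite (RintegralZl _ measurableT (isin u)) (RintegralZl _ measurableT (icos u)) => H.
  have {}H : - a * \int[leb]_y (y * g1 a y * sin (y * u + b)) + u * F u = 0.
    apply: H.
    - move=> y; have l : is_derive (y : R) 1 (fun y : R => y * u + b) u.
        by apply: drv_eq (drv_add (drv_mul (drv_id y) (drv_cst u y)) (drv_cst b y)) _ => /=; ring.
      apply: drv_cvg (drv_add (drv_mul (drv_cst (- a) y) (drv_mul (drv_mul (drv_id y) (drv_g1 a y)) (drv_sin l)))
        (drv_mul (drv_cst u y) (drv_mul (drv_g1 a y) (drv_cos l)))).
    - by apply: rintD; apply: rintZ; [exact: isin|exact: icos].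
    - have hb y : `|h y| <= g1 a y.
        by rewrite normrM (ger0_norm (g1_ge0 _ _)) ler_piMr ?g1_ge0// sin_max.
      have gn (n : nat) : g1 a n%:R <= (expR (- (a / 2))) ^+ n.
        rewrite /g1 -expRM_natl ler_expR mulrN lerN2 mulrAC mulrC -natrX ler_wpM2l//.
          by rewrite divr_ge0// ltW.
        by rewrite ler_nat; case: n => // n; rewrite expnS leq_pmulr// expn_gt0.
      have g0 : (fun n : nat => (expR (- (a / 2))) ^+ n *+ 2) @ \oo --> 0.
        rewrite -(mul0rn _ 2); apply: cvgMn; apply: cvg_expr.
        by rewrite ger0_norm ?expR_ge0// expR_lt1 oppr_lt0 divr_gt0.
      apply/norm_cvg0P; apply: (squeeze_cvgr _ (cvg_cst 0) g0).
      apply: nearW => n; rewrite normr_ge0/= (le_trans (ler_normB _ _))// mulr2n.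
      apply: lerD; rewrite (le_trans (hb _))//.
      by rewrite /g1 sqrrN; exact: gn.
  rewrite (_ : (fun y => _) = (fun y => -1 * (y * g1 a y * sin (y * u + b)))); last by apply/funext => y; rewrite mulN1r.
  rewrite (RintegralZl _ measurableT (isin u)) mulN1r.
  have -> : \int[leb]_y (y * g1 a y * sin (y * u + b)) = u * F u / a.
    by apply: (mulfI (lt0r_neq0 a0)); move: H => /eqP; rewrite mulNr addrC subr_eq0 => /eqP <-; field; rewrite gt_eqF.
  by rewrite mulrAC mulNr.
have Fd (u : R) : is_derive u 1 (fun u => F u * g1 (- a^-1) u) 0.
  apply: drv_eq (drv_mul (dF u) (drv_g1 _ u)) _.
  by field; rewrite gt_eqF.
have := is_derive_0_is_cst z 0 Fd.
rewrite /g1 expr0n/= mulr0 mul0r oppr0 expR0 mulr1 {2}/F.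
under [in RHS]eq_Rintegral do rewrite mulr0 add0r.
rewrite (RintegralZr _ measurableT ig) Ig => H.
rewrite -/(F z) [RHS]mulrC.
by rewrite (mulrC (cos b)) -H mulrCA -expRD [X in expR X](_ : _ = 0) ?expR0 ?mulr1//; field; rewrite gt_eqF.
Qed.

End gauss1.

Section gaussn.
Context {R : realType}.
Local Notation mu n := (@lebesgue_rV R n).

Definition gn (a : R) n (x : 'rV[R]_n) : R := expR (- (a * dotp x x / 2)).

Lemma gn_ge0 a n (x : 'rV[R]_n) : 0 <= gn a x. Proof. exact: expR_ge0. Qed.

Lemma meas_gn a n : measurable_fun setT (@gn a n).
Proof. by rewrite /gn; meas; exact: meas_dotp. Qed.

Lemma gn_cons a n (s : R) (y : 'rV[R]_n) : gn a (rV_cons (s, y)) = g1 a s * gn a y.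
Proof. by rewrite /gn/g1 dotp_cons -expRD; congr expR; field. Qed.

Lemma int_gn a n : 0 < a -> rint (mu n) (@gn a n) /\ \int[mu n]_x gn a x = gc a ^+ n.
Proof.
move=> a0; elim: n => [|n [IH1 IH2]].
  have E (x : 'rV[R]_0) : gn a x = 1.
    by rewrite /gn /dotp big_ord0 mulr0 mul0r oppr0 expR0.
  have -> : @gn a 0 = cst 1 by apply/funext => x; rewrite E.
  split.
    apply: rint_ltyP => //; rewrite (eq_integral (cst 1%:E)); last by move=> x _; rewrite /= normr1.
    by rewrite integral_cst//= mul1e diracE in_setT ltry.
  by rewrite Rintegral_cst//= indicE in_setT mulr1 expr0.
have [i1 I1] := int_g1 a0.
have [h1 h2] := rint_tensor i1 IH1 (@meas_gn a n.+1) (@gn_cons a n).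
by split => //; rewrite h2 I1 IH2 exprS.
Qed.

Lemma rint_gn_cos a n (b : R) (z : 'rV[R]_n) : 0 < a ->
  rint (mu n) (fun x => gn a x * cos (dotp x z + b)).
Proof.
move=> a0; have [i _] := int_gn n a0; apply: rint_le i _.
  by measd; exact: meas_gn.
by move=> x; rewrite normrM (ger0_norm (gn_ge0 _ _)) ler_piMr ?gn_ge0// cos_max.
Qed.

Lemma int_gn_cos a n (b : R) (z : 'rV[R]_n) : 0 < a ->
  \int[mu n]_x (gn a x * cos (dotp x z + b)) = cos b * gc a ^+ n * gn a^-1 z.
Proof.
move=> a0; elim: n b z => [|n IH] b z.
  rewrite (@eq_Rintegral _ _ _ _ _ (fun=> cos b)); last first.
    by move=> x _; rewrite /gn /dotp !big_ord0 mulr0 mul0r oppr0 expR0 mul1r add0r.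
  rewrite Rintegral_cst//= indicE in_setT.
  by rewrite /gn /dotp big_ord0 mulr0 mul0r oppr0 expR0 !mulr1.
rewrite -(rV_cons_tail z); set z0 := z _ _; set z' := rV_tail z.
have [i1 _] := int_g1 a0.
have mlin (c : R) : measurable_fun setT (fun y : R => y * z0 + c) by meas.
have ic c : rint (@lebesgue_measure R) (fun s => g1 a s * cos (s * z0 + c)).
  apply: rint_le i1 _; first by meas; exact: meas_g1.
  by move=> x; rewrite normrM (ger0_norm (g1_ge0 _ _)) ler_piMr ?g1_ge0// cos_max.
have T c1 c2 := @rint_tensor R n
  (fun x => g1 a (x ord0 ord0) * cos (x ord0 ord0 * z0 + c1) * (gn a (rV_tail x) * cos (dotp (rV_tail x) z' + c2)))
  _ _ (ic c1) (rint_gn_cos c2 z' a0).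
have {}T c1 c2 : rint (mu n.+1) (fun x => g1 a (x ord0 ord0) * cos (x ord0 ord0 * z0 + c1) * (gn a (rV_tail x) * cos (dotp (rV_tail x) z' + c2))) /\
  \int[mu n.+1]_x (g1 a (x ord0 ord0) * cos (x ord0 ord0 * z0 + c1) * (gn a (rV_tail x) * cos (dotp (rV_tail x) z' + c2))) =
  cos c1 * gc a * g1 a^-1 z0 * (cos c2 * gc a ^+ n * gn a^-1 z').
  have [||h1 h2] := T c1 c2.
  - have mt := @measurable_rV_tail R n.
    have m0 := @measurable_rV_coord R n.+1 ord0.
    by measd.
  - by move=> s y; rewrite rV_cons0 rV_tail_cons.
  by split => //; rewrite h2 int_g1_cos// IH.
have [h1 I1] := T 0 b; have [h2 I2] := T (- (pi / 2)) b%R.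
have [h3 I3] := T (- (pi / 2)) (b - pi / 2).
rewrite (@eq_Rintegral _ _ _ _ _ (fun x : 'rV[R]_n.+1 =>
  g1 a (x ord0 ord0) * cos (x ord0 ord0 * z0 + 0) * (gn a (rV_tail x) * cos (dotp (rV_tail x) z' + b)) -
  g1 a (x ord0 ord0) * cos (x ord0 ord0 * z0 - pi / 2) * (gn a (rV_tail x) * cos (dotp (rV_tail x) z' + (b - pi / 2))))); last first.
  move=> x _; rewrite -[in LHS](rV_cons_tail x) gn_cons dotp_cons -(addrA (_ * _)) (cosD (x ord0 ord0 * z0)) addr0 (addrA _ b) !cosBpihalf.
  ring.
rewrite RintegralB// I1 I3 cosN cos_pihalf cos0 gn_cons exprS; ring.
Qed.

End gaussn.

Section fatou_le.
Context d (T : measurableType d) (R : realType) (mu : {measure set T -> \bar R}).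

Lemma fatou_le (f_ : nat -> T -> R) (f : T -> R) (C : \bar R) :
  (forall n, measurable_fun setT (f_ n)) -> (forall n x, 0 <= f_ n x) ->
  (forall x, f_ ^~ x @ \oo --> f x) ->
  (forall n, \int[mu]_x (f_ n x)%:E <= C)%E -> (\int[mu]_x (f x)%:E <= C)%E.
Proof.
move=> mf f0 cf fC.
have F := @fatou _ _ _ mu setT measurableT (fun n x => (f_ n x)%:E)
  (fun n => (measurable_EFinP _ _).2 (mf n)) (fun n x _ => f0 n x).
rewrite (_ : (\int[mu]_x (f x)%:E = \int[mu]_x limn_einf (fun n => (f_ n x)%:E))%E).
  apply: (le_trans F); rewrite limn_einf_lim; apply: lime_le; first exact: is_cvg_einfs.
  apply: nearW => n; apply: le_trans (fC n); apply: ereal_inf_lbound.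
  by exists n => /=.
apply: eq_integral => x _.
have c : (fun n => (f_ n x)%:E) @ \oo --> (f x)%:E.
  by apply: cvg_EFin; [exact: nearW|exact: cf].
rewrite is_cvg_limn_einfE; last by apply/cvg_ex; exists (f x)%:E.
by apply/esym/cvg_lim.
Qed.

End fatou_le.

Section fub_bd.
Context d1 d2 (T1 : measurableType d1) (T2 : measurableType d2) (R : realType).
Variable m1 : {sigma_finite_measure set T1 -> \bar R}.
Variable m2 : {sigma_finite_measure set T2 -> \bar R}.

Lemma rint_bd d (T : measurableType d) (m : {measure set T -> \bar R}) (p k : T -> R) :
  rint m p -> measurable_fun setT k -> (forall x, `|k x| <= 1) ->
  rint m (fun x => p x * k x).
Proof.
move=> ip mk k1; apply: rint_le (rint_norm ip) _.
  by meas; exact: rint_meas ip.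
by move=> x; rewrite normrM ler_piMr.
Qed.

Lemma fub_bd (w : T1 -> R) (p : T2 -> R) (k : T1 -> T2 -> R) :
  rint m1 w -> rint m2 p -> measurable_fun setT (fun z => k z.1 z.2) ->
  (forall y x, `|k y x| <= 1) ->
  [/\ rint m1 (fun y => w y * \int[m2]_x (p x * k y x)),
      rint m2 (fun x => p x * \int[m1]_y (w y * k y x)) &
      \int[m1]_y (w y * \int[m2]_x (p x * k y x)) =
      \int[m2]_x (p x * \int[m1]_y (w y * k y x))].
Proof.
move=> iw ip mk k1.
have mk1 y : measurable_fun setT (k y) by exact: (measurableT_comp mk (@pair1_measurable _ _ _ _ y)).
have mk2 x : measurable_fun setT (k ^~ x) by exact: (measurableT_comp mk (@pair2_measurable _ _ _ _ x)).
have i2 y : rint m2 (fun x => p x * k y x) by exact: rint_bd.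
have i1 x : rint m1 (fun y => w y * k y x) by exact: rint_bd.
pose f y x := w y * (p x * k y x).
have mw := rint_meas iw. have mp := rint_meas ip.
have mf : measurable_fun setT (fun z => f z.1 z.2).
  apply: meas_mul; first exact: (measurableT_comp mw measurable_fst).
  by apply: meas_mul => //; exact: (measurableT_comp mp measurable_snd).
have fi : rint (m1 \x m2)%E (fun z => f z.1 z.2).
  apply: (@rint_prod _ _ _ _ _ m1 m2 f (fun y => (\int[m2]_x `|p x|) * `|w y|)) => //.
    by apply: rintZ; exact: rint_norm.
  move=> y; rewrite EFinM -rintE; last exact: rint_norm.
  rewrite muleC -ge0_integralZl//; last by apply/measurable_EFinP; exact: meas_norm.
  apply: ge0_le_integral => //.
  - by apply/measurable_EFinP; apply: meas_norm; meas.
  - by apply/measurable_EFinP; meas.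
  - move=> x _; rewrite -EFinM lee_fin /f !normrM ler_wpM2l// ler_piMr//.
have [||h1 h2 h3] := rint_fubini fi.
- by move=> y; apply: rintZ; exact: i2.
- move=> x; rewrite (_ : f ^~ x = fun y => p x * (w y * k y x)); first by apply: rintZ; exact: i1.
  by apply/funext => y; rewrite /f mulrCA.
have E1 : (fun y => w y * \int[m2]_x (p x * k y x)) = fun y => \int[m2]_x f y x.
  by apply/funext => y; rewrite -RintegralZl//; exact: i2.
have E2 : (fun x => p x * \int[m1]_y (w y * k y x)) = fun x => \int[m1]_y f y x.
  apply/funext => x; rewrite -RintegralZl//; last exact: i1.
  by apply: eq_Rintegral => y _; rewrite /f mulrCA.
by rewrite E1 E2; split.
Qed.

Lemma meas_Rint (p : T2 -> R) (k : T1 -> T2 -> R) :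
  rint m2 p -> measurable_fun setT (fun z => k z.1 z.2) ->
  (forall y x, `|k y x| <= 1) ->
  measurable_fun setT (fun y => \int[m2]_x (p x * k y x)).
Proof.
move=> ip mk k1.
have mk1 y : measurable_fun setT (k y) by exact: (measurableT_comp mk (@pair1_measurable _ _ _ _ y)).
have i2 y : rint m2 (fun x => p x * k y x) by exact: rint_bd.
have mp := measurableT_comp (rint_meas ip) (@measurable_snd _ _ T1 T2).
pose h (z : T1 * T2) := (p z.2 * k z.1 z.2 + `|p z.2|)%:E.
have mh : measurable_fun setT h.
  by apply/measurable_EFinP; apply: meas_add; [exact: meas_mul|exact: meas_norm].
have h0 z : (0 <= h z)%E.
  have : `|p z.2 * k z.1 z.2| <= `|p z.2| by rewrite normrM ler_piMr.
  by rewrite ler_norml lee_fin -lerBlDr sub0r => /andP[].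
have := @measurable_fun_fubini_tonelli_F _ _ _ _ _ m2 h mh h0.
rewrite (_ : fubini_F m2 h = EFin \o (fun y => \int[m2]_x (p x * k y x) + \int[m2]_x `|p x|)); last first.
  apply/funext => y; rewrite /fubini_F/=.
  have in2 := rint_norm ip; have i2y := i2 y.
  by rewrite -RintegralD// -rintE//; apply: rintD.
move=> /measurable_EFinP m.
apply: (eq_measurable_fun (fun y => (\int[m2]_x (p x * k y x) + \int[m2]_x `|p x|) + - \int[m2]_x `|p x|)).
  by move=> y _; rewrite addrK.
by apply: meas_add => //; exact: meas_cst.
Qed.

End fub_bd.

Section bessel.
Context d (X : measurableType d) (R : realType).
Variable mu : {sigma_finite_measure set X -> \bar R}.
Variables (n : nat) (Psi : X -> 'rV[R]_n) (beta a P : X -> R) (B : R).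
Hypothesis mPsi : measurable_fun setT Psi.
Hypothesis mbeta : measurable_fun setT beta.
Hypothesis ma : measurable_fun setT a.
Hypothesis mP : measurable_fun setT P.
Hypothesis ip : rint mu (fun x => a x * P x).
Let K e (z : 'rV[R]_n) := gc e ^+ n * gn e^-1 z.
Hypothesis KB : forall e z, 0 < e ->
  (\int[mu]_x (a x ^+ 2 * K e (z - Psi x))%:E <= B%:E)%E.
Let Y := @lebesgue_rV R n.

Let p x := a x * P x.
Let A y x := dotp y (Psi x) + beta x.
Let F y := \int[mu]_x (p x * cos (A y x)).

Let K_ge0 e z : 0 <= K e z.
Proof. by rewrite mulr_ge0 ?gn_ge0// exprn_ge0// sqrtr_ge0. Qed.

Let KN e z : K e (- z) = K e z.
Proof. by rewrite /K /gn dotpNN. Qed.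

Let mA : measurable_fun setT (fun z : 'rV[R]_n * X => A z.1 z.2).
Proof.
apply: meas_add; last exact: (measurableT_comp mbeta measurable_snd).
apply: meas_dotp; first exact: measurable_fst.
exact: (measurableT_comp mPsi measurable_snd).
Qed.

Let mA1 y : measurable_fun setT (A y).
Proof. exact: (measurableT_comp mA (@pair1_measurable _ _ _ _ y)). Qed.

Let mA2 x : measurable_fun setT (A ^~ x).
Proof. exact: (measurableT_comp mA (@pair2_measurable _ _ _ _ x)). Qed.

Let Fbd y : `|F y| <= \int[mu]_x `|p x|.
Proof.
have i1 : rint mu (fun x => p x * cos (A y x)).
  apply: rint_bd => //; first by meas; exact: mA1.
  by move=> x; exact: cos_max.
apply: le_trans (le_normr_Rintegral measurableT i1) _.
apply: le_Rintegral => //.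
- exact: rint_norm.
- exact: rint_norm.
- by move=> x _; rewrite normrM ler_piMr// cos_max.
Qed.

Let mcosA : measurable_fun setT (fun z : 'rV[R]_n * X => cos (A z.1 z.2)).
Proof. by meas. Qed.

Let cosA1 y x : `|cos (A y x)| <= 1. Proof. exact: cos_max. Qed.

Let M e x z := (K e (Psi x - Psi z) + K e (Psi x + Psi z)) / 2.

Let I e x z := \int[Y]_y (gn e y * cos (A y x) * cos (A y z)).

Let IM e x z : 0 < e -> `|I e x z| <= M e x z.
Proof.
move=> e0; rewrite /I.
rewrite (@eq_Rintegral _ _ _ _ _ (fun y => 2^-1 * (gn e y * cos (dotp y (Psi x - Psi z) + (beta x - beta z))
   + gn e y * cos (dotp y (Psi x + Psi z) + (beta x + beta z))))); last first.
  move=> y _; rewrite dotpDr dotpNr dotpDr.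
  rewrite (_ : _ + (beta x - beta z) = A y x - A y z); last by rewrite /A; ring.
  rewrite (_ : _ + (beta x + beta z) = A y x + A y z); last by rewrite /A; ring.
  by rewrite cosB cosD; field.
have i1 := rint_gn_cos (beta x - beta z) (Psi x - Psi z) e0.
have i2 := rint_gn_cos (beta x + beta z) (Psi x + Psi z) e0.
rewrite RintegralZl//; last exact: rintD.
rewrite RintegralD// !int_gn_cos// normrM ger0_norm// /M mulrC ler_wpM2r//.
have H b z' : `|cos b * gc e ^+ n * gn e^-1 z'| <= K e z'.
  by rewrite -mulrA normrM (ger0_norm (K_ge0 e z')) ler_piMl// cos_max.
by rewrite (le_trans (ler_normD _ _))// lerD.
Qed.

Let MC e x z : M e x z = M e z x.
Proof. by rewrite /M -opprB KN (addrC (Psi x)). Qed.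

Let mM e : measurable_fun setT (fun w : X * X => M e w.1 w.2).
Proof.
have m1 := measurableT_comp mPsi (@measurable_fst _ _ X X).
have m2 := measurableT_comp mPsi (@measurable_snd _ _ X X).
have mK (f : X * X -> 'rV[R]_n) : measurable_fun setT f -> measurable_fun setT (fun w => K e (f w)).
  by move=> mf; apply: meas_mul; [exact: meas_cst|exact: (measurableT_comp (@meas_gn R _ n) mf)].
have mco (f : X * X -> 'rV[R]_n) : measurable_fun setT f -> forall i, measurable_fun setT (fun w => f w ord0 i).
  by move=> mf i; exact: (measurableT_comp (@measurable_rV_coord R n i) mf).
apply: meas_mul; last exact: meas_cst.
apply: meas_add; apply: mK; apply: measurable_fun_rVP => i.
  rewrite (_ : (fun _ => _) = fun w : X * X => Psi w.1 ord0 i - Psi w.2 ord0 i).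
    by apply: meas_add; [exact: (mco _ m1)|apply: meas_opp; exact: (mco _ m2)].
  by apply/funext => w; rewrite !mxE.
rewrite (_ : (fun _ => _) = fun w : X * X => Psi w.1 ord0 i + Psi w.2 ord0 i).
  by apply: meas_add; [exact: (mco _ m1)|exact: (mco _ m2)].
by apply/funext => w; rewrite !mxE.
Qed.

Let M_ge0 e x z : 0 <= M e x z.
Proof. by rewrite divr_ge0// addr_ge0. Qed.

Let pM_ge0 e x z : 0 <= `|p x| * (`|p z| * M e x z).
Proof. by rewrite mulr_ge0// mulr_ge0. Qed.

(* the Schur test *)
Let schur e : 0 < e ->
  (\int[mu]_x \int[mu]_z (`|p x| * (`|p z| * M e x z))%:E <= B%:E * \int[mu]_x (P x ^+ 2)%:E)%E.
Proof.
move=> e0.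
have mP1 := measurableT_comp mP (@measurable_fst _ _ X X).
have mP2 := measurableT_comp mP (@measurable_snd _ _ X X).
have ma1 := measurableT_comp ma (@measurable_fst _ _ X X).
have ma2 := measurableT_comp ma (@measurable_snd _ _ X X).
pose t1 (w : X * X) := (2^-1 * (P w.1 ^+ 2 * (a w.2 ^+ 2 * M e w.1 w.2)))%:E.
pose t2 (w : X * X) := (2^-1 * (P w.2 ^+ 2 * (a w.1 ^+ 2 * M e w.1 w.2)))%:E.
have mt1 : measurable_fun setT t1.
  by apply/measurable_EFinP; repeat (first [exact: mM|exact: mP1|exact: ma2|exact: meas_cst|apply: meas_exp|apply: meas_mul]).
have mt2 : measurable_fun setT t2.
  by apply/measurable_EFinP; repeat (first [exact: mM|exact: mP2|exact: ma1|exact: meas_cst|apply: meas_exp|apply: meas_mul]).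
have t10 w : (0 <= t1 w)%E by rewrite lee_fin mulr_ge0// mulr_ge0 ?sqr_ge0// mulr_ge0 ?sqr_ge0.
have t20 w : (0 <= t2 w)%E by rewrite lee_fin mulr_ge0// mulr_ge0 ?sqr_ge0// mulr_ge0 ?sqr_ge0.
have pm1 x (f : X * X -> \bar R) : measurable_fun setT f -> measurable_fun setT (fun z => f (x, z)).
  by move=> mf; exact: (measurableT_comp mf (@pair1_measurable _ _ _ _ x)).
have mF (f : X * X -> \bar R) : measurable_fun setT f -> (forall w, 0 <= f w)%E ->
   measurable_fun setT (fun x => \int[mu]_z f (x, z))%E.
  by move=> mf f0; exact: (@measurable_fun_fubini_tonelli_F _ _ _ _ _ mu f mf f0).
have mp := rint_meas ip.
pose t0 (w : X * X) := (`|p w.1| * (`|p w.2| * M e w.1 w.2))%:E.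
have mt0 : measurable_fun setT t0.
  apply/measurable_EFinP; apply: meas_mul.
    by apply: meas_norm; exact: (measurableT_comp mp (@measurable_fst _ _ X X)).
  apply: meas_mul; last exact: mM.
  by apply: meas_norm; exact: (measurableT_comp mp (@measurable_snd _ _ X X)).
have le1 : (\int[mu]_x \int[mu]_z t0 (x, z) <= \int[mu]_x (\int[mu]_z t1 (x, z) + \int[mu]_z t2 (x, z)))%E.
  apply: ge0_le_integral => //.
  - by move=> x _; apply: integral_ge0 => z _; rewrite lee_fin pM_ge0.
  - by apply: mF => // w; rewrite lee_fin pM_ge0.
  - by apply: emeasurable_funD; apply: mF.
  move=> x _; rewrite -ge0_integralD//; [|exact: pm1|exact: pm1].
  apply: ge0_le_integral => //.
  - by move=> z _; rewrite lee_fin pM_ge0.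
  - exact: pm1.
  - by apply: emeasurable_funD; exact: pm1.
  move=> z _; rewrite -EFinD lee_fin /p !normrM/=.
  have -> : `|a x| * `|P x| * (`|a z| * `|P z| * M e x z) =
    (`|P x| * `|a z|) * (`|P z| * `|a x|) * M e x z by ring.
  have := sqr_ge0 (`|P x| * `|a z| - `|P z| * `|a x|).
  rewrite sqrrB !exprMn !real_normK ?num_real// => h.
  have {h} h : (`|P x| * `|a z|) * (`|P z| * `|a x|) <= 2^-1 * (P x ^+ 2 * a z ^+ 2 + P z ^+ 2 * a x ^+ 2).
    by move: h; rewrite mulr2n; lra.
  apply: le_trans (ler_wpM2r (M_ge0 e x z) h) _.
  by rewrite le_eqVlt; apply/orP; left; apply/eqP; ring.
apply: (le_trans le1).
rewrite ge0_integralD//; last 4 first.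
- by move=> x _; exact: integral_ge0.
- exact: mF.
- by move=> x _; exact: integral_ge0.
- exact: mF.
have -> : (\int[mu]_x \int[mu]_z t2 (x, z) = \int[mu]_x \int[mu]_z t1 (x, z))%E.
  apply: etrans (@fubini_tonelli _ _ _ _ _ mu mu t2 mt2 t20) _.
  by apply: eq_integral => x _; apply: eq_integral => z _; rewrite /t1/t2/= MC.
have ub : (\int[mu]_x \int[mu]_z t1 (x, z) <= \int[mu]_x (2^-1%:E * (B%:E * (P x ^+ 2)%:E)))%E.
  apply: ge0_le_integral => //.
  - by move=> x _; exact: integral_ge0.
  - exact: mF.
  - by apply: measurable_funeM; apply: measurable_funeM; apply/measurable_EFinP; exact: meas_exp.
  move=> x _.
  have mMx : measurable_fun setT (fun z => M e x z).
    by exact: (measurableT_comp (@mM e) (@pair1_measurable _ _ _ _ x)).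
  have E : (\int[mu]_z t1 (x, z) = (2^-1 * P x ^+ 2)%:E * \int[mu]_z (a z ^+ 2 * M e x z)%:E)%E.
    rewrite -ge0_integralZl//.
    - by apply: eq_integral => z _; rewrite -EFinM; congr (_%:E); rewrite /=; ring.
    - by apply/measurable_EFinP; apply: meas_mul => //; exact: meas_exp.
    - by move=> z _; rewrite lee_fin mulr_ge0 ?sqr_ge0.
    - by rewrite lee_fin mulr_ge0 ?sqr_ge0.
  rewrite E EFinM -muleA; apply: lee_wpmul2l => //.
  rewrite muleC; apply: lee_wpmul2r; first by rewrite lee_fin sqr_ge0.
  have mKx s : measurable_fun setT (fun z => K e (s - Psi z)).
    apply: meas_mul; first exact: meas_cst.
    apply: (measurableT_comp (@meas_gn R _ n)); apply: measurable_fun_rVP => i.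
    rewrite (_ : (fun _ => _) = fun w => s ord0 i - Psi w ord0 i).
      by apply: meas_add; [exact: meas_cst|apply: meas_opp; exact: (measurableT_comp (@measurable_rV_coord R n i) mPsi)].
    by apply/funext => w; rewrite !mxE.
  have E2 : (\int[mu]_z (a z ^+ 2 * M e x z)%:E =
     2^-1%:E * (\int[mu]_z (a z ^+ 2 * K e (Psi x - Psi z))%:E + \int[mu]_z (a z ^+ 2 * K e (- Psi x - Psi z))%:E))%E.
    have m1 s : measurable_fun setT (fun z => (a z ^+ 2 * K e (s - Psi z))%:E).
      by apply/measurable_EFinP; apply: meas_mul => //; exact: meas_exp.
    have p1 s z : setT z -> (0 <= (a z ^+ 2 * K e (s - Psi z))%:E)%E.
      by move=> _; rewrite lee_fin mulr_ge0 ?sqr_ge0.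
    rewrite -ge0_integralD; [|by []|exact: p1|exact: m1|exact: p1|exact: m1].
    rewrite -ge0_integralZl//.
    - apply: eq_integral => z _; rewrite -EFinD -EFinM; congr (_%:E).
      by rewrite -opprD KN /M; field.
    - by apply: emeasurable_funD; exact: m1.
    - by move=> z zT; rewrite adde_ge0//; exact: p1.
  rewrite E2; apply: (@le_trans _ _ (2^-1%:E * (B%:E + B%:E))%E).
    by apply: lee_wpmul2l => //; apply: leeD; exact: KB.
  by rewrite -EFinD -EFinM lee_fin; lra.
apply: le_trans (leeD ub ub) _.
have B0 : (0 <= B%:E)%E.
  by apply: le_trans (KB 0 e0); apply: integral_ge0 => z _; rewrite lee_fin mulr_ge0 ?sqr_ge0.
have mP2' : measurable_fun setT (fun x => (P x ^+ 2)%:E).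
  by apply/measurable_EFinP; exact: meas_exp.
rewrite ge0_integralZl//; last 2 first.
- exact: measurable_funeM.
- by move=> x _; rewrite mule_ge0// lee_fin sqr_ge0.
rewrite ge0_integralZl//; last by move=> x _; rewrite lee_fin sqr_ge0.
rewrite -ge0_muleDl// -EFinD (_ : 2^-1 + 2^-1 = 1); last by field.
by rewrite mul1e.
Qed.

Lemma bessel : measurable_fun setT (fun y => F y) /\
  (\int[Y]_y (F y ^+ 2)%:E <= B%:E * \int[mu]_x (P x ^+ 2)%:E)%E.
Proof.
have mF : measurable_fun setT F.
  exact: (@meas_Rint _ _ _ _ _ mu p (fun y x => cos (A y x)) ip mcosA cosA1).
split => //.
apply: (@fatou_le _ _ _ Y (fun k y => gn k.+1%:R^-1 y * F y ^+ 2)).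
- by move=> k; apply: meas_mul; [exact: meas_gn|exact: meas_exp].
- by move=> k y; rewrite mulr_ge0 ?gn_ge0 ?sqr_ge0.
- move=> y; rewrite -[X in _ --> X]mul1r; apply: cvgMr_tmp.
  rewrite /gn -[X in _ --> X](@expR0 R) .
  apply: continuous_cvg; first exact: continuous_expR.
  rewrite -[X in _ --> X]oppr0; apply: cvgN.
  rewrite (_ : (fun k => _) = (fun k : nat => k.+1%:R^-1 * (dotp y y / 2))); last by apply/funext => k; rewrite mulrA.
  by rewrite -[X in _ --> X](mul0r (dotp y y / 2)); apply: cvgMr_tmp; exact: cvg_harmonic.
move=> k; have e0 : 0 < k.+1%:R^-1 :> R by rewrite invr_gt0.
set e := k.+1%:R^-1 in e0 *.
have [iw _] := int_gn n e0.
have [iwF _ _] := fub_bd iw ip mcosA cosA1.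
have [iwFF ipG E] := fub_bd iwF ip mcosA cosA1.
have iw2 x : rint Y (fun y => gn e y * cos (A y x)).
  by apply: rint_bd => //; meas; exact: mA2.
have G x : \int[Y]_y (gn e y * F y * cos (A y x)) = \int[mu]_z (p z * I e x z) /\ rint mu (fun z => p z * I e x z).
  have [_ h1 h2] := fub_bd (iw2 x) ip mcosA cosA1.
  split => //; rewrite -[RHS]h2; apply: eq_Rintegral => y _.
  by rewrite mulrAC.
have -> : (\int[Y]_y (gn e y * F y ^+ 2)%:E = (\int[Y]_y (gn e y * F y * F y))%:E)%E.
  by rewrite -rintE//; apply: eq_integral => y _; rewrite -mulrA expr2.
rewrite [X in X%:E]E; apply: le_trans (schur e0).
apply: (@le_trans _ _ (\int[mu]_x `|p x * \int[Y]_y (gn e y * F y * cos (A y x))|%:E)%E).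
  rewrite rintE; last exact: rint_norm.
  by rewrite lee_fin; apply: le_trans (ler_norm _) _; exact: le_normr_Rintegral.
apply: ge0_le_integral => //.
- by apply/measurable_EFinP; apply: meas_norm; exact: rint_meas ipG.
- apply: (@measurable_fun_fubini_tonelli_F _ _ _ _ _ mu (fun w => (`|p w.1| * (`|p w.2| * M e w.1 w.2))%:E)).
    have mp := rint_meas ip.
    apply/measurable_EFinP; apply: meas_mul.
      by apply: meas_norm; exact: (measurableT_comp mp (@measurable_fst _ _ X X)).
    apply: meas_mul; last exact: mM.
    by apply: meas_norm; exact: (measurableT_comp mp (@measurable_snd _ _ X X)).
  by move=> w; rewrite lee_fin pM_ge0.
move=> x _; have [-> iG] := G x.
have mMx : measurable_fun setT (fun z => M e x z).
  by exact: (measurableT_comp (@mM e) (@pair1_measurable _ _ _ _ x)).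
rewrite normrM EFinM.
apply: (@le_trans _ _ (`|p x|%:E * \int[mu]_z (`|p z| * M e x z)%:E)%E).
  apply: lee_wpmul2l => //.
  apply: (@le_trans _ _ (\int[mu]_z `|p z * I e x z|%:E)%E).
    rewrite rintE; last exact: rint_norm.
    by rewrite lee_fin; exact: le_normr_Rintegral.
  apply: ge0_le_integral => //.
  - by apply/measurable_EFinP; apply: meas_norm; exact: rint_meas iG.
  - by apply/measurable_EFinP; apply: meas_mul => //; apply: meas_norm; exact: rint_meas ip.
  - by move=> z _; rewrite lee_fin normrM ler_wpM2l// IM.
rewrite -ge0_integralZl//.
- by apply/measurable_EFinP; apply: meas_mul => //; apply: meas_norm; exact: rint_meas ip.
- by move=> z _; rewrite lee_fin mulr_ge0.
Qed.

End bessel.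

Section extension.
Context d (Y : measurableType d) (R : realType) (nu : {measure set Y -> \bar R}).
Variables (F : nat -> Y -> R) (r : nat -> R) (C : R).
Hypothesis mF : forall n, measurable_fun setT (F n).
Hypothesis FC : forall n, (\int[nu]_y (F n y ^+ 2)%:E <= C%:E)%E.
Hypothesis r0 : r @ \oo --> 0.
Hypothesis Fr : forall n m, (\int[nu]_y ((F n y - F m y) ^+ 2)%:E <= (r n + r m)%:E)%E.

Lemma sum_half_le2 n : \sum_(k < n) (2 : R) ^- k <= 2.
Proof.
suff -> : \sum_(k < n) (2 : R) ^- k = 2 - 2 * 2 ^- n by rewrite gerBl mulr_ge0// invr_ge0 exprn_ge0.
elim: n => [|n IH]; first by rewrite big_ord0 expr0 invr1 mulr1 subrr.
by rewrite big_ord_recr/= IH exprS invfM; field; rewrite expf_neq0.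
Qed.

Lemma extension : exists (sg : nat -> nat) (U : Y -> R) (D : Y -> \bar R),
  [/\ measurable_fun setT U, measurable_fun setT D, (forall y, 0 <= D y)%E,
      (\int[nu]_y D y < +oo)%E &
   [/\ (forall k, (k <= sg k)%N),
      (forall y, (D y < +oo)%E -> (fun k => F (sg k) y) @ \oo --> U y),
      (forall k y w f, 0 < w -> (`|F (sg k) y * f|%:E <= w%:E * D y + (3 * f ^+ 2 / w)%:E)%E) &
      (\int[nu]_y (U y ^+ 2)%:E <= C%:E)%E]].
Proof.
have sgP k : exists n, (k <= n)%N /\ r n <= 4 ^- k.
  have p4 : 0 < (4 : R) ^- k by rewrite invr_gt0 exprn_gt0.
  have /cvgrPdist_le/(_ _ p4) [N _ HN] := r0.
  exists (maxn k N); split; first exact: leq_maxl.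
  have := HN (maxn k N) (leq_maxr _ _); rewrite sub0r normrN; apply: le_trans.
  exact: ler_norm.
have [sg sgH] := choice sgP.
have sgk k : (k <= sg k)%N by have [] := sgH k.
have sgr k : r (sg k) <= 4 ^- k by have [] := sgH k.
pose dl k y := F (sg k.+1) y - F (sg k) y.
have mdl k : measurable_fun setT (dl k) by rewrite /dl; meas.
pose u k y : \bar R := (2 ^+ k * dl k y ^+ 2)%:E.
have u0 k y : (0 <= u k y)%E by rewrite lee_fin mulr_ge0 ?sqr_ge0 ?exprn_ge0.
have mu k : measurable_fun setT (u k) by apply/measurable_EFinP; rewrite /=; meas; exact: mdl.
pose D y := ((F (sg 0%N) y ^+ 2)%:E + \sum_(k <oo) u k y)%E.
have sum0 y : (0 <= \sum_(k <oo) u k y)%E by apply: nneseries_ge0 => k _ _.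
have D0 y : (0 <= D y)%E by rewrite adde_ge0// lee_fin sqr_ge0.
have mS : measurable_fun setT (fun y => \sum_(k <oo) u k y)%E.
  by apply: ge0_emeasurable_sum => //.
have mF0 : measurable_fun setT (fun y => (F (sg 0%N) y ^+ 2)%:E).
  by apply/measurable_EFinP; meas.
have mD : measurable_fun setT D by exact: emeasurable_funD.
have Dfin : (\int[nu]_y D y < +oo)%E.
  rewrite ge0_integralD//; last by move=> y _; rewrite lee_fin sqr_ge0.
  apply: lte_add_pinfty; first exact: le_lt_trans (FC _) (ltry _).
  rewrite integral_nneseries//.
  apply: (@le_lt_trans _ _ (\sum_(k <oo) (2 / 2 ^+ k)%:E)%E).
    apply: lee_nneseries => k _; first by move=> _; apply: integral_ge0 => y _.
    rewrite (_ : (\int[nu]_y u k y = (2 ^+ k)%:E * \int[nu]_y (dl k y ^+ 2)%:E)%E); last first.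
      rewrite -ge0_integralZl//.
      - by apply/measurable_EFinP; apply: meas_exp; exact: mdl.
      - by move=> y _; rewrite lee_fin sqr_ge0.
    apply: le_trans (lee_wpmul2l _ (Fr _ _)) _; first by rewrite lee_fin exprn_ge0.
    rewrite -EFinM lee_fin.
    apply: (@le_trans _ _ (2 ^+ k * (4 ^- k + 4 ^- k))).
      rewrite ler_wpM2l ?exprn_ge0// lerD//.
      apply: le_trans (sgr _) _; rewrite lef_pV2 ?posrE ?exprn_gt0//.
      by rewrite ler_weXn2l// ler1n.
    rewrite (_ : 4 ^+ k = 2 ^+ k * 2 ^+ k :> R); last by rewrite -exprMn; congr (_ ^+ _); ring.
    by rewrite le_eqVlt; apply/orP; left; apply/eqP; field; rewrite expf_neq0.
  apply: (@le_lt_trans _ _ 4%:E); last exact: ltry.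
  apply: lime_le; first by apply: is_cvg_nneseries => k _ _; rewrite lee_fin divr_ge0 ?exprn_ge0.
  apply: nearW => n; rewrite big_mkord sumEFin lee_fin -mulr_sumr.
  by apply: le_trans (ler_wpM2l _ (sum_half_le2 n)) _ => //; lra.
have tele n y : F (sg n) y = F (sg 0%N) y + \sum_(k < n) dl k y.
  elim: n => [|n IH]; first by rewrite big_ord0 addr0.
  by rewrite big_ord_recr/= addrA -IH /dl addrC subrK.
have part n y : ((F (sg 0%N) y ^+ 2 + \sum_(k < n) 2 ^+ k * dl k y ^+ 2)%:E <= D y)%E.
  rewrite EFinD; apply: leeD => //.
  rewrite -sumEFin -(big_mkord xpredT (fun k => u k y)).
  exact: nneseries_lim_ge.
have amgm (x f c : R) : 0 < c -> `|x * f| <= c * x ^+ 2 + f ^+ 2 / c.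
  move=> c0; have H (s : R) : s <= c * x ^+ 2 + f ^+ 2 / c -> True by [].
  have e1 : c * x ^+ 2 + f ^+ 2 / c = (c * x - f) ^+ 2 / c + 2 * (x * f).
    by field; rewrite gt_eqF.
  have e2 : c * x ^+ 2 + f ^+ 2 / c = (c * x + f) ^+ 2 / c - 2 * (x * f).
    by field; rewrite gt_eqF.
  have p1 : 0 <= (c * x - f) ^+ 2 / c by rewrite divr_ge0 ?sqr_ge0 ?ltW.
  have p2 : 0 <= (c * x + f) ^+ 2 / c by rewrite divr_ge0 ?sqr_ge0 ?ltW.
  have p3 : 0 <= c * x ^+ 2 + f ^+ 2 / c.
    by apply: addr_ge0; [apply: mulr_ge0|apply: divr_ge0]; rewrite ?sqr_ge0// ltW.
  by rewrite ler_norml; apply/andP; split; lra.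
have bound k y w f : 0 < w -> (`|F (sg k) y * f|%:E <= w%:E * D y + (3 * f ^+ 2 / w)%:E)%E.
  move=> w0.
  apply: (@le_trans _ _ (w%:E * (F (sg 0%N) y ^+ 2 + \sum_(j < k) 2 ^+ j * dl j y ^+ 2)%:E + (3 * f ^+ 2 / w)%:E)%E); last first.
    by rewrite leeD2r// lee_wpmul2l// lee_fin ltW.
  rewrite -EFinM -EFinD lee_fin tele mulrDl mulr_suml.
  apply: le_trans (ler_normD _ _) _.
  have h1 := amgm (F (sg 0%N) y) f w w0.
  have h2 : `|\sum_(j < k) dl j y * f| <= w * \sum_(j < k) 2 ^+ j * dl j y ^+ 2 + 2 * f ^+ 2 / w.
    apply: le_trans (ler_norm_sum _ _ _) _.
    apply: (@le_trans _ _ (\sum_(j < k) (w * (2 ^+ j * dl j y ^+ 2) + f ^+ 2 / w * 2 ^- j))).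
      apply: ler_sum => j _; have p : 0 < w * 2 ^+ j by rewrite mulr_gt0// exprn_gt0.
      apply: le_trans (amgm _ _ _ p) _; rewrite le_eqVlt; apply/orP; left; apply/eqP.
      by rewrite invfM; ring.
    rewrite big_split/= -!mulr_sumr lerD2l [leRHS](_ : _ = f ^+ 2 / w * 2); last by ring.
    by rewrite ler_wpM2l ?sum_half_le2// divr_ge0 ?sqr_ge0// ltW.
  apply: le_trans (lerD h1 h2) _.
  by rewrite le_eqVlt; apply/orP; left; apply/eqP; ring.
have cvgF y : (D y < +oo)%E -> cvgn (fun k => F (sg k) y).
  move=> Dy.
  pose M := fine (D y).
  have DM : D y = M%:E by rewrite fineK// ge0_fin_numE.
  have c : cvgn (series (fun k => dl k y)).
    apply: normed_cvg.
    suff : cvgn (series (fun k => `|dl k y|)) by [].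
    apply: nondecreasing_is_cvgn.
      by apply/nondecreasing_seqP => n; rewrite !seriesEord/= big_ord_recr/= lerDl.
    exists (M + 2) => _ [n _ <-]; rewrite seriesEord/=.
    have := part n y; rewrite DM lee_fin => hn.
    apply: (@le_trans _ _ (\sum_(j < n) (2 ^+ j * dl j y ^+ 2 + 2 ^- j))).
      apply: ler_sum => j _; have p : 0 < (2 : R) ^+ j by rewrite exprn_gt0.
      by have := amgm (dl j y) 1 _ p; rewrite mulr1 expr1n mul1r.
    rewrite big_split/= lerD// ?sum_half_le2//.
    by apply: le_trans hn; rewrite lerDr sqr_ge0.
  rewrite (_ : (fun k => _) = (fun k => F (sg 0%N) y + series (fun k => dl k y) k)); last first.
    by apply/funext => k; rewrite tele seriesEord.
  by apply: is_cvgD => //; exact: is_cvg_cst.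
pose E := [set y | (D y < +oo)%E].
have mE : measurable E.
  by rewrite -[X in measurable X]setTI; exact: emeasurable_fun_infty_o.
pose G n y := F (sg n) y * \1_E y.
have mG n : measurable_fun setT (G n) by apply: meas_mul => //; apply: measurable_indic.
pose U y := limn (fun n => G n y).
have cU y : (fun n => G n y) @ \oo --> U y.
  have [Dy|Dy] := pselect (E y).
    have EG : (fun n => G n y) = (fun n => F (sg n) y).
      by apply/funext => n; rewrite /G indicE mem_set// mulr1.
    by rewrite /U EG; exact: (cvgF y Dy).
  have E0 : (fun n => G n y) = (fun=> 0).
    by apply/funext => n; rewrite /G indicE memNset// mulr0.
  by rewrite /U E0 lim_cst//; exact: cvg_cst.
have mU : measurable_fun setT U by apply: (measurable_fun_cvg mG) => y _; exact: cU.
exists sg, U, D; split => //; split => //.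
  move=> y Dy; have := cU y.
  have -> // : (fun n => G n y) = (fun n => F (sg n) y).
  by apply/funext => n; rewrite /G indicE mem_set// mulr1.
apply: (@fatou_le _ _ _ nu (fun n y => G n y ^+ 2)).
- by move=> n; exact: meas_exp.
- by move=> n y; exact: sqr_ge0.
- by move=> y; apply: cvgM; exact: cU.
- move=> n; apply: le_trans (FC (sg n)); apply: ge0_le_integral => //.
  + by move=> y _; rewrite lee_fin sqr_ge0.
  + by apply/measurable_EFinP; exact: meas_exp.
  + by apply/measurable_EFinP; exact: meas_exp.
  + move=> y _; rewrite lee_fin /G exprMn indicE.
    by case: (_ \in _); rewrite ?expr1n ?mulr1// expr0n/= mulr0 sqr_ge0.
Qed.

End extension.

Section L2ext.
Context dY dX (Y : measurableType dY) (X : measurableType dX) (R : realType).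
Variables (nu : {measure set Y -> \bar R}) (mu : {sigma_finite_measure set X -> \bar R}).
Variables (k : Y -> X -> R) (a P : X -> R) (B : R) (chi : nat -> X -> R).
Hypothesis mk : measurable_fun setT (fun z => k z.1 z.2).
Hypothesis k1 : forall y x, `|k y x| <= 1.
Hypothesis B0 : 0 <= B.
Hypothesis bes : forall Q, measurable_fun setT Q -> rint mu (fun x => a x * Q x) ->
  (\int[nu]_y ((\int[mu]_x (a x * Q x * k y x)) ^+ 2)%:E <= B%:E * \int[mu]_x (Q x ^+ 2)%:E)%E.
Hypothesis mP : measurable_fun setT P.
Hypothesis iP : rint mu (fun x => P x ^+ 2).
Hypothesis mchi : forall n, measurable_fun setT (chi n).
Hypothesis chi0 : forall n x, 0 <= chi n x.
Hypothesis chi1 : forall n x, chi n x <= 1.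
Hypothesis cchi : forall x, chi ^~ x @ \oo --> (1 : R).
Hypothesis ichi : forall n, rint mu (fun x => a x * P x * chi n x).

Definition trunc_tr n y := \int[mu]_x (a x * P x * chi n x * k y x).

Lemma L2ext : exists (sg : nat -> nat) (U : Y -> R) (D : Y -> \bar R),
  [/\ measurable_fun setT U, measurable_fun setT D, (forall y, 0 <= D y)%E,
      (\int[nu]_y D y < +oo)%E &
   [/\ (forall k, (k <= sg k)%N),
      (forall y, (D y < +oo)%E -> (fun j => trunc_tr (sg j) y) @ \oo --> U y),
      (forall j y w f, 0 < w -> (`|trunc_tr (sg j) y * f|%:E <= w%:E * D y + (3 * f ^+ 2 / w)%:E)%E) &
      (\int[nu]_y (U y ^+ 2)%:E <= (B * \int[mu]_x (P x ^+ 2))%:E)%E]].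
Proof.
have chin n x : `|chi n x| <= 1 by rewrite ger0_norm.
have mk1 y : measurable_fun setT (k y) by exact: (measurableT_comp mk (@pair1_measurable _ _ _ _ y)).
have mF n : measurable_fun setT (trunc_tr n).
  exact: (@meas_Rint _ _ _ _ _ mu (fun x => a x * P x * chi n x) k (ichi n) mk k1).
have mPc (c : X -> R) : measurable_fun setT c -> (forall x, `|c x| <= 1) -> rint mu (fun x => (P x * c x) ^+ 2).
  move=> mc c1; apply: rint_le iP _; first by meas.
  move=> x; rewrite normrX normrM exprMn real_normK ?num_real// ler_piMr ?sqr_ge0//.
  by rewrite exprn_ile1.
have b1 n x : `|1 - chi n x| <= 1.
  by rewrite ger0_norm ?subr_ge0// gerBl.
have i1 n : rint mu (fun x => (P x * (1 - chi n x)) ^+ 2).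
  by apply: mPc => //; meas.
pose r n := 2 * B * \int[mu]_x ((P x * (1 - chi n x)) ^+ 2).
have r0 : r @ \oo --> 0.
  have [|||_ h] := @rint_dct _ _ _ mu (fun n x => (P x * (1 - chi n x)) ^+ 2) (fun=> 0) _ _ iP.
  - by move=> n; meas.
  - move=> x; rewrite -[X in _ --> X](_ : (P x * (1 - 1)) ^+ 2 = 0); last by rewrite subrr mulr0 expr0n.
    have c : (fun n => P x * (1 - chi n x)) @ \oo --> P x * (1 - 1).
      by apply: cvgM; [exact: cvg_cst|apply: cvgB; [exact: cvg_cst|exact: cchi]].
    by apply: cvgM.
  - move=> n x; rewrite normrX normrM exprMn real_normK ?num_real// ler_piMr ?sqr_ge0//.
    by rewrite exprn_ile1.
  rewrite -[X in _ --> X](mulr0 (2 * B)); apply: cvgM; first exact: cvg_cst.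
  by move: h; rewrite Rintegral_cst// mul0r.
apply: (@extension _ _ _ nu trunc_tr r (B * \int[mu]_x (P x ^+ 2)) mF _ r0).
- move=> n.
  have E y : trunc_tr n y = \int[mu]_x (a x * (P x * chi n x) * k y x).
    by apply: eq_Rintegral => x _; rewrite mulrA.
  under eq_integral do rewrite E.
  apply: le_trans (bes _ _) _; first by meas.
    by apply: eq_integrable (ichi n) => // x _; rewrite /= mulrA.
  rewrite EFinM -(rintE iP); apply: lee_wpmul2l; first by rewrite lee_fin.
  apply: ge0_le_integral => //.
  + by move=> x _; rewrite lee_fin sqr_ge0.
  + by apply/measurable_EFinP; meas.
  + by apply/measurable_EFinP; meas.
  + move=> x _; rewrite lee_fin exprMn ler_piMr ?sqr_ge0//.
    by rewrite exprn_ile1.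
move=> n m.
have ikn y j : rint mu (fun x => a x * P x * chi j x * k y x).
  exact: (rint_bd (ichi j) (mk1 y) (k1 y)).
have E y : trunc_tr n y - trunc_tr m y = \int[mu]_x (a x * (P x * (chi n x - chi m x)) * k y x).
  rewrite /trunc_tr -RintegralB//; [|exact: ikn|exact: ikn].
  by apply: eq_Rintegral => x _; ring.
under eq_integral do rewrite E.
apply: le_trans (bes _ _) _; first by meas.
  rewrite (_ : (fun _ => _) = fun x => a x * P x * chi n x - a x * P x * chi m x).
    exact: rintB.
  by apply/funext => x; ring.
have -> : r n + r m = B * \int[mu]_x (2 * ((P x * (1 - chi n x)) ^+ 2 + (P x * (1 - chi m x)) ^+ 2)).
  rewrite RintegralZl//; last exact: rintD.
  rewrite (RintegralD measurableT (i1 n) (i1 m)) /r. by move: (\int[mu]_x _) (\int[mu]_x _) => s t; ring.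
rewrite EFinM -rintE; last by apply: rintZ; exact: rintD.
apply: lee_wpmul2l; first by rewrite lee_fin.
apply: ge0_le_integral => //.
- by move=> x _; rewrite lee_fin sqr_ge0.
- by apply/measurable_EFinP; meas.
- by apply/measurable_EFinP; meas.
- move=> x _; rewrite lee_fin !exprMn -mulrDr [leRHS]mulrCA ler_wpM2l ?sqr_ge0//.
  have := sqr_ge0 ((1 - chi n x) + (1 - chi m x)).
  have -> : chi n x - chi m x = (1 - chi m x) - (1 - chi n x) by ring.
  by move: (1 - chi m x) (1 - chi n x) => s t; nra.
Qed.

End L2ext.

Section pairing.
Context dZ dX (Z : measurableType dZ) (X : measurableType dX) (R : realType).
Variables (zeta : {sigma_finite_measure set Z -> \bar R}) (mu : {sigma_finite_measure set X -> \bar R}).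
Variables (k : Z -> X -> R) (p f : X -> R) (chi : nat -> X -> R) (sg : nat -> nat).
Variables (U phi : Z -> R) (D : Z -> \bar R).
Hypothesis mk : measurable_fun setT (fun z => k z.1 z.2).
Hypothesis k1 : forall y x, `|k y x| <= 1.
Hypothesis mchi : forall n, measurable_fun setT (chi n).
Hypothesis chi0 : forall n x, 0 <= chi n x.
Hypothesis chi1 : forall n x, chi n x <= 1.
Hypothesis cchi : forall x, chi ^~ x @ \oo --> (1 : R).
Hypothesis ichi : forall n, rint mu (fun x => p x * chi n x).
Hypothesis sgk : forall j, (j <= sg j)%N.
Hypothesis mU : measurable_fun setT U.
Hypothesis mD : measurable_fun setT D.
Hypothesis D0 : forall y, (0 <= D y)%E.
Hypothesis Dfin : (\int[zeta]_y D y < +oo)%E.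
Let S n y := \int[mu]_x (p x * chi n x * k y x).
Hypothesis cS : forall y, (D y < +oo)%E -> (fun j => S (sg j) y) @ \oo --> U y.
Hypothesis bS : forall j y w f, 0 < w -> (`|S (sg j) y * f|%:E <= w%:E * D y + (3 * f ^+ 2 / w)%:E)%E.
Hypothesis iphi : rint zeta phi.
Hypothesis iphi2 : rint zeta (fun y => phi y ^+ 2).
Hypothesis ipT : rint mu (fun x => p x * \int[zeta]_y (phi y * k y x)).

Lemma pairing : rint zeta (fun y => U y * phi y) /\
  \int[zeta]_y (U y * phi y) = \int[mu]_x (p x * \int[zeta]_y (phi y * k y x)).
Proof.
have mphi := rint_meas iphi.
have mS n : measurable_fun setT (S n).
  exact: (@meas_Rint _ _ _ _ _ mu (fun x => p x * chi n x) k (ichi n) mk k1).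
have iD : zeta.-integrable setT D.
  apply/integrableP; split => //; apply: le_lt_trans Dfin.
  by rewrite le_eqVlt; apply/orP; left; apply/eqP; apply: eq_integral => y _; rewrite gee0_abs.
have Dae : {ae zeta, forall y, (D y < +oo)%E}.
  have := integrable_ae measurableT iD; apply: filterS => y /(_ I).
  by rewrite ge0_fin_numE.
have ifD : rint zeta (fine \o D).
  apply: rint_ltyP; first by apply: measurableT_comp => //.
  apply: le_lt_trans Dfin; apply: ge0_le_integral => //.
  - by apply/measurable_EFinP; apply: meas_norm; apply: measurableT_comp => //.
  - by move=> y _; rewrite /= ger0_norm ?fine_ge0//; case: (D y) (D0 y) => // _; rewrite leey.
have [|||||h1 h2] := @rint_dct_ae _ _ _ zeta (fun j y => S (sg j) y * phi y) (fun y => U y * phi y)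
  (fun y => fine (D y) + 3 * phi y ^+ 2).
- by move=> j; exact: meas_mul.
- exact: meas_mul.
- by apply: rintD => //; exact: rintZ.
- by apply: filterS Dae => y Dy; apply: cvgM; [exact: cS|exact: cvg_cst].
- apply: filterS Dae => y Dy j.
  have := bS j y (phi y) (ltr01 : 0 < (1 : R)).
  rewrite mul1e divr1 -(@fineK _ (D y)) ?ge0_fin_numE//.
split => //.
have E j : \int[zeta]_y (S (sg j) y * phi y) = \int[mu]_x (p x * chi (sg j) x * \int[zeta]_y (phi y * k y x)).
  have [_ _ <-] := fub_bd iphi (ichi (sg j)) mk k1.
  by apply: eq_Rintegral => y _; rewrite mulrC.
have mT : measurable_fun setT (fun x => p x * \int[zeta]_y (phi y * k y x)) := rint_meas ipT.
have [|||_ h3] := @rint_dct _ _ _ mu (fun j x => p x * (\int[zeta]_y (phi y * k y x)) * chi (sg j) x)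
   (fun x => p x * \int[zeta]_y (phi y * k y x)) _ _ (rint_norm ipT).
- by move=> j; apply: meas_mul.
- move=> x; rewrite -[X in _ --> X]mulr1; apply: cvgM; first exact: cvg_cst.
  apply: (@cvg_comp _ _ _ sg (chi ^~ x) _ \oo _ _ (cchi x)).
  by apply/cvgnyPge => N; exists N => // j /= Nj; exact: leq_trans Nj (sgk j).
- by move=> j x; rewrite normrM ler_piMr// ger0_norm.
apply: (cvg_unique (@Rhausdorff R) h2).
rewrite (_ : (fun n => _) = (fun j => \int[mu]_x (p x * (\int[zeta]_y (phi y * k y x)) * chi (sg j) x)))//.
by apply/funext => j; rewrite E; apply: eq_Rintegral => x _; rewrite mulrAC.
Qed.

End pairing.

Section ft_bessel.
Context {R : realType} (n : nat).
Local Notation mu := (@lebesgue_rV R n).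

Lemma gn_sub (a : R) (z x : 'rV[R]_n) : gn a (z - x) = gn a (x - z).
Proof. by rewrite -[z - x]opprB /gn dotpNN. Qed.

Lemma int_kernel (e : R) (z : 'rV[R]_n) : 0 < e ->
  (\int[mu]_x (gc e ^+ n * gn e^-1 (z - x))%:E = ((2 * pi) ^+ n)%:E)%E.
Proof.
move=> e0; have ei : 0 < e^-1 by rewrite invr_gt0.
have [i I] := int_gn n ei.
have [iz Iz] := rintegral_shift (- z) i.
have iz' : rint mu (fun x => gn e^-1 (z - x)).
  by apply: eq_integrable iz => // x _; rewrite /= gn_sub.
rewrite rintE; last exact: rintZ.
rewrite RintegralZl// (_ : \int[mu]_x _ = gc e^-1 ^+ n); last first.
  by rewrite -I -Iz; apply: eq_Rintegral => x _; rewrite gn_sub.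
by rewrite -exprMn gcV.
Qed.

Lemma ft_bessel (beta : R) (P : 'rV[R]_n -> R) : measurable_fun setT P -> rint mu P ->
  (\int[mu]_y ((\int[mu]_x (P x * cos (dotp y x + beta))) ^+ 2)%:E <=
   ((2 * pi) ^+ n)%:E * \int[mu]_x (P x ^+ 2)%:E)%E.
Proof.
move=> mP iP.
have i1 : rint mu (fun x => 1 * P x) by under eq_fun do rewrite mul1r.
have [|_] := @bessel _ _ R mu n id (fun=> beta) (fun=> 1) P ((2 * pi) ^+ n)
  (@measurable_id _ _ _) (measurable_cst _) (measurable_cst _) mP i1.
  move=> e z e0; rewrite -(int_kernel z e0).
  by under eq_integral do rewrite expr1n mul1r.
apply: le_trans; rewrite le_eqVlt; apply/orP; left; apply/eqP.
by apply: eq_integral => y _; congr ((_ ^+ 2)%:E); apply: eq_Rintegral => x _; rewrite mul1r.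
Qed.

End ft_bessel.

Section cutoffs.
Context {R : realType} (n : nat).
Local Notation mu := (@lebesgue_rV R n).

Lemma gn_decay (a : R) N : 0 < a -> exists C, 0 <= C /\ forall x : 'rV[R]_n, Q x ^+ N * gn a x <= C.
Proof.
move=> a0; case: N => [|N].
  exists 1; split => // x; rewrite expr0 mul1r /gn -(@expR0 R) ler_expR oppr_le0.
  by rewrite divr_ge0// mulr_ge0 ?dotp_ge0// ltW.
pose c := Num.min 1 (a / 2 / N.+1%:R).
have c0 : 0 < c by rewrite lt_min ltr01/= !divr_gt0.
exists (c ^- N.+1); split; first by rewrite invr_ge0 exprn_ge0// ltW.
move=> x; set t := a * dotp x x / 2.
have h : (c * Q x) ^+ N.+1 <= expR t.
  rewrite (_ : t = t / N.+1%:R * N.+1%:R); last by rewrite divfK.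
  rewrite expRM_natr; apply: lerXn2r; rewrite ?nnegrE ?expR_ge0//.
    by rewrite mulr_ge0 ?Q_ge0// ltW.
  apply: le_trans (expR_ge1Dx _); rewrite /Q mulrDr mulr1 lerD//.
    by rewrite ge_min lexx.
  rewrite (_ : t / N.+1%:R = a / 2 / N.+1%:R * dotp x x); last by rewrite /t; ring.
  by rewrite ler_wpM2r ?dotp_ge0// ge_min lexx orbT.
rewrite /gn -/t expRN -ler_pdivlMr ?invr_gt0 ?expR_gt0// invrK mulrC.
by rewrite ler_pdivlMr ?exprn_gt0// -exprMn mulrC.
Qed.

Lemma rint_Q_gn (a : R) N : 0 < a -> rint mu (fun x => Q x ^+ N * gn a x).
Proof.
move=> a0; have [C [C0 HC]] := gn_decay (N + n) a0.
apply: (rint_le _ (rintZ C (@rint_Q R n))).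
  by measd; exact: meas_gn.
move=> x; rewrite ger0_norm ?mulr_ge0 ?exprn_ge0 ?Q_ge0 ?gn_ge0//.
rewrite ler_pdivlMr ?exprn_gt0 ?Q_gt0// mulrAC -exprD; exact: HC.
Qed.

Definition chi (j : nat) (x : 'rV[R]_n) := gn j.+1%:R^-1 x.

Lemma meas_chi j : measurable_fun setT (chi j). Proof. exact: meas_gn. Qed.
Lemma chi_ge0 j x : 0 <= chi j x. Proof. exact: gn_ge0. Qed.
Lemma chi_le1 j x : chi j x <= 1.
Proof.
by rewrite /chi /gn -(@expR0 R) ler_expR oppr_le0 divr_ge0// mulr_ge0 ?dotp_ge0.
Qed.

Lemma cvg_chi x : chi ^~ x @ \oo --> (1 : R).
Proof.
rewrite /chi /gn -[X in _ --> X](@expR0 R).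
apply: continuous_cvg; first exact: continuous_expR.
rewrite -[X in _ --> X]oppr0; apply: cvgN.
rewrite (_ : (fun k => _) = (fun k : nat => k.+1%:R^-1 * (dotp x x / 2))); last by apply/funext => k; rewrite mulrA.
by rewrite -[X in _ --> X](mul0r (dotp x x / 2)); apply: cvgMr_tmp; exact: cvg_harmonic.
Qed.

(* a square integrable function times a weight of polynomial growth is
   integrable after cutting off *)
Lemma rint_chi (a P : 'rV[R]_n -> R) j : measurable_fun setT a -> measurable_fun setT P ->
  (forall x, a x ^+ 2 <= Q x) -> rint mu (fun x => P x ^+ 2) ->
  rint mu (fun x => a x * P x * chi j x).
Proof.
move=> ma mP aQ iP.
have j0 : 0 < j.+1%:R^-1 :> R by rewrite invr_gt0.
have iQ := rint_Q_gn 1 j0.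
apply: (rint_le _ (rintD iQ iP)).
  by measd.
move=> x; rewrite !normrM (ger0_norm (chi_ge0 j x)).
have c0 := chi_ge0 j x; have c1 := chi_le1 j x; have := aQ x.
rewrite expr1 -/(chi j x) -[P x ^+ 2]real_normK ?num_real// -[a x ^+ 2]real_normK ?num_real//.
move: (normr_ge0 (a x)) (normr_ge0 (P x)) (Q_ge0 x) c0 c1.
move: `|a x| `|P x| (Q x) (chi j x) => s p q c s0 p0 q0 c0 c1 sq.
have h : 0 <= c * (s - p) ^+ 2 by rewrite mulr_ge0 ?sqr_ge0.
have h2 : 0 <= c * (q - s ^+ 2) by rewrite mulr_ge0// subr_ge0.
have h3 : 0 <= (1 - c) * p ^+ 2 by rewrite mulr_ge0 ?sqr_ge0 ?subr_ge0.
nra.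
Qed.

End cutoffs.

Section monotone_phase.
Context {R : realType}.
Local Notation leb := (@lebesgue_measure R).
Variables (c a tau : R).
Hypothesis c0 : 0 <= c.
Hypothesis a0 : 0 < a.

Let sq s := Num.sqrt (s ^+ 2 + c).
Let F s := s * sq s.
Let dF s := sq s + s ^+ 2 / sq s.
Let G u := g1 a (tau - u).

Let rad_gt0 s : s != 0 -> 0 < s ^+ 2 + c.
Proof. by move=> s0; rewrite ltr_wpDr// exprn_even_gt0. Qed.

Let sq_gt0 s : s != 0 -> 0 < sq s.
Proof. by move=> s0; rewrite sqrtr_gt0 rad_gt0. Qed.

Let derF (s : R) : s != 0 -> is_derive s 1 F (dF s).
Proof.
move=> s0; have := sq_gt0 s0; rewrite /dF => q0.
have h1 : is_derive s 1 (fun s => s ^+ 2 + c) (2 * s).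
  rewrite (_ : (fun s => s ^+ 2 + c) = (fun y : R => y * y + c)); last first.
    by apply/funext => y; rewrite expr2.
  have h := drv_add (drv_mul (drv_id s) (drv_id s)) (drv_cst c s).
  by refine (drv_eq h _) => /=; ring.
have h2 : is_derive s 1 sq ((2 * sq s)^-1 * (2 * s)).
  refine (@drv_comp R Num.sqrt (fun s => s ^+ 2 + c) s (2 * s) _ _ h1).
  by have := is_derive1_sqrt (rad_gt0 s0).
by apply: drv_eq (drv_mul (drv_id s) h2) _ => /=; field; rewrite gt_eqF.
Qed.

Let contF (s : R) : {for s, continuous F}.
Proof.
apply: cvgM; first exact: cvg_id.
apply: continuous_cvg; first exact: sqrt_continuous.
by apply: cvgD; [exact: exprn_continuous|exact: cvg_cst].
Qed.

Let contsq (s : R) : {for s, continuous sq}.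
Proof.
apply: continuous_cvg; first exact: sqrt_continuous.
by apply: cvgD; [exact: exprn_continuous|exact: cvg_cst].
Qed.

Let contdF (s : R) : s != 0 -> {for s, continuous (derive1 F)}.
Proof.
move=> s0.
have E : \forall x \near s, dF x = derive1 F x.
  have : \forall x \near s, x != 0.
    by apply: open_nbhs_nbhs; split => //; exact: open_neq.
  by apply: filterS => x x0; rewrite derive1E; case: (derF x0).
rewrite /prop_for/continuous_at -(nbhs_singleton E).
apply: cvg_trans (near_eq_cvg E) _.
apply: cvgD; first exact: contsq.
apply: cvgM; first exact: exprn_continuous.
by apply: cvgV; [rewrite gt_eqF// sq_gt0|exact: contsq].
Qed.

Let Fincr p q : (0 < p) || (q < 0) -> {in `[p, q] &, {homo F : x y / x < y}}.
Proof.
move=> pq x y; rewrite !in_itv/= => /andP[px xq] /andP[py yq] xy.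
case/orP: pq => [p0|q0].
  have x0 := lt_le_trans p0 px; have y0 := lt_le_trans p0 py.
  apply: ltr_pM => //; [exact: ltW|exact: sqrtr_ge0|].
  rewrite ltr_sqrt ?rad_gt0 ?gt_eqF// ltrD2r ltr_pXn2r// nnegrE; exact: ltW.
have x0 := le_lt_trans xq q0; have y0 := le_lt_trans yq q0.
rewrite -ltrN2 /F -!mulNr.
apply: ltr_pM; [by rewrite oppr_ge0 ltW|exact: sqrtr_ge0|by rewrite ltrN2|].
rewrite ltr_sqrt ?rad_gt0 ?lt_eqF// ltrD2r -[y ^+ 2]sqrrN -[x ^+ 2]sqrrN ltr_pXn2r ?ltrN2//.
  by rewrite nnegrE oppr_ge0 ltW.
by rewrite nnegrE oppr_ge0 ltW.
Qed.

Let contG : continuous G.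
Proof.
move=> u.
have h := drv_comp (f := fun u => tau - u) (drv_g1 a (tau - u)) (drv_add (drv_cst tau u) (drv_opp (drv_id u))).
exact: (drv_cvg h).
Qed.

Let mh : measurable_fun setT (fun s => sq s * G (F s)).
Proof.
have msq : measurable_fun setT sq by rewrite /sq; meas.
apply: meas_mul => //; apply: (meas_cont contG).
by apply: meas_mul => //; exact: measurable_id.
Qed.

Let piece p q : p < q -> (0 < p) || (q < 0) ->
  (\int[leb]_(s in `[p, q]) (sq s * G (F s))%:E <= \int[leb]_(u in `[F p, F q]) (G u)%:E)%E.
Proof.
move=> pq pq0.
have ne s : s \in `[p, q] -> s != 0.
  rewrite in_itv/= => /andP[ps sq']; case/orP: pq0 => [p0|q0].
    by rewrite gt_eqF// (lt_le_trans p0).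
  by rewrite lt_eqF// (le_lt_trans sq').
have pin : p \in `[p, q] by rewrite in_itv/= lexx ltW.
have qin : q \in `[p, q] by rewrite in_itv/= lexx ltW.
have oin s : s \in `]p, q[ -> s \in `[p, q] by exact: subset_itv_oo_cc.
rewrite (@integration_by_substitution_increasing R F G p q (ltW pq) (Fincr pq0)).
- apply: ge0_le_integral => //.
  + by move=> s _; rewrite lee_fin mulr_ge0 ?sqrtr_ge0 ?g1_ge0.
  + apply/measurable_EFinP; apply: measurable_funTS; exact: mh.
  + apply/measurable_EFinP.
    apply: (eq_measurable_fun (fun s => G (F s) * dF s)).
      move=> s; rewrite inE/= => hs.
      change (G (F s) * dF s = G (F s) * derive1 F s).
      by rewrite derive1E; case: (derF (ne _ hs)) => _ ->.
    apply: measurable_funTS; apply: meas_mul; last first.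
      rewrite /dF; apply: meas_add; first by rewrite /sq; meas.
      by apply: meas_mul; [meas|apply: meas_inv; [move=> x; exact: sqrtr_ge0|rewrite /sq; meas]].
    apply: (meas_cont contG); rewrite /F; apply: meas_mul; [exact: measurable_id|by rewrite /sq; meas].
  + move=> s /= hs; rewrite lee_fin; change (sq s * G (F s) <= G (F s) * derive1 F s).
    rewrite derive1E; case: (derF (ne _ hs)) => _ ->.
    rewrite mulrC ler_wpM2l ?g1_ge0// /dF lerDl.
    by rewrite divr_ge0 ?sqr_ge0 ?sqrtr_ge0.
- by move=> s /oin/ne s0; exact: contdF.
- by apply/cvg_ex; exists (derive1 F p); apply: cvg_at_right_filter; exact: contdF (ne _ pin).
- by apply/cvg_ex; exists (derive1 F q); apply: cvg_at_left_filter; exact: contdF (ne _ qin).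
- split; first by move=> s /oin/ne s0; case: (derF s0).
    by apply: cvg_at_right_filter; exact: contF.
  by apply: cvg_at_left_filter; exact: contF.
- exact: continuous_subspaceT.
Qed.

Lemma monotone_phase :
  (\int[leb]_s (Num.sqrt (s ^+ 2 + c) * g1 a (tau - s * Num.sqrt (s ^+ 2 + c)))%:E <= (gc a)%:E)%E.
Proof.
have mG : measurable_fun setT G by apply: (meas_cont contG); exact: measurable_id.
have IG : (\int[leb]_u (G u)%:E = (gc a)%:E)%E.
  have [i1 I1] := int_g1 a0.
  rewrite -I1 -rintE// -(@integral_shift1 R (- tau) (fun x => (g1 a x)%:E)).
  - by apply: eq_integral => u _; rewrite /G /g1 -sqrrN opprB.
  - by apply/measurable_EFinP; exact: meas_g1.
  - by move=> x; rewrite lee_fin g1_ge0.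
pose p k : R := k.+2%:R.
pose Ap k : set R := `[(p k)^-1, p k]%classic.
pose An k : set R := `[- p k, - (p k)^-1]%classic.
have p1 k : 1 < p k by rewrite /p ltr1n.
have p0 k : 0 < p k by exact: lt_trans (p1 k).
have pV0 k : 0 < (p k)^-1 by rewrite invr_gt0.
have pp k : (p k)^-1 < p k.
  by apply: (@lt_trans _ _ 1) => //; rewrite invf_lt1.
pose h s := sq s * G (F s).
have h0 s : 0 <= h s by rewrite mulr_ge0 ?sqrtr_ge0 ?g1_ge0.
have dis k : Ap k `&` An k = set0.
  apply/seteqP; split => // x []; rewrite /Ap/An/= !in_itv/= => /andP[x1 _] /andP[_ x2].
  have x0 := lt_le_trans (pV0 k) x1.
  by move: x2; rewrite leNgt => /negP; apply; apply: lt_trans x0; rewrite oppr_lt0.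
rewrite (_ : (\int[leb]_s _ = \int[leb]_s (h s * \1_(~` [set (0%R : R)]) s)%:E)%E); last first.
  transitivity (\int[leb]_(s in setT `\ (0%R : R)) (h s)%:E)%E.
    rewrite integral_setD1//; first exact: measurableD.
    by apply: measurable_funTS; apply/measurable_EFinP.
  rewrite setTD integral_mkcond; apply: eq_integral => s _.
  by rewrite patchE indicE; case: (s \in _); rewrite ?mulr1 ?mulr0.
apply: (@fatou_le _ _ _ leb (fun k s => h s * \1_(Ap k `|` An k) s)).
- move=> k; apply: meas_mul; first exact: mh.
  by apply: measurable_indic; apply: measurableU; exact: measurable_itv.
- by move=> k s; rewrite mulr_ge0// indicE.
- move=> s; apply: cvgM; first exact: cvg_cst.
  have [->|s0] := eqVneq s 0.
    apply: cvg_near_cst; apply: nearW => k; rewrite !indicE.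
    rewrite (_ : (0 \in Ap k `|` An k) = false); last first.
      apply/memNset; rewrite /Ap/An/= !in_itv/= => -[/andP[+ _]|/andP[_ +]].
        by rewrite leNgt pV0.
      by rewrite leNgt oppr_lt0 pV0.
    by rewrite (_ : (0 \in ~` [set 0]) = false)//; apply/memNset => /=; exact.
  apply: cvg_near_cst; near=> k.
  rewrite !indicE (_ : (s \in ~` [set 0]) = true); last first.
    by apply/mem_set => /= /eqP; apply/negP.
  have k1 : `|s| <= p k.
    near: k; exists (Num.truncn `|s|) => // k /= hk.
    by rewrite (le_trans (ltW (truncnS_gt _)))// ler_nat; exact: (leq_trans hk (leqnSn _)).
  have k2 : (p k)^-1 <= `|s|.
    rewrite invf_ple ?posrE ?normr_gt0//.
    near: k; exists (Num.truncn `|s|^-1) => // k /= hk.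
    by rewrite (le_trans (ltW (truncnS_gt _)))// ler_nat; exact: (leq_trans hk (leqnSn _)).
  congr (_ %:R); congr nat_of_bool; apply/mem_set.
  rewrite /Ap/An/= !in_itv/=; move: k1 k2; case: (ltrP 0 s) => sp.
    by rewrite gtr0_norm// => -> ->; left.
  by rewrite ler0_norm// => k1 k2; right; rewrite lerNl k1 lerNr k2.
move=> k; rewrite -IG.
have mAp : measurable (Ap k) by exact: measurable_itv.
have mAn : measurable (An k) by exact: measurable_itv.
have mhE D : measurable D -> measurable_fun D (fun s => (h s)%:E).
  by move=> mD; apply: measurable_funTS; apply/measurable_EFinP; exact: mh.
have mGE D : measurable D -> measurable_fun D (fun s => (G s)%:E).
  by move=> mD; apply: measurable_funTS; apply/measurable_EFinP.
have -> : (\int[leb]_s (h s * \1_(Ap k `|` An k) s)%:E = \int[leb]_(s in Ap k `|` An k) (h s)%:E)%E.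
  rewrite [RHS]integral_mkcond; apply: eq_integral => s _.
  by rewrite patchE indicE; case: (s \in _); rewrite ?mulr1 ?mulr0.
rewrite ge0_integral_setU//; last 3 first.
- by apply: mhE; apply: measurableU.
- by move=> s _; rewrite lee_fin.
- by rewrite disj_set2E dis eqxx.
have l1 := @piece (p k)^-1 (p k) (pp k).
have l2 := @piece (- p k) (- (p k)^-1).
apply: (@le_trans _ _ (\int[leb]_(u in `[F (p k)^-1, F (p k)]) (G u)%:E
   + \int[leb]_(u in `[F (- p k), F (- (p k)^-1)]) (G u)%:E)%E).
  by apply: leeD; [apply: l1; rewrite pV0|apply: l2; rewrite ?ltrN2// oppr_lt0 pV0 orbT].
have F0 s : 0 < s -> 0 < F s by move=> s0; rewrite /F mulr_gt0// sq_gt0// gt_eqF.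
have Fn s : s < 0 -> F s < 0 by move=> s0; rewrite /F pmulr_llt0// sq_gt0// lt_eqF.
rewrite -ge0_integral_setU//.
- by apply: ge0_subset_integral => //; [exact: measurableU|exact: mGE|move=> u _; rewrite lee_fin g1_ge0].
- by apply: mGE; apply: measurableU.
- by move=> u _; rewrite lee_fin g1_ge0.
- rewrite disj_set2E; apply/eqP/seteqP; split => // u []; rewrite /= !in_itv/= => /andP[u1 _] /andP[_ u2].
  have u0 := lt_le_trans (F0 _ (pV0 k)) u1.
  have n0 : - (p k)^-1 < 0 by rewrite oppr_lt0.
  by have := lt_trans u0 (le_lt_trans u2 (Fn _ n0)); rewrite ltxx.
Unshelve. all: by end_near. Qed.

End monotone_phase.

Section weight1.
Context {R : realType} (alpha : R).
Hypothesis ha : 1 / 2 < alpha.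
Local Notation leb := (@lebesgue_measure R).

Definition wt1 (s : R) := ((1 + s ^+ 2) `^ alpha)^-1.

Lemma wt1_ge0 s : 0 <= wt1 s. Proof. by rewrite invr_ge0 powR_ge0. Qed.

Lemma meas_wt1 : measurable_fun setT wt1.
Proof.
by apply: meas_inv; [move=> s; exact: powR_ge0|apply: meas_powR; meas].
Qed.

Lemma rint_wt1 : rint leb wt1.
Proof.
have a0 : 0 < alpha by apply: lt_trans ha; rewrite divr_gt0.
have b0 : 0 < 2 * alpha - 1 by move: ha; lra.
pose b := 2 * alpha - 1.
apply: rint_ltyP; first exact: meas_wt1.
under eq_integral => s _ do rewrite (ger0_norm (wt1_ge0 s)).
have q0 (s : R) : 0 < 1 + s ^+ 2 by rewrite ltr_wpDr ?sqr_ge0.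
have cw : continuous wt1.
  move=> s; apply: cvgV; first by rewrite gt_eqF// powR_gt0.
  have h : is_derive (s : R) 1 (fun s : R => 1 + s * s) (0 + (1 * s + s * 1)).
    exact: (drv_add (drv_cst 1 s) (drv_mul (drv_id s) (drv_id s))).
  have q0' : 0 < (fun s : R => 1 + s * s) s by rewrite -expr2.
  have := drv_cvg (drv_comp (f := fun s : R => 1 + s * s) (is_derive1_powR alpha q0') h).
  by [].
rewrite ge0_symfun_integralT//; last 2 first.
- exact: wt1_ge0.
- by move=> s; rewrite /wt1 /= sqrrN.
apply: lte_mul_pinfty => //.
apply: (@le_lt_trans _ _ ((2 `^ alpha / b)%:E)); last exact: ltry.
rewrite integral_mkcond.
pose f n s := wt1 s * \1_(`[0%R, n.+1%:R]%classic : set R) s.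
pose P := [set x : R | 0 <= x].
rewrite (_ : (\int[leb]_x _)%E = \int[leb]_s (wt1 s * \1_P s)%:E)%E; last first.
  apply: eq_integral => s _; rewrite patchE indicE.
  by case: (s \in _); rewrite ?mulr1 ?mulr0.
apply: (@fatou_le _ _ _ leb f).
- by move=> n; apply: meas_mul; [exact: meas_wt1|apply: measurable_indic; exact: measurable_itv].
- by move=> n s; rewrite mulr_ge0 ?wt1_ge0// indicE.
- move=> s; apply: cvgM; first exact: cvg_cst.
  apply: cvg_near_cst; near=> n; rewrite !indicE; congr (nat_of_bool _)%:R.
  apply/idP/idP; first by rewrite !inE /P/= in_itv/= => /andP[].
  rewrite !inE /P/= in_itv/= => s0; rewrite s0/=.
  near: n; exists (Num.truncn s) => // n /= hn.
  by rewrite (le_trans (ltW (truncnS_gt _)))// ler_nat ltnS.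
move=> n.
have -> : (\int[leb]_s (f n s)%:E = \int[leb]_(s in `[0%R, n.+1%:R]) (wt1 s)%:E)%E.
  rewrite [RHS]integral_mkcond; apply: eq_integral => s _.
  by rewrite patchE /f indicE; case: (s \in _); rewrite ?mulr1 ?mulr0.
have n0 : 0 < n.+1%:R :> R by [].
pose F s : R := - (2 `^ alpha / b) * (1 + s) `^ (- b).
pose dF s : R := 2 `^ alpha * (1 + s) `^ (- b - 1).
have dFF (s : R) : 0 <= s -> is_derive s 1 F (dF s).
  move=> s0; have s1 : 0 < (fun s : R => 1 + s) s by rewrite ltr_wpDr.
  have h := drv_mul (drv_cst (- (2 `^ alpha / b)) s) (drv_comp (f := fun s : R => 1 + s) (is_derive1_powR (- b) s1) (drv_add (drv_cst 1 s) (drv_id s))).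
  refine (drv_eq h _) => /=; rewrite /dF /b; field; rewrite gt_eqF//.
have FTC : (\int[leb]_(s in `[0%R, n.+1%:R]) (dF s)%:E = (F n.+1%:R)%:E - (F 0)%:E)%E.
  apply: continuous_FTC2 => //.
  - apply: continuous_in_subspaceT => s; rewrite inE/= in_itv/= => /andP[s0 _].
    have s1 : 0 < (fun s : R => 1 + s) s by rewrite ltr_wpDr.
    have h := drv_mul (drv_cst (2 `^ alpha) s) (drv_comp (f := fun s : R => 1 + s) (is_derive1_powR (- b - 1) s1) (drv_add (drv_cst 1 s) (drv_id s))).
    exact: (drv_cvg h).
  - split.
    + by move=> s; rewrite in_itv/= => /andP[/ltW s0 _]; case: (dFF s s0).
    + by apply: cvg_at_right_filter; exact: (drv_cvg (dFF 0 (lexx 0))).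
    + by apply: cvg_at_left_filter; exact: (drv_cvg (dFF _ (ltW n0))).
  - by move=> s; rewrite in_itv/= => /andP[/ltW s0 _]; rewrite derive1E; case: (dFF s s0).
apply: (@le_trans _ _ (\int[leb]_(s in `[0%R, n.+1%:R]) (dF s)%:E)%E).
  apply: ge0_le_integral => //.
  - by move=> s _; rewrite lee_fin wt1_ge0.
  - by apply: measurable_funTS; apply/measurable_EFinP; exact: meas_wt1.
  - apply: measurable_funTS; apply/measurable_EFinP; apply: meas_mul; first exact: meas_cst.
    by apply: meas_powR; meas.
  - move=> s; rewrite /= in_itv/= => /andP[s0 _]; rewrite lee_fin /wt1 /dF.
    rewrite (_ : - b - 1 = - (2 * alpha)); last by rewrite /b; ring.
    have s1 : 0 < 1 + s by rewrite ltr_wpDr.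
    rewrite powRN ler_pdivlMr ?powR_gt0// mulrC ler_pdivrMr ?powR_gt0//.
    rewrite powRrM -powRM ?(ltW (q0 s))//.
    apply: ge0_ler_powR; rewrite ?nnegrE ?powR_ge0 ?(ltW a0)//.
      by rewrite mulr_ge0// ltW.
    rewrite powR_mulrn ?addr_ge0//.
    by have := sqr_ge0 (1 - s); nra.
rewrite FTC -EFinB lee_fin /F addr0 powR1 mulr1 opprK.
by rewrite gerDr mulNr oppr_le0 mulr_ge0 ?powR_ge0// divr_ge0 ?powR_ge0// ltW.
Unshelve. all: by end_near. Qed.

End weight1.

Section smoothing.
Context {R : realType} (m : nat).
Local Notation leb := (@lebesgue_measure R).
Local Notation mu := (@lebesgue_rV R m.+1).

Definition phs (x : 'rV[R]_m.+1) : R := x ord0 ord0 * enorm x.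
Definition amp (x : 'rV[R]_m.+1) : R := Num.sqrt (enorm x).
Definition Psi (x : 'rV[R]_m.+1) : 'rV[R]_m.+1 := rV_cons (phs x, rV_tail x).

Lemma enorm2 (x : 'rV[R]_m.+1) : enorm x ^+ 2 = dotp x x.
Proof. by rewrite sqr_sqrtr// dotp_ge0. Qed.

Lemma amp2 x : amp x ^+ 2 = enorm x.
Proof. by rewrite sqr_sqrtr// sqrtr_ge0. Qed.

Lemma meas_enorm : measurable_fun setT (@enorm R m.+1).
Proof. by rewrite /enorm; measd. Qed.

Lemma meas_phs : measurable_fun setT phs.
Proof. by apply: meas_mul; [exact: measurable_rV_coord|exact: meas_enorm]. Qed.

Lemma meas_amp : measurable_fun setT amp.
Proof. by apply: meas_sqrt; exact: meas_enorm. Qed.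

Lemma meas_Psi : measurable_fun setT Psi.
Proof.
apply: (measurableT_comp (@measurable_rV_cons R m)).
by apply/measurable_fun_pairP; split; [exact: meas_phs|exact: measurable_rV_tail].
Qed.

Lemma rV_consN (p : R * 'rV[R]_m) : - rV_cons p = rV_cons (- p.1, - p.2).
Proof.
apply/rowP => j; rewrite [LHS]mxE; case: (unliftP ord0 j) => [k ->|->].
  by rewrite !rV_consS/= mxE.
by rewrite !rV_cons0.
Qed.

Lemma smoothing_kernel (e : R) (z : 'rV[R]_m.+1) : 0 < e ->
  (\int[mu]_x (amp x ^+ 2 * (gc e ^+ m.+1 * gn e^-1 (z - Psi x)))%:E <= ((2 * pi) ^+ m.+1)%:E)%E.
Proof.
move=> e0; have ei : 0 < e^-1 by rewrite invr_gt0.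
have mPsi := meas_Psi; have mamp := meas_amp.
have mz : measurable_fun setT (fun x => z - Psi x).
  apply: measurable_fun_rVP => i.
  rewrite (_ : (fun _ => _) = fun x => z ord0 i - Psi x ord0 i).
    by apply: meas_add; [exact: meas_cst|apply: meas_opp; exact: (measurableT_comp (@measurable_rV_coord R m.+1 i) mPsi)].
  by apply/funext => x; rewrite !mxE.
rewrite integral_rVS; last 2 first.
- apply/measurable_EFinP; apply: meas_mul; first exact: meas_exp.
  by apply: meas_mul; [exact: meas_cst|exact: (measurableT_comp (@meas_gn R e^-1 m.+1) mz)].
- by move=> x; rewrite lee_fin !mulr_ge0 ?sqrtr_ge0 ?gn_ge0 ?exprn_ge0 ?sqrtr_ge0.
set z0 := z ord0 ord0; set z' := rV_tail z.
pose h (s : R) (y : 'rV[R]_m) := Num.sqrt (s ^+ 2 + dotp y y) * g1 e^-1 (z0 - s * Num.sqrt (s ^+ 2 + dotp y y)).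
pose f (p : R * 'rV[R]_m) := ((gc e * h p.1 p.2) * (gc e ^+ m * gn e^-1 (z' - p.2)))%:E.
have E s y : (amp (rV_cons (s, y)) ^+ 2 * (gc e ^+ m.+1 * gn e^-1 (z - Psi (rV_cons (s, y)))))%:E = f (s, y).
  rewrite /f /h /=; congr (_%:E).
  rewrite amp2 /Psi rV_tail_cons /phs rV_cons0 /enorm dotp_cons/= -expr2.
  rewrite -{1}(rV_cons_tail z) rV_consN rV_consD gn_cons/= (exprS (gc e)) -/z0 -/z'.
  ring.
under eq_integral do under eq_integral do rewrite E.
have mh : measurable_fun setT (fun p : R * 'rV[R]_m => h p.1 p.2).
  have msq : measurable_fun setT (fun p : R * 'rV[R]_m => Num.sqrt (p.1 ^+ 2 + dotp p.2 p.2)).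
    apply: meas_sqrt; apply: meas_add; first by apply: meas_exp; exact: measurable_fst.
    by apply: meas_dotp; exact: measurable_snd.
  apply: meas_mul => //; apply: (measurableT_comp (@meas_g1 R e^-1)).
  apply: meas_add; first exact: meas_cst.
  by apply: meas_opp; apply: meas_mul => //; exact: measurable_fst.
have mgz : measurable_fun setT (fun y : 'rV[R]_m => gn e^-1 (z' - y)).
  rewrite (_ : (fun _ => _) = (fun y => gn e^-1 (y - z'))); last by apply/funext => y; rewrite gn_sub.
  have [i _] := int_gn m ei; have [i' _] := rintegral_shift (- z') i.
  exact: rint_meas i'.
have mf : measurable_fun setT f.
  apply/measurable_EFinP; apply: meas_mul; first by apply: meas_mul; [exact: meas_cst|exact: mh].
  by apply: meas_mul; [exact: meas_cst|exact: (measurableT_comp mgz measurable_snd)].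
have h0 s y : 0 <= h s y by rewrite mulr_ge0 ?sqrtr_ge0 ?g1_ge0.
have g0 : 0 <= gc e by exact: sqrtr_ge0.
have k0 y : 0 <= gc e ^+ m * gn e^-1 (z' - y) by rewrite mulr_ge0 ?gn_ge0// exprn_ge0.
have f0 p : (0 <= f p)%E by rewrite lee_fin mulr_ge0// mulr_ge0.
have -> : (\int[leb]_s \int[@lebesgue_rV R m]_y f (s, y) = \int[@lebesgue_rV R m]_y \int[leb]_s f (s, y))%E.
  exact: (@fubini_tonelli _ _ _ _ _ leb (@lebesgue_rV R m) f mf f0).
apply: (@le_trans _ _ (\int[@lebesgue_rV R m]_y ((2 * pi)%:E * (gc e ^+ m * gn e^-1 (z' - y))%:E))%E).
  apply: ge0_le_integral => //.
  - by move=> y _; apply: integral_ge0.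
  - exact: (@measurable_fun_fubini_tonelli_G _ _ _ _ _ leb f mf f0).
  - by apply: measurable_funeM; apply/measurable_EFinP; apply: meas_mul => //; exact: meas_cst.
  - move=> y _.
    have mhy : measurable_fun setT (fun s => h s y).
      exact: (measurableT_comp mh (@pair2_measurable _ _ _ _ y)).
    rewrite (_ : (\int[leb]_s f (s, y) = (gc e ^+ m * gn e^-1 (z' - y))%:E * ((gc e)%:E * \int[leb]_s (h s y)%:E))%E); last first.
      rewrite -ge0_integralZl//; [|exact/measurable_EFinP|by move=> s _; rewrite lee_fin].
      rewrite -ge0_integralZl//.
      + by apply: eq_integral => s _; rewrite -!EFinM /f/= mulrC.
      + by apply: measurable_funeM; exact/measurable_EFinP.
      + by move=> s _; rewrite mule_ge0// lee_fin.
      + by rewrite lee_fin.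
    rewrite muleC; apply: lee_wpmul2r; first by rewrite lee_fin.
    rewrite -(gcV e0) EFinM; apply: lee_wpmul2l; first by rewrite lee_fin.
    exact: (monotone_phase z0 (dotp_ge0 y) ei).
rewrite ge0_integralZl//; last 3 first.
- by apply/measurable_EFinP; apply: meas_mul => //; exact: meas_cst.
- by move=> y _; rewrite lee_fin.
- by rewrite lee_fin mulr_ge0 ?pi_ge0.
by rewrite int_kernel// -EFinM -exprS.
Qed.


Variable alpha : R.
Hypothesis ha : 1 / 2 < alpha.

Definition Wt (x : 'rV[R]_m.+1) : R := Num.sqrt ((Q x `^ alpha)^-1).
Definition stk (beta : R) (p : R * 'rV[R]_m.+1) (x : 'rV[R]_m.+1) : R :=
  Wt p.2 * cos (dotp p.2 x + (p.1 * phs x + beta)).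

Let a0 : 0 < alpha. Proof. by apply: lt_trans ha; rewrite divr_gt0. Qed.

Lemma Wt2 x : Wt x ^+ 2 = (Q x `^ alpha)^-1.
Proof. by rewrite sqr_sqrtr// invr_ge0 powR_ge0. Qed.

Lemma Wt_gt0 x : 0 < Wt x.
Proof. by rewrite sqrtr_gt0 invr_gt0 powR_gt0// Q_gt0. Qed.

Lemma Wt_le1 x : Wt x <= 1.
Proof.
rewrite -[leRHS]sqrtr1 ler_wsqrtr// invf_le1 ?powR_gt0 ?Q_gt0//.
have E1 : (1 : R) `^ alpha = 1 by rewrite powR1.
rewrite -[leLHS]E1; apply: ge0_ler_powR; rewrite ?nnegrE ?Q_ge0 ?Q_ge1//.
exact: ltW.
Qed.

Lemma meas_Wt : measurable_fun setT Wt.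
Proof.
by apply: meas_sqrt; apply: meas_inv; [move=> x; exact: powR_ge0|apply: meas_powR; measd].
Qed.

Lemma Wt2_le (s : R) (y : 'rV[R]_m) : Wt (rV_cons (s, y)) ^+ 2 <= wt1 alpha s.
Proof.
rewrite Wt2 /wt1 lef_pV2 ?posrE ?powR_gt0 ?Q_gt0//; last by rewrite ltr_wpDr ?sqr_ge0.
apply: ge0_ler_powR; rewrite ?nnegrE ?Q_ge0 ?addr_ge0 ?sqr_ge0//; first exact: ltW.
by rewrite /Q dotp_cons lerD2l expr2 lerDl dotp_ge0.
Qed.

Lemma meas_stk beta : measurable_fun setT (fun z => stk beta z.1 z.2).
Proof.
have mf := @measurable_fst _ _ (R * 'rV[R]_m.+1)%type 'rV[R]_m.+1.
have ms := @measurable_snd _ _ (R * 'rV[R]_m.+1)%type 'rV[R]_m.+1.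
have mx := measurableT_comp measurable_snd mf.
have mt := measurableT_comp measurable_fst mf.
apply: meas_mul; first exact: (measurableT_comp meas_Wt mx).
apply: meas_cos; apply: meas_add; first exact: meas_dotp.
apply: meas_add; last exact: meas_cst.
by apply: meas_mul; [exact: mt|exact: (measurableT_comp meas_phs ms)].
Qed.

Lemma stk_le1 beta p x : `|stk beta p x| <= 1.
Proof.
rewrite normrM mulr_ile1// ?cos_max// ger0_norm ?Wt_le1//.
exact/ltW/Wt_gt0.
Qed.

Definition Bst : R := (2 * pi) ^+ m.+1 * \int[leb]_s wt1 alpha s.

Lemma Bst_ge0 : 0 <= Bst.
Proof.
rewrite mulr_ge0 ?exprn_ge0 ?mulr_ge0 ?pi_ge0//.
by apply: Rintegral_ge0 => s _; exact: wt1_ge0.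
Qed.

Lemma smoothing_bessel (beta : R) (P : 'rV[R]_m.+1 -> R) : measurable_fun setT P ->
  rint mu (fun x => amp x * P x) ->
  (\int[(leb \x mu)%E]_p ((\int[mu]_x (amp x * P x * stk beta p x)) ^+ 2)%:E <=
   Bst%:E * \int[mu]_x (P x ^+ 2)%:E)%E.
Proof.
move=> mP iP.
pose ph (q : (R * 'rV[R]_m.+1)) (x : 'rV[R]_m.+1) := cos (dotp q.2 x + (q.1 * phs x + beta)).
have mph : measurable_fun setT (fun z : (R * 'rV[R]_m.+1) * 'rV[R]_m.+1 => ph z.1 z.2).
  have mf := @measurable_fst _ _ (R * 'rV[R]_m.+1)%type 'rV[R]_m.+1.
  have ms := @measurable_snd _ _ (R * 'rV[R]_m.+1)%type 'rV[R]_m.+1.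
  have mx := measurableT_comp measurable_snd mf.
  have mt := measurableT_comp measurable_fst mf.
  apply: meas_cos; apply: meas_add; first exact: meas_dotp.
  apply: meas_add; last exact: meas_cst.
  by apply: meas_mul; [exact: mt|exact: (measurableT_comp meas_phs ms)].
have ph1 q x : `|ph q x| <= 1 by exact: cos_max.
have iph q : rint mu (fun x => amp x * P x * ph q x).
  apply: rint_bd => //.
  exact: (measurableT_comp mph (@pair1_measurable _ _ _ _ q)).
pose H q := \int[mu]_x (amp x * P x * ph q x).
have mH : measurable_fun setT H.
  exact: (@meas_Rint _ _ _ _ _ mu (fun x => amp x * P x) ph iP mph ph1).
have E q : \int[mu]_x (amp x * P x * stk beta q x) = Wt q.2 * H q.
  rewrite /H -RintegralZl//; last exact: iph.
  by apply: eq_Rintegral => x _; rewrite /stk mulrCA.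
pose G (q : R * 'rV[R]_m.+1) : \bar R := (wt1 alpha (q.2 ord0 ord0) * H q ^+ 2)%:E.
have mG : measurable_fun setT G.
  apply/measurable_EFinP; apply: meas_mul; last exact: meas_exp.
  apply: (measurableT_comp (@meas_wt1 R alpha)).
  exact: (measurableT_comp (@measurable_rV_coord R m.+1 ord0) measurable_snd).
have G0 q : (0 <= G q)%E by rewrite lee_fin mulr_ge0 ?wt1_ge0 ?sqr_ge0.
apply: (@le_trans _ _ (\int[(leb \x mu)%E]_q G q)%E).
  apply: ge0_le_integral => //.
  - by move=> q _; rewrite lee_fin sqr_ge0.
  - apply/measurable_EFinP; apply: meas_exp.
    apply: (eq_measurable_fun (fun q => Wt q.2 * H q)); first by move=> q _; rewrite E.
    by apply: meas_mul => //; exact: (measurableT_comp meas_Wt measurable_snd).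
  - move=> q _; rewrite E lee_fin exprMn ler_wpM2r ?sqr_ge0//.
    by rewrite -[q.2]rV_cons_tail rV_cons0 Wt2_le.
rewrite fubini_tonelli1//.
(* reorder (t, (s, y)) into (s, (t, y)) *)
have mc := @measurable_rV_cons R m.
pose G3 (w : (R * R) * 'rV[R]_m) : \bar R := G (w.1.1, rV_cons (w.1.2, w.2)).
have mG3 : measurable_fun setT G3.
  have mf := @measurable_fst _ _ (R * R)%type 'rV[R]_m.
  have ms := @measurable_snd _ _ (R * R)%type 'rV[R]_m.
  apply: (measurableT_comp mG); apply/measurable_fun_pairP; split.
    exact: (measurableT_comp measurable_fst mf).
  apply: (measurableT_comp mc); apply/measurable_fun_pairP; split => //.
  exact: (measurableT_comp measurable_snd mf).
have G30 w : (0 <= G3 w)%E by exact: G0.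
pose L (p : R * R) := (\int[@lebesgue_rV R m]_y G3 (p, y))%E.
have mL : measurable_fun setT L.
  exact: (@measurable_fun_fubini_tonelli_F _ _ _ _ _ (@lebesgue_rV R m) G3 mG3 G30).
have L0 p : (0 <= L p)%E by apply: integral_ge0.
have -> : (\int[leb]_t \int[mu]_x G (t, x) = \int[leb]_t \int[leb]_s L (t, s))%E.
  apply: eq_integral => t _; rewrite integral_rVS//.
  exact: (measurableT_comp mG (@pair1_measurable _ _ _ _ t)).
have -> : (\int[leb]_t \int[leb]_s L (t, s) = \int[leb]_s \int[leb]_t L (t, s))%E.
  exact: (@fubini_tonelli _ _ _ _ _ leb leb L mL L0).
have mPsi := meas_Psi; have mamp := meas_amp.
have P20 : (0 <= \int[mu]_x (P x ^+ 2)%:E)%E by apply: integral_ge0 => x _; rewrite lee_fin sqr_ge0.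
have K0 : (0 <= ((2 * pi) ^+ m.+1)%:E * \int[mu]_x (P x ^+ 2)%:E)%E.
  by rewrite mule_ge0// lee_fin exprn_ge0// mulr_ge0// pi_ge0.
have mwt := @meas_wt1 R alpha.
apply: (@le_trans _ _ (\int[leb]_s ((wt1 alpha s)%:E * (((2 * pi) ^+ m.+1)%:E * \int[mu]_x (P x ^+ 2)%:E)))%E); last first.
  rewrite ge0_integralZr//; last 2 first.
  - exact/measurable_EFinP.
  - by move=> s _; rewrite lee_fin wt1_ge0.
  by rewrite (rintE (rint_wt1 ha)) /Bst muleA -EFinM mulrC.
apply: ge0_le_integral => //.
- by move=> s _; apply: integral_ge0.
- exact: (@measurable_fun_fubini_tonelli_G _ _ _ _ _ leb L mL L0).
- by apply: emeasurable_funM; [exact/measurable_EFinP|exact: measurable_cst].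
move=> s _.
pose F z := \int[mu]_x (amp x * P x * cos (dotp z (Psi x) + (s * x ord0 ord0 + beta))).
have mb : measurable_fun setT (fun x : 'rV[R]_m.+1 => s * x ord0 ord0 + beta).
  by apply: meas_add; [apply: meas_mul; [exact: meas_cst|exact: measurable_rV_coord]|exact: meas_cst].
have [mF bF] := @bessel _ _ R mu m.+1 Psi (fun x => s * x ord0 ord0 + beta) amp P ((2 * pi) ^+ m.+1)
  mPsi mb mamp mP iP (fun e z => @smoothing_kernel e z).
apply: (@le_trans _ _ ((wt1 alpha s)%:E * \int[mu]_z (F z ^+ 2)%:E)%E); last first.
  by apply: lee_wpmul2l bF; rewrite lee_fin wt1_ge0.
rewrite -ge0_integralZl//; last 3 first.
- by apply/measurable_EFinP; exact: meas_exp.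
- by move=> z _; rewrite lee_fin sqr_ge0.
- by rewrite lee_fin wt1_ge0.
have mF2 : measurable_fun setT (fun z => ((wt1 alpha s)%:E * (F z ^+ 2)%:E)%E).
  by apply: measurable_funeM; apply/measurable_EFinP; exact: meas_exp.
have F2_ge0 z : (0 <= (wt1 alpha s)%:E * (F z ^+ 2)%:E)%E.
  by rewrite mule_ge0// lee_fin ?wt1_ge0 ?sqr_ge0.
rewrite (integral_rVS mF2 F2_ge0).
rewrite le_eqVlt; apply/orP; left; apply/eqP.
apply: eq_integral => t _; apply: eq_integral => y _.
rewrite /G3 /G/= rV_cons0/= -EFinM; congr ((_ * _ ^+ 2)%:E).
apply: eq_Rintegral => x _; congr (_ * cos _).
rewrite /Psi dotp_cons -{1}(rV_cons_tail x) dotp_cons/=; ring.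
Qed.

End smoothing.

Section uniqueness.
Context {R : realType} (n : nat).
Local Notation mu := (@lebesgue_rV R n).
Implicit Types x z : 'rV[R]_n.

Lemma measurable_rV_sub : measurable_fun setT (fun p : 'rV[R]_n * 'rV[R]_n => p.1 - p.2).
Proof.
apply: measurable_fun_rVP => i.
rewrite (_ : (fun _ => _) = fun p : 'rV[R]_n * 'rV[R]_n => p.1 ord0 i - p.2 ord0 i).
  apply: meas_add; first exact: (measurableT_comp (@measurable_rV_coord R n i) measurable_fst).
  by apply: meas_opp; exact: (measurableT_comp (@measurable_rV_coord R n i) measurable_snd).
by apply/funext => p; rewrite !mxE.
Qed.

Lemma gn_lin (a : R) x (i : 'I_n) : 0 < a ->
  `|x ord0 i| * gn a x <= (Num.sqrt a)^-1 * gn (a / 2) x.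
Proof.
move=> a0; have s0 : 0 < Num.sqrt a by rewrite sqrtr_gt0.
have -> : gn a x = expR (- (a * dotp x x / 4)) * gn (a / 2) x.
  by rewrite /gn -expRD; congr expR; field.
rewrite mulrA; apply: ler_wpM2r; first exact: gn_ge0.
rewrite expRN -ler_pdivlMr ?invr_gt0 ?expR_gt0// invrK mulrC ler_pdivlMr// mulrC.
apply: le_trans (expR_ge1Dx _).
have h : x ord0 i ^+ 2 <= dotp x x.
  by rewrite /dotp (bigD1 i)//= -expr2 lerDl sumr_ge0// => j _; rewrite -expr2 sqr_ge0.
apply: (@le_trans _ _ (1 + a * `|x ord0 i| ^+ 2 / 4)).
  rewrite -[a in leRHS](@sqr_sqrtr _ a) ?(ltW a0)//.
  have := sqr_ge0 (1 - Num.sqrt a * `|x ord0 i| / 2).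
  by move: (Num.sqrt a) `|x ord0 i| => s t; nra.
rewrite lerD2l ler_pM2r// ler_wpM2l ?(ltW a0)//.
by rewrite real_normK ?num_real.
Qed.

(* approximate identity, for a bounded Lipschitz function *)
Lemma gauss_approx (w : 'rV[R]_n -> R) (L : R) x : measurable_fun setT w ->
  (forall z, `|w z| <= 1) ->
  (forall z, `|w z - w x| <= L * \sum_i `|z ord0 i - x ord0 i|) -> 0 <= L ->
  (fun k : nat => gc k.+1%:R ^- n * \int[mu]_z (w z * gn k.+1%:R (z - x))) @ \oo --> w x.
Proof.
move=> mw w1 wL L0.
have ig k : rint mu (fun z => gn k.+1%:R (z - x)) /\ \int[mu]_z gn k.+1%:R (z - x) = gc k.+1%:R ^+ n.
  have [|i I] := @int_gn R k.+1%:R n; first by rewrite ltr0n.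
  by have [i' I'] := rintegral_shift (- x) i; rewrite -I.
have ig2 k : rint mu (fun z => gn (k.+1%:R / 2) (z - x)) /\ \int[mu]_z gn (k.+1%:R / 2) (z - x) = gc (k.+1%:R / 2) ^+ n.
  have [|i I] := @int_gn R (k.+1%:R / 2) n; first by rewrite divr_gt0// ltr0n.
  by have [i' I'] := rintegral_shift (- x) i; rewrite -I.
have iw k : rint mu (fun z => w z * gn k.+1%:R (z - x)).
  have [i _] := ig k; apply: (rint_le _ i); first by apply: meas_mul => //; exact: rint_meas i.
  by move=> z; rewrite normrM (ger0_norm (gn_ge0 _ _)) ler_piMl ?gn_ge0.
have gcp k : 0 < gc k.+1%:R :> R by apply: gc_gt0; rewrite ltr0n.
have r2 k : gc (k.+1%:R / 2) = Num.sqrt 2 * gc k.+1%:R :> R.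
  rewrite /gc -sqrtrM//; congr Num.sqrt; field.
  by rewrite gt_eqF//= addrC natr1 ltr0n.
have bnd k : `|gc k.+1%:R ^- n * \int[mu]_z (w z * gn k.+1%:R (z - x)) - w x| <=
    (L * n%:R * Num.sqrt 2 ^+ n) * (Num.sqrt k.+1%:R)^-1.
  have [i I] := ig k; have [i2 I2] := ig2 k.
  have -> : gc k.+1%:R ^- n * \int[mu]_z (w z * gn k.+1%:R (z - x)) - w x =
     gc k.+1%:R ^- n * \int[mu]_z ((w z - w x) * gn k.+1%:R (z - x)).
    have -> : \int[mu]_z ((w z - w x) * gn k.+1%:R (z - x)) =
       \int[mu]_z (w z * gn k.+1%:R (z - x) - w x * gn k.+1%:R (z - x)).
      by apply: eq_Rintegral => z _; rewrite mulrBl.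
    rewrite (RintegralB measurableT (iw k) (rintZ (w x) i)) (RintegralZl _ measurableT i) I mulrBr; congr (_ - _).
    by rewrite mulrCA mulVf ?mulr1// expf_neq0// gt_eqF.
  have id : rint mu (fun z => (w z - w x) * gn k.+1%:R (z - x)).
    apply: eq_integrable (rintB (iw k) (rintZ (w x) i)) => // z _.
    by rewrite /= mulrBl.
  rewrite normrM ger0_norm ?invr_ge0 ?exprn_ge0 ?(ltW (gcp k))// mulrC ler_pdivrMr ?exprn_gt0//.
  apply: le_trans (le_normr_Rintegral measurableT id) _.
  apply: (@le_trans _ _ (\int[mu]_z ((L * n%:R * (Num.sqrt k.+1%:R)^-1) * gn (k.+1%:R / 2) (z - x)))).
    apply: le_Rintegral => //; [exact: rint_norm|exact: rintZ|].
    move=> z _; rewrite normrM (ger0_norm (gn_ge0 _ _)).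
    apply: le_trans (ler_wpM2r (gn_ge0 _ _) (wL z)) _.
    rewrite -!mulrA ler_wpM2l// mulr_suml.
    apply: (@le_trans _ _ (\sum_(i0 < n) (Num.sqrt k.+1%:R)^-1 * gn (k.+1%:R / 2) (z - x))).
      apply: ler_sum => j _; have := @gn_lin k.+1%:R (z - x) j.
      by rewrite !mxE; apply; rewrite ltr0n.
    by rewrite sumr_const card_ord -[leLHS]mulr_natl.
  rewrite RintegralZl// I2 r2 exprMn.
  by rewrite le_eqVlt; apply/orP; left; apply/eqP; ring.
have b0 : (fun k : nat => (L * n%:R * Num.sqrt 2 ^+ n) * (Num.sqrt k.+1%:R)^-1) @ \oo --> (0 : R).
  rewrite -[X in _ --> X](mulr0 (L * n%:R * Num.sqrt 2 ^+ n)); apply: cvgM; first exact: cvg_cst.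
  rewrite (_ : (fun k => _) = (fun k : nat => Num.sqrt k.+1%:R^-1)); last first.
    by apply/funext => k; rewrite sqrtrV.
  rewrite -[X in _ --> X](sqrtr0 R); apply: continuous_cvg; first exact: sqrt_continuous.
  exact: cvg_harmonic.
apply/subr_cvg0/norm_cvg0P; apply: (squeeze_cvgr _ (cvg_cst 0) b0).
by apply: nearW => k; rewrite normr_ge0/=; exact: bnd.
Qed.

Definition ramp (j : nat) (s : R) := Num.min 1 (j.+1%:R * Num.max 0 s).

Lemma ramp_bd j s : 0 <= ramp j s <= 1.
Proof.
by rewrite /ramp le_min ler01/= mulr_ge0//= ?ge_min ?lexx// le_max lexx.
Qed.

Lemma ramp_lip j s t : `|ramp j s - ramp j t| <= j.+1%:R * `|s - t|.
Proof.
have j0 : 0 < j.+1%:R :> R by rewrite ltr0n.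
have h : `|Num.max 0 s - Num.max 0 t| <= `|s - t|.
  have := ler_norm (s - t); have := ler_norm (- (s - t)); rewrite normrN.
  rewrite /Num.max; case: ltP => s0; case: ltP => t0 h1 h2; rewrite ler_norml; apply/andP; split; lra.
apply: (@le_trans _ _ `|j.+1%:R * Num.max 0 s - j.+1%:R * Num.max 0 t|).
  rewrite /ramp; set p := _ * Num.max 0 s; set q := _ * Num.max 0 t.
  have := ler_norm (p - q); have := ler_norm (- (p - q)); rewrite normrN.
  rewrite /Num.min; case: ltP => p0; case: ltP => q0 h1 h2; rewrite ler_norml; apply/andP; split; lra.
by rewrite -mulrBr normrM (ger0_norm (ltW j0)) ler_wpM2l// ltW.
Qed.

Lemma cvg_ramp s : (fun j => ramp j s) @ \oo --> ((0 < s)%R%:R : R).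
Proof.
have [s0|s0] := ltP 0 s.
  apply: cvg_near_cst; near=> j; rewrite /ramp max_r ?(ltW s0)//; apply/min_idPl.
  rewrite -ler_pdivrMr// div1r.
  near: j; exists (Num.truncn s^-1) => // j /= hj.
  by rewrite (le_trans (ltW (truncnS_gt _)))// ler_nat ltnS.
by apply: cvg_near_cst; apply: nearW => j; rewrite /ramp max_l// mulr0 min_r// ler01.
Unshelve. all: by end_near. Qed.

Lemma prod_lip (F G : 'I_n -> R) : (forall i, 0 <= F i <= 1) -> (forall i, 0 <= G i <= 1) ->
  `|\prod_i F i - \prod_i G i| <= \sum_i `|F i - G i|.
Proof.
move=> F01 G01.
suff : forall s : seq 'I_n, `|\prod_(i <- s) F i - \prod_(i <- s) G i| <= \sum_(i <- s) `|F i - G i| /\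
   0 <= \prod_(i <- s) G i <= 1 by move=> /(_ (index_enum _))[].
elim=> [|i s [IH /andP[g0 g1]]].
  by split; rewrite !big_nil ?subrr ?normr0 ?ler01 ?lexx.
rewrite !big_cons; have /andP[f0 f1] := F01 i; have /andP[h0 h1] := G01 i; split; last first.
  by rewrite mulr_ge0//= mulr_ile1.
rewrite (_ : _ - _ = F i * (\prod_(j <- s) F j - \prod_(j <- s) G j) + (F i - G i) * \prod_(j <- s) G j); last by ring.
apply: le_trans (ler_normD _ _) _; rewrite addrC; apply: lerD.
  by rewrite normrM (ger0_norm g0) ler_piMr.
apply: le_trans IH; rewrite normrM (ger0_norm f0) ler_piMl//.
Qed.

Definition lower (b : 'I_n -> R) : set 'rV[R]_n := [set x | forall i, x ord0 i < b i].

Lemma measurable_lower b : measurable (lower b).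
Proof.
have -> : lower b = \bigcap_(i in [set: 'I_n]) [set x : 'rV[R]_n | x ord0 i < b i].
  by apply/seteqP; split => [x h i _|x h i]; [exact: h|exact: (h i I)].
apply: fin_bigcap_measurable => // i _.
rewrite -[X in measurable X]setTI.
have /(_ measurableT _ (measurable_itv `]-oo, b i[)) := @measurable_rV_coord R n i.
by rewrite set_itvE.
Qed.

Lemma rV_measurableE : @measurable _ 'rV[R]_n = <<s [set A | exists b, A = lower b] >>.
Proof.
apply/seteqP; split; last first.
  apply: smallest_sub; first exact: sigma_algebra_measurable.
  by move=> _ [b ->]; exact: measurable_lower.
apply: smallest_sub; first exact: smallest_sigma_algebra.
elim/big_ind: _ => [//|A B sA sB|i _]; first by rewrite subUset.
move=> _ [B mB <-]; rewrite setTI.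
pose C := [set B : set R | <<s [set A | exists b, A = lower b] >> ((fun x : 'rV[R]_n => x ord0 i) @^-1` B)].
have sC : sigma_algebra setT C.
  split.
  - by rewrite /C/= preimage_set0; exact: sigma_algebra0.
  - by move=> A hA; rewrite /C/= setTD preimage_setC -setTD; apply: sigma_algebraCD.
  - move=> A hA; rewrite /C/= preimage_bigcup; apply: sigma_algebra_bigcup => k; exact: hA.
have GB : (@RGenInftyO.G R).-sigma.-measurable B by rewrite -RGenInftyO.measurableE.
suff sub : <<s @RGenInftyO.G R >> `<=` C by exact: sub GB.
apply: smallest_sub => // _ [b ->]; rewrite /C/=.
have -> : (fun x : 'rV[R]_n => x ord0 i) @^-1` `]-oo, b[ =
   \bigcup_(N : nat) lower (fun j => if j == i then b else N%:R).
  apply/seteqP; split => [x|x [N _ /(_ i)]]; rewrite /= in_itv/= ?eqxx// => xb.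
  exists (Num.truncn (\sum_j `|x ord0 j|)).+1 => // j.
  case: eqP => [->//|_]; apply: le_lt_trans (truncnS_gt _).
  by rewrite (le_trans (ler_norm _))// (bigD1 j)//= lerDl sumr_ge0.
by apply: sigma_algebra_bigcup => N; apply: sub_sigma_algebra; eexists.
Qed.

Lemma gauss_conv_eq0 (r : 'rV[R]_n -> R) : rint mu r ->
  (forall (k : nat) z, \int[mu]_x (r x * gn k.+1%:R (x - z)) = 0) ->
  {ae mu, forall x, r x = 0}.
Proof.
move=> ir H; have mr := rint_meas ir.
have ig k x : rint mu (fun z => gn k.+1%:R (z - x)) /\ \int[mu]_z gn k.+1%:R (z - x) = gc k.+1%:R ^+ n.
  have [|i I] := @int_gn R k.+1%:R n; first by rewrite ltr0n.
  by have [i' I'] := rintegral_shift (- x) i; rewrite -I.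
have mgn (k : nat) : measurable_fun setT (fun p : 'rV[R]_n * 'rV[R]_n => gn k.+1%:R (p.1 - p.2)).
  by apply: (measurableT_comp (@meas_gn R _ n)); exact: measurable_rV_sub.
have gcp k : 0 < gc k.+1%:R :> R by apply: gc_gt0; rewrite ltr0n.
have gn1 k x : gn k.+1%:R x <= 1.
  by rewrite /gn -(@expR0 R) ler_expR oppr_le0 divr_ge0// mulr_ge0 ?dotp_ge0.
(* against bounded Lipschitz functions *)
have Hw (w : 'rV[R]_n -> R) (L : R) : measurable_fun setT w -> (forall z, `|w z| <= 1) -> 0 <= L ->
   (forall x z, `|w z - w x| <= L * \sum_i `|z ord0 i - x ord0 i|) ->
   \int[mu]_x (r x * w x) = 0.
  move=> mw w1 L0 wL.
  pose f k x z := r x * (w z * gn k.+1%:R (z - x)).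
  have mf k : measurable_fun setT (fun p : 'rV[R]_n * 'rV[R]_n => f k p.1 p.2).
    apply: meas_mul; first exact: (measurableT_comp mr measurable_fst).
    apply: meas_mul; first exact: (measurableT_comp mw measurable_snd).
    rewrite (_ : (fun _ => _) = (fun p : 'rV[R]_n * 'rV[R]_n => gn k.+1%:R (p.1 - p.2))); first exact: mgn.
    by apply/funext => p; rewrite gn_sub.
  have iw k x : rint mu (fun z => w z * gn k.+1%:R (z - x)).
    have [i _] := ig k x; apply: (rint_le _ i); first by apply: meas_mul => //; exact: rint_meas i.
    by move=> z; rewrite normrM (ger0_norm (gn_ge0 _ _)) ler_piMl ?gn_ge0.
  have bw k x : `|\int[mu]_z (w z * gn k.+1%:R (z - x))| <= gc k.+1%:R ^+ n.
    have [i <-] := ig k x.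
    apply: le_trans (le_normr_Rintegral measurableT (iw k x)) _.
    apply: le_Rintegral => //; first exact: rint_norm.
    by move=> z _; rewrite normrM (ger0_norm (gn_ge0 _ _)) ler_piMl ?gn_ge0.
  have fi k : rint (mu \x mu)%E (fun p => f k p.1 p.2).
    apply: (@rint_prod _ _ _ _ _ mu mu (f k) (fun x => gc k.+1%:R ^+ n * `|r x|)) => //.
      by apply: rintZ; exact: rint_norm.
    move=> x; rewrite (_ : (\int[mu]_z _)%E = (\int[mu]_z `|f k x z|)%:E); last first.
      by apply: rintE; apply: rint_norm; apply: rintZ; exact: iw.
    rewrite lee_fin.
    have -> : \int[mu]_z `|f k x z| = `|r x| * \int[mu]_z `|w z * gn k.+1%:R (z - x)|.
      rewrite -(RintegralZl `|r x| measurableT (rint_norm (iw k x))).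
      by apply: eq_Rintegral => z _; rewrite normrM.
    rewrite mulrC ler_wpM2r//; have [i <-] := ig k x.
    apply: le_Rintegral => //; first by apply: rint_norm; exact: iw.
    by move=> z _; rewrite normrM (ger0_norm (gn_ge0 _ _)) ler_piMl ?gn_ge0.
  have E k : \int[mu]_x (r x * (gc k.+1%:R ^- n * \int[mu]_z (w z * gn k.+1%:R (z - x)))) = 0.
    have irg z : rint mu (fun x => r x * gn k.+1%:R (x - z)).
      have [i _] := ig k z; apply: rint_bd => //; first exact: rint_meas i.
      by move=> x; rewrite ger0_norm ?gn_ge0.
    have fE z : (f k ^~ z) = fun x => w z * (r x * gn k.+1%:R (x - z)).
      by apply/funext => x; rewrite /f mulrCA gn_sub.
    have [||_ _ fub] := rint_fubini (fi k).
    - by move=> x; apply: rintZ; exact: iw.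
    - by move=> z; rewrite fE; apply: rintZ; exact: irg.
    have z1 : \int[mu]_z \int[mu]_x f k x z = 0.
      transitivity (\int[mu]_(z in setT) (0 : R)); last by rewrite (Rintegral_cst mu measurableT) mul0r.
      apply: eq_Rintegral => z _; rewrite fE.
      by rewrite (RintegralZl (w z) measurableT (irg z)) H mulr0.
    have z2 : \int[mu]_x (r x * \int[mu]_z (w z * gn k.+1%:R (z - x))) = 0.
      rewrite -z1 -fub; apply: eq_Rintegral => x _.
      by rewrite -(RintegralZl (r x) measurableT (iw k x)).
    have irW : rint mu (fun x => r x * \int[mu]_z (w z * gn k.+1%:R (z - x))).
      have [||h _ _] := rint_fubini (fi k).
      - by move=> x; apply: rintZ; exact: iw.
      - by move=> z; rewrite fE; apply: rintZ; exact: irg.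
      rewrite (_ : (fun x => _) = (fun x => \int[mu]_z f k x z)); first exact: h.
      by apply/funext => x; rewrite -(RintegralZl (r x) measurableT (iw k x)).
    transitivity (\int[mu]_x (gc k.+1%:R ^- n * (r x * \int[mu]_z (w z * gn k.+1%:R (z - x))))).
      by apply: eq_Rintegral => x _; rewrite mulrCA.
    by rewrite (RintegralZl _ measurableT irW) z2 mulr0.
  have mW k : measurable_fun setT (fun x => \int[mu]_z (w z * gn k.+1%:R (z - x))).
    have iw0 : rint mu (fun z => w z * 0).
      by under eq_fun do rewrite mulr0; exact: integrable0.
    have mkk : measurable_fun setT (fun p : 'rV[R]_n * 'rV[R]_n => (w p.2 * gn k.+1%:R (p.2 - p.1) + gn k.+1%:R (p.2 - p.1))%:E).
      have m1 : measurable_fun setT (fun p : 'rV[R]_n * 'rV[R]_n => gn k.+1%:R (p.2 - p.1)).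
        rewrite (_ : (fun _ => _) = (fun p : 'rV[R]_n * 'rV[R]_n => gn k.+1%:R (p.1 - p.2))); first exact: mgn.
        by apply/funext => p; rewrite gn_sub.
      apply/measurable_EFinP; apply: meas_add => //; apply: meas_mul => //.
      exact: (measurableT_comp mw measurable_snd).
    have k0 (p : 'rV[R]_n * 'rV[R]_n) : (0 <= (w p.2 * gn k.+1%:R (p.2 - p.1) + gn k.+1%:R (p.2 - p.1))%:E)%E.
      rewrite lee_fin -[X in _ + X]mul1r -mulrDl mulr_ge0 ?gn_ge0//.
      by have := w1 p.2; rewrite ler_norml => /andP[h _]; rewrite -lerBlDr sub0r.
    have := @measurable_fun_fubini_tonelli_F _ _ _ _ _ mu _ mkk k0.
    rewrite (_ : fubini_F mu _ = EFin \o (fun x => \int[mu]_z (w z * gn k.+1%:R (z - x)) + gc k.+1%:R ^+ n)); last first.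
      apply/funext => x; rewrite /fubini_F/=; have [i <-] := ig k x.
      rewrite -(RintegralD measurableT (iw k x) i) -rintE//.
      exact: (rintD (iw k x) i).
    move=> /measurable_EFinP h.
    apply: (eq_measurable_fun (fun x => (\int[mu]_z (w z * gn k.+1%:R (z - x)) + gc k.+1%:R ^+ n) + - gc k.+1%:R ^+ n)).
      by move=> x _; rewrite addrK.
    by apply: meas_add => //; exact: meas_cst.
  have [|||_ h] := @rint_dct _ _ _ mu (fun k x => r x * (gc k.+1%:R ^- n * \int[mu]_z (w z * gn k.+1%:R (z - x))))
     (fun x => r x * w x) (fun x => `|r x|) _ (rint_norm ir).
  - by move=> k; apply: meas_mul => //; apply: meas_mul; [exact: meas_cst|exact: mW].
  - move=> x; apply: cvgM; first exact: cvg_cst.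
    by apply: (@gauss_approx w L) => //; exact: wL.
  - move=> k x; rewrite normrM ler_piMr// normrM ger0_norm ?invr_ge0 ?exprn_ge0 ?(ltW (gcp k))//.
    by rewrite mulrC ler_pdivrMr ?exprn_gt0// mul1r.
  apply: (cvg_unique (@Rhausdorff R) h).
  by rewrite (_ : (fun k => _) = (fun=> 0)); [exact: cvg_cst|apply/funext => k; exact: E].
(* against indicators of lower orthants *)
have Hl b : \int[mu]_x (r x * \1_(lower b) x) = 0.
  pose w j x := \prod_i ramp j (b i - x ord0 i).
  have w01 j x : 0 <= w j x <= 1.
    apply/andP; split; first by apply: prodr_ge0 => i _; have /andP[] := ramp_bd j (b i - x ord0 i).
    by apply: prodr_ile1 => i _; exact: ramp_bd.
  have mw j : measurable_fun setT (w j).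
    apply: meas_prod => i; apply: meas_cont.
      move=> s; apply/cvgrPdist_le => e e0.
      have j0 : 0 < j.+1%:R :> R by rewrite ltr0n.
      near=> t; apply: le_trans (ramp_lip _ _ _) _.
      rewrite mulrC -ler_pdivlMr//; near: t.
      by apply: cvgr_dist_le => //; rewrite divr_gt0.
    by apply: meas_add; [exact: meas_cst|apply: meas_opp; exact: measurable_rV_coord].
  have Hj j : \int[mu]_x (r x * w j x) = 0.
    apply: (Hw _ j.+1%:R) => //.
    - by move=> z; have /andP[h0 h1] := w01 j z; rewrite ger0_norm.
    - move=> x z; apply: le_trans (prod_lip _ _) _ => [i|i|]; [exact: ramp_bd|exact: ramp_bd|].
      rewrite mulr_sumr; apply: ler_sum => i _; apply: le_trans (ramp_lip _ _ _) _.
      by rewrite ler_wpM2l// distrC; rewrite le_eqVlt; apply/orP; left; apply/eqP; congr `|_|; ring.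
  have [|||_ h] := @rint_dct _ _ _ mu (fun j x => r x * w j x) (fun x => r x * \1_(lower b) x) (fun x => `|r x|) _ (rint_norm ir).
  - by move=> j; exact: meas_mul.
  - move=> x; apply: cvgM; first exact: cvg_cst.
    have -> : \1_(lower b) x = \prod_i ((0 < b i - x ord0 i)%R%:R : R).
      rewrite indicE; have [xb|xb] := pselect (lower b x).
        by rewrite mem_set//= big1// => i _; rewrite subr_gt0 xb.
      rewrite memNset//; have [i hi] : exists i, ~ (x ord0 i < b i) by apply/existsNP.
      by rewrite (bigD1 i)//= subr_gt0 (negbTE (introN idP hi)) mul0r.
    by apply: cvg_big => [p|i _]; [exact: mul_continuous|exact: cvg_ramp].
  - by move=> j x; have /andP[h0 h1] := w01 j x; rewrite normrM ler_piMr// ger0_norm.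
  apply: (cvg_unique (@Rhausdorff R) h).
  by rewrite (_ : (fun k => _) = (fun=> 0)); [exact: cvg_cst|apply/funext => j; exact: Hj].
have Z (A : set 'rV[R]_n) : measurable A ->
    (\int[mu]_(x in A) (r x)%:E)%E = (\int[mu]_x (r x * \1_A x))%:E.
  move=> mA; rewrite -rintE; last first.
    apply: (rint_bd ir) => //.
    by move=> x; rewrite indicE; case: (_ \in _); rewrite ?normr1 ?normr0.
  rewrite [LHS]integral_mkcond; apply: eq_integral => x _.
  by rewrite patchE indicE; case: (x \in _); rewrite ?mulr1 ?mulr0.
have T0 : (\int[mu]_x (r x)%:E)%E = 0%E.
  pose b (N : nat) : 'I_n -> R := fun=> N%:R.
  have [|||_ h] := @rint_dct _ _ _ mu (fun N x => r x * \1_(lower (b N)) x) r (fun x => `|r x|) _ (rint_norm ir).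
  - by move=> N; apply: meas_mul => //; apply: measurable_indic; exact: measurable_lower.
  - move=> x; rewrite -[X in _ --> X]mulr1; apply: cvgM; first exact: cvg_cst.
    apply: cvg_near_cst; near=> N; rewrite indicE mem_set// => i.
    apply: (@le_lt_trans _ _ (\sum_j `|x ord0 j|)).
      by rewrite (le_trans (ler_norm _))// (bigD1 i)//= lerDl sumr_ge0.
    rewrite /b; near: N; exists (Num.truncn (\sum_j `|x ord0 j|)).+1 => // N /= hN.
    by apply: (lt_le_trans (truncnS_gt _)); rewrite ler_nat.
  - by move=> N x; rewrite normrM ler_piMr// indicE; case: (_ \in _); rewrite ?normr1 ?normr0.
  rewrite rintE//; congr (_%:E); apply: (cvg_unique (@Rhausdorff R) h).
  by rewrite (_ : (fun k => _) = (fun=> 0)); [exact: cvg_cst|apply/funext => N; exact: Hl].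
have ind A : measurable A -> (\int[mu]_(x in A) (r x)%:E)%E = 0%E.
  rewrite rV_measurableE; move: A; apply: dynkin_induction => //.
  - exact: rV_measurableE.
  - move=> _ _ [b ->] [c ->]; exists (fun i => Num.min (b i) (c i)).
    apply/seteqP; split => x; first by move=> [h1 h2] i; rewrite lt_min h1 h2.
    by move=> h; split => i; have := h i; rewrite lt_min => /andP[].
  - by move=> _ [b ->]; rewrite Z ?Hl//; exact: measurable_lower.
  - move=> A mA hA; have := T0; rewrite -(setvU A) integral_setU//=.
    + by rewrite hA adde0.
    + exact: measurableC.
    + by rewrite setvU; apply/measurable_EFinP.
    + by rewrite disj_set2E setICl eqxx.
  - move=> F mF tF hF; rewrite integral_bigcup//.
      by apply: eseries0 => k _ _; exact: hF.
    by apply: integrableS ir => //; exact: bigcupT_measurable.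
have := @integral_ae_eq _ _ _ mu setT measurableT (cst 0%E) (EFin \o r) ir (measurable_cst _) _.
case=> [E _ mE|].
  by rewrite [RHS]integral0; exact: (ind _ mE).
by move=> N [mN N0 sN]; exists N; split => // x /= hx; apply: sN => /= h; apply: hx; have [] := h I.
Unshelve. all: by end_near. Qed.

End uniqueness.

Section pointwise_continuity.
Context {R : realType} (T : topologicalType).
Implicit Types (f g : T -> R).

Lemma cont_add f g : continuous f -> continuous g -> continuous (fun x => f x + g x).
Proof. by move=> cf cg x; apply: cvgD; [exact: cf|exact: cg]. Qed.

Lemma cont_mul f g : continuous f -> continuous g -> continuous (fun x => f x * g x).
Proof. by move=> cf cg x; apply: cvgM; [exact: cf|exact: cg]. Qed.

Lemma cont_cst (c : R) : continuous (fun _ : T => c).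
Proof. by move=> x; exact: cvg_cst. Qed.

Lemma cont_sum n (F : 'I_n -> T -> R) : (forall i, continuous (F i)) ->
  continuous (fun x => \sum_i F i x).
Proof. by move=> cF x; apply: cvg_big => [p|i _]; [exact: add_continuous|exact: cF]. Qed.

Lemma cont_comp f (h : R -> R) : continuous h -> continuous f -> continuous (fun x => h (f x)).
Proof. by move=> ch cf x; apply: continuous_comp; [exact: cf|exact: ch]. Qed.
End pointwise_continuity.

Section gaussian_schwartz.
Context {R : realType} (n : nat).
Implicit Types (x y v : 'rV[R]_n) (f g : 'rV[R]_n -> R).

Lemma is_derive_line f x v df : is_derive (0 : R) 1 (fun h : R => f (h *: v + x)) df ->
  is_derive x v f df.
Proof.
move=> [d D].
have E : (fun h : R => h^-1 *: (f (h *: v + x) - f x)) =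
   (fun h : R => h^-1 *: (((fun h : R => f (h *: v + x)) \o shift 0) (h *: 1) - (fun h : R => f (h *: v + x)) 0)).
  by apply/funext => h /=; rewrite /shift/= addr0 scale0r add0r /GRing.scale/= mulr1.
split; first by rewrite /derivable /= E.
by rewrite -D /derive /= E.
Qed.

Lemma is_derive_along f x v (s df : R) : is_derive (s *: v + x) v f df ->
  is_derive s 1 (fun h : R => f (h *: v + x)) df.
Proof.
move=> [d D].
have E : (fun h : R => h^-1 *: (f (h *: v + (s *: v + x)) - f (s *: v + x))) =
   (fun h : R => h^-1 *: (((fun h : R => f (h *: v + x)) \o shift s) (h *: 1) - (fun h : R => f (h *: v + x)) s)).
  by apply/funext => h /=; rewrite /shift/= (_ : h *: 1 = h) ?[_ *: 1]mulr1// scalerDl addrA.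
split; first by rewrite /derivable /= -E.
by rewrite -D /derive /= -E.
Qed.

Lemma Q_le_mul x y : Q x <= 2 * (Q (x - y) * Q y).
Proof.
have h : dotp x x <= 2 * dotp (x - y) (x - y) + 2 * dotp y y.
  have e : 2 * dotp (x - y) (x - y) + 2 * dotp y y - dotp x x = dotp (x - y - y) (x - y - y).
    by rewrite !(dotpDl, dotpDr, dotpNl, dotpNr) (dotpC y x); ring.
  by rewrite -subr_ge0 e dotp_ge0.
rewrite /Q; have := dotp_ge0 (x - y); have := dotp_ge0 y; have := dotp_ge0 x; move: h.
move: (dotp x x) (dotp (x - y) (x - y)) (dotp y y) => s t u; nra.
Qed.

Lemma coord_le_Q x (i : 'I_n) : `|x ord0 i| <= Q x.
Proof.
have h : x ord0 i ^+ 2 <= dotp x x.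
  by rewrite /dotp (bigD1 i)//= expr2 lerDl sumr_ge0// => j _; exact: sqr_ge0.
rewrite /Q; move: h; rewrite -real_normK ?num_real//; move: (`|_|) (dotp x x) (normr_ge0 (x ord0 i)) => s t; nra.
Qed.

Lemma enorm_le_Q x : 1 + enorm x <= 2 * Q x.
Proof.
have : enorm x ^+ 2 = dotp x x by rewrite sqr_sqrtr// dotp_ge0.
rewrite /Q => <-; have : 0 <= enorm x by exact: sqrtr_ge0.
move: (enorm x) => s; nra.
Qed.

Lemma Q_le_enorm x : Q x <= (1 + enorm x) ^+ 2.
Proof.
have : enorm x ^+ 2 = dotp x x by rewrite sqr_sqrtr// dotp_ge0.
rewrite /Q => <-; have : 0 <= enorm x by exact: sqrtr_ge0.
move: (enorm x) => s; nra.
Qed.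

Variables (a : R) (y : 'rV[R]_n).
Hypothesis a0 : 0 < a.

(* the polynomial multiples of a fixed gaussian *)
Inductive gclass : ('rV[R]_n -> R) -> Prop :=
| gclass_base : gclass (fun x => gn a (x - y))
| gclass_coord f (i : 'I_n) : gclass f -> gclass (fun x => (x - y) ord0 i * f x)
| gclass_scale f (c : R) : gclass f -> gclass (fun x => c * f x)
| gclass_add f g : gclass f -> gclass g -> gclass (fun x => f x + g x).

Lemma coord_derive x (i j : 'I_n) :
  is_derive x (delta_mx ord0 i) (fun x => (x - y) ord0 j) ((i == j)%:R).
Proof.
apply: is_derive_line.
rewrite (_ : (fun h : R => _) = (fun h : R => (i == j)%:R * h + (x - y) ord0 j)).
  have h := drv_add (drv_mul (drv_cst ((i == j)%:R : R) 0) (drv_id 0)) (drv_cst ((x - y) ord0 j) 0).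
  by refine (drv_eq h _) => /=; ring.
by apply/funext => h; rewrite !mxE eqxx/= eq_sym; ring.
Qed.

Lemma gclass_derive f (i : 'I_n) : gclass f ->
  exists g, gclass g /\ forall x, is_derive x (delta_mx ord0 i) f (g x).
Proof.
elim=> [|{}f j cf [g [cg hg]]|{}f c _ [g [cg hg]]|{}f f' _ [g [cg hg]] _ [g' [cg' hg']]].
- exists (fun x => (- a) * ((x - y) ord0 i * gn a (x - y))); split.
    by apply: gclass_scale; apply: gclass_coord; exact: gclass_base.
  move=> x; apply: is_derive_line.
  pose u := x - y.
  rewrite (_ : (fun h : R => _) = (fun h : R => expR (- (a * (dotp u u + (2 * u ord0 i) * h + h * h) / 2)))).
    have h2 := drv_add (drv_add (drv_cst (dotp u u) 0) (drv_mul (drv_cst (2 * u ord0 i) 0) (drv_id 0))) (drv_mul (drv_id 0) (drv_id (0 : R))).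
    have h1 := drv_exp (drv_opp (drv_mul (drv_mul (drv_cst a 0) h2) (drv_cst 2^-1 0))).
    refine (drv_eq h1 _) => /=; rewrite /gn -/u.
    by rewrite !mulr0 !addr0; move: (expR _) => E; field.
  apply/funext => h; rewrite /gn; congr (expR (- (a * _ / 2))).
  have -> : h *: delta_mx ord0 i + x - y = u + h *: delta_mx ord0 i by rewrite /u -addrA addrC.
  rewrite (dotpDl u (h *: delta_mx ord0 i)) !(dotpDr u (h *: delta_mx ord0 i)).
  have e1 w : dotp w (h *: delta_mx ord0 i) = h * w ord0 i.
    rewrite /dotp (bigD1 i)//= !mxE !eqxx/= mulr1 big1 ?addr0 1?mulrC// => j ji.
    by rewrite !mxE eqxx/= (negbTE ji) !mulr0.
  rewrite (dotpC (h *: delta_mx ord0 i) u) !e1 !mxE !eqxx/=; ring.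
- exists (fun x => (i == j)%:R * f x + (x - y) ord0 j * g x); split.
    by apply: gclass_add; [apply: gclass_scale|apply: gclass_coord].
  move=> x.
  have h := @is_deriveM _ _ (fun x => (x - y) ord0 j) f x (delta_mx ord0 i) _ _ (coord_derive x i j) (hg x).
  by apply: is_derive_eq h _; rewrite /GRing.scale/= addrC mulrC.
- exists (fun x => c * g x); split; first exact: gclass_scale.
  by move=> x; exact: (@is_deriveZ _ _ _ f c x (delta_mx ord0 i) _ (hg x)).
- exists (fun x => g x + g' x); split; first exact: gclass_add.
  by move=> x; exact: is_deriveD.
Qed.

Lemma gclass_decay f N : gclass f -> exists C, 0 <= C /\ forall x, Q (x - y) ^+ N * `|f x| <= C.
Proof.
move=> cf; elim: cf N => [|{}f i _ IH|{}f c _ IH|{}f g _ IH _ IH'] N.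
- have [C [C0 hC]] := @gn_decay R n a N a0; exists C; split => // x.
  by rewrite ger0_norm ?gn_ge0.
- have [C [C0 hC]] := IH N.+1; exists C; split => // x; apply: le_trans (hC x).
  rewrite normrM exprSr -mulrA ler_wpM2l ?exprn_ge0 ?Q_ge0// ler_wpM2r//.
  exact: coord_le_Q.
- have [C [C0 hC]] := IH N; exists (`|c| * C); split=> [|x]; first exact: mulr_ge0.
  by rewrite normrM mulrCA ler_wpM2l.
- have [C [C0 hC]] := IH N; have [C' [C0' hC']] := IH' N.
  exists (C + C'); split=> [|x]; first exact: addr_ge0.
  apply: le_trans (lerD (hC x) (hC' x)).
  by rewrite -mulrDr ler_wpM2l ?exprn_ge0 ?Q_ge0// ler_normD.
Qed.

Lemma gclass_continuous f : gclass f -> continuous f.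
Proof.
have cc i : continuous (fun x : 'rV[R]_n => (x - y) ord0 i).
  rewrite (_ : (fun _ => _) = (fun x : 'rV[R]_n => x ord0 i + - y ord0 i)); last first.
    by apply/funext => x; rewrite !mxE.
  by apply: cont_add; [exact: coord_continuous|exact: cont_cst].
elim=> [|{}f i _ IH|{}f c _ IH|{}f g _ IH _ IH'].
- rewrite (_ : (fun _ => _) = (fun x => expR (- (a / 2) * dotp (x - y) (x - y)))); last first.
    by apply/funext => x; rewrite /gn; congr expR; ring.
  apply: cont_comp; first exact: continuous_expR.
  apply: cont_mul; first exact: cont_cst.
  by apply: cont_sum => i; exact: cont_mul.
- exact: cont_mul.
- by apply: cont_mul => //; exact: cont_cst.
- exact: cont_add.
Qed.

Lemma gclass_partials s f : gclass f -> gclass (partials s f).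
Proof.
move=> cf; elim: s => [|i s IH] //=.
have [g [cg hg]] := gclass_derive i IH.
rewrite (_ : (fun _ => _) = g)//; apply/funext => x.
by have [_ ->] := hg x.
Qed.

Lemma gclass_schwartz f : gclass f -> real_schwartz f.
Proof.
move=> cf s; have cs := gclass_partials s cf; split; first exact: gclass_continuous.
- by move=> i x; have [g [_ /(_ x)[]]] := gclass_derive i cs.
- move=> k; have [C [C0 hC]] := gclass_decay k cs; exists ((4 * Q y) ^+ k * C) => x.
  apply: (@le_trans _ _ ((4 * Q y) ^+ k * (Q (x - y) ^+ k * `|partials s f x|))); last first.
    by rewrite ler_wpM2l// exprn_ge0// mulr_ge0// Q_ge0.
  rewrite mulrA ler_wpM2r// -exprMn lerXn2r ?nnegrE ?mulr_ge0 ?Q_ge0 ?addr_ge0 ?sqrtr_ge0//.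
  apply: le_trans (enorm_le_Q x) _.
  rewrite (_ : 4 * Q y * Q (x - y) = 2 * (2 * (Q (x - y) * Q y))); last by ring.
  by rewrite ler_wpM2l// Q_le_mul.
Qed.

Lemma real_schwartz0 : real_schwartz (fun _ : 'rV[R]_n => 0 : R).
Proof.
rewrite (_ : (fun=> 0) = fun x => 0 * gn a (x - y)); last by apply/funext => x; rewrite mul0r.
exact/gclass_schwartz/gclass_scale/gclass_base.
Qed.

End gaussian_schwartz.

Section schwartz_fourier.
Context {R : realType} (n : nat).
Local Notation mu := (@lebesgue_rV R n).
Implicit Types (f c : 'rV[R]_n -> R) (x xi : 'rV[R]_n).

Lemma cvg_sin_scaled (x : R) :
  (fun k => k.+1%:R * sin (k.+1%:R^-1 * x)) @ \oo --> x.
Proof.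
have h : is_derive (0 : R) 1 (fun s : R => sin (s * x)) x.
  refine (drv_eq (drv_sin (drv_mul (drv_id 0) (drv_cst x 0))) _).
  by rewrite /= mul0r cos0; ring.
have [d e] := h; move: d; rewrite /derivable -/(derive _ _ _) => d.
have {}d : (fun h : R => h^-1 *: (((fun s : R => sin (s * x)) \o shift 0) (h *: 1) - sin (0 * x))) @ 0^' --> x.
  by rewrite -[X in _ --> X]e; exact: d.
have c := (cvg_at_rightP _ _ _).1 (cvg_dnbhs_at_right d) (fun k => k.+1%:R^-1).
apply: cvg_trans (c _); last by split; [move=> k; rewrite invr_gt0|exact: cvg_harmonic].
apply: near_eq_cvg; near=> k.
by rewrite /= mul0r sin0 subr0 addr0 invrK [_%:R^-1 *: 1]mulr1.
Unshelve. all: by end_near. Qed.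

Lemma rint_sum d (T : measurableType d) (m : {measure set T -> \bar R}) k (F : 'I_k -> T -> R) :
  (forall i, rint m (F i)) -> rint m (fun t => \sum_i F i t).
Proof.
move=> iF; elim: (index_enum _) => [|i r IH].
  under eq_fun do rewrite big_nil.
  exact: integrable0.
under eq_fun do rewrite big_cons.
exact: rintD.
Qed.

Definition decays f := forall N : nat, exists M : R, forall x, `|f x| <= M * Q x ^- N.

Lemma schwartz_decays f s : real_schwartz f -> decays (partials s f).
Proof.
move=> /(_ s)[_ _ h] N; have [M hM] := h N.*2; exists M => x.
rewrite ler_pdivlMr ?exprn_gt0 ?Q_gt0//; apply: le_trans (hM x).
rewrite mulrC ler_wpM2r// -mul2n exprM lerXn2r ?nnegrE ?Q_ge0 ?sqr_ge0//.
exact: Q_le_enorm.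
Qed.

Lemma schwartz_measurable f : real_schwartz f -> measurable_fun setT f.
Proof. by move=> /(_ [::])[cf _ _]; exact: rV_continuous_measurable. Qed.

Lemma decays_rint f c K : decays f -> measurable_fun setT f -> measurable_fun setT c ->
  (forall x, `|c x| <= Q x ^+ K) ->
  rint mu (fun x => f x * c x) /\ rint mu (fun x => (f x * c x) ^+ 2).
Proof.
move=> df mf mc cK.
have bd N : exists M, 0 <= M /\ forall x, `|f x * c x| <= M * Q x ^- N.
  have [M hM] := df (N + K)%N; exists M; split.
    have := hM 0; rewrite /Q /dotp big1 ?addr0 ?expr1n ?invr1 ?mulr1 => [|i _]; last by rewrite mxE mul0r.
    exact: le_trans.
  move=> x; rewrite normrM; apply: le_trans (ler_pM _ _ (hM x) (cK x)) _ => //.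
  have q0 k : Q x ^+ k != 0 by rewrite gt_eqF// exprn_gt0// Q_gt0.
  rewrite le_eqVlt; apply/orP; left; apply/eqP; rewrite exprD.
  by move: (q0 N) (q0 K); move: (Q x ^+ N) (Q x ^+ K) => p q p0 q1; field; rewrite p0.
split.
  have [M [M0 hM]] := bd n; apply: rint_le (rintZ M (@rint_Q R n)) _; first exact: meas_mul.
  exact: hM.
have [M [M0 hM]] := bd n; apply: rint_le (rintZ (M ^+ 2) (@rint_QX R n (n + n) (leq_addr _ _))) _.
  by apply: meas_exp; exact: meas_mul.
move=> x; rewrite normrX (_ : M ^+ 2 * Q x ^- (n + n) = (M * Q x ^- n) ^+ 2).
  by rewrite lerXn2r ?nnegrE ?hM// (le_trans _ (hM x)).
by rewrite exprMn exprVn -exprM addnn muln2.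
Qed.

Lemma Q_shift_small x (s : R) (i : 'I_n) : `|s| <= 1 ->
  Q x <= 4 * Q (s *: (delta_mx ord0 i : 'rV[R]_n) + x).
Proof.
move=> s1; set v := s *: _; have := Q_le_mul x (v + x).
rewrite (_ : x - (v + x) = - v); last by rewrite opprD addrCA subrr addr0.
have -> : Q (- v) = 1 + s ^+ 2.
  rewrite /Q dotpNN /dotp (bigD1 i)//= !mxE !eqxx/= mulr1 big1 ?addr0// => j ji.
  by rewrite !mxE eqxx/= (negbTE ji) !mulr0.
move/le_trans; apply.
have : s ^+ 2 <= 1 by rewrite -real_normK ?num_real// expr_le1.
have := Q_ge0 (v + x); move: (Q (v + x)) (s ^+ 2) => q r; nra.
Qed.

Lemma diff_quotient_decay f (i : 'I_n) : real_schwartz f -> forall N, exists M, 0 <= M /\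
  forall x h, 0 < h -> h <= 1 ->
  `|f (x + h *: delta_mx ord0 i) - f x| <= h * (M * Q x ^- N).
Proof.
move=> sf N; have [M0 hM0] := schwartz_decays [:: i] sf N.
pose M := `|M0| * 4 ^+ N; exists M; split; first by rewrite mulr_ge0// exprn_ge0.
move=> x h h0 h1; set v := delta_mx ord0 i.
have [_ df _] := sf [::].
have D (s : R) : is_derive s 1 (fun h : R => f (h *: v + x)) ('D_v f (s *: v + x)).
  by apply: is_derive_along; split => //; exact: df.
have [|] := @MVT_segment R (fun h : R => f (h *: v + x)) (fun s => 'D_v f (s *: v + x)) 0 h (ltW h0) (fun s _ => D s).
  by apply: continuous_subspaceT; exact: drv_continuous D.
move=> c /[!in_itv]/= /andP[c0 ch]; rewrite scale0r add0r subr0 [h *: v + x]addrC => ->.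
rewrite normrM (ger0_norm (ltW h0)) mulrC ler_wpM2l ?(ltW h0)//.
apply: le_trans (hM0 _) _; apply: (@le_trans _ _ (`|M0| * Q (c *: v + x) ^- N)).
  by rewrite ler_wpM2r ?ler_norm// invr_ge0 exprn_ge0// Q_ge0.
rewrite /M -mulrA ler_wpM2l//.
rewrite -[X in _ <= X]invrK invfM invrK lef_pV2 ?posrE ?exprn_gt0 ?Q_gt0 ?mulr_gt0 ?invr_gt0 ?exprn_gt0 ?Q_gt0//.
rewrite mulrC ler_pdivrMr ?exprn_gt0// mulrC -exprMn lerXn2r ?nnegrE ?mulr_ge0 ?Q_ge0//.
by apply: Q_shift_small; rewrite ger0_norm// (le_trans ch).
Qed.

Section transform.
Variable f : 'rV[R]_n -> R.
Hypothesis sf : real_schwartz f.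

Definition ctr beta xi := \int[mu]_x (f x * cos (dotp xi x + beta)).

Let mf : measurable_fun setT f. Proof. exact: schwartz_measurable. Qed.

Let fint : rint mu f /\ rint mu (fun x => f x ^+ 2).
Proof.
have [|i1 i2] := @decays_rint f (fun=> 1) 0 (schwartz_decays [::] sf) mf (meas_cst 1).
  by move=> x; rewrite expr0 normr1.
by split; [move: i1|move: i2]; under eq_fun do rewrite mulr1.
Qed.

Let mcos beta : measurable_fun setT (fun z : 'rV[R]_n * 'rV[R]_n => cos (dotp z.1 z.2 + beta)).
Proof. by apply: meas_cos; apply: meas_add; [apply: meas_dotp|exact: meas_cst]. Qed.

Let mcos1 xi beta : measurable_fun setT (fun x : 'rV[R]_n => cos (dotp xi x + beta)).
Proof. by apply: meas_cos; apply: meas_add; [apply: meas_dotp|exact: meas_cst]. Qed.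

Lemma rint_ctr beta xi : rint mu (fun x => f x * cos (dotp xi x + beta)).
Proof. by have [i _] := fint; apply: rint_bd => // x; exact: cos_max. Qed.

Lemma meas_ctr beta : measurable_fun setT (ctr beta).
Proof.
have [i _] := fint.
exact: (@meas_Rint _ _ _ _ _ mu f (fun xi x => cos (dotp xi x + beta)) i (mcos beta) (fun _ _ => cos_max _)).
Qed.

Lemma ctr_phase beta gamma xi :
  ctr (beta + gamma) xi = cos gamma * ctr beta xi + sin gamma * ctr (beta + pi / 2) xi.
Proof.
rewrite /ctr -(RintegralZl (cos gamma) measurableT (rint_ctr beta xi)).
rewrite -(RintegralZl (sin gamma) measurableT (rint_ctr (beta + pi / 2) xi)).
rewrite -(RintegralD measurableT (rintZ _ (rint_ctr beta xi)) (rintZ _ (rint_ctr (beta + pi / 2) xi))).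
apply: eq_Rintegral => x _; rewrite !addrA cosDpihalf [cos (_ + gamma)]cosD; ring.
Qed.

Lemma ctr_shift beta xi v :
  \int[mu]_x (f (x + v) * cos (dotp xi x + beta)) = ctr (beta - dotp xi v) xi.
Proof.
have [i e] := rintegral_shift v (rint_ctr (beta - dotp xi v) xi).
rewrite /ctr -e; apply: eq_Rintegral => x _; rewrite dotpDr; congr (_ * cos _); ring.
Qed.

Definition ctr2 xi := ctr 0 xi ^+ 2 + ctr (pi / 2) xi ^+ 2.

Lemma ctr_le_ctr2 beta xi : ctr beta xi ^+ 2 <= ctr2 xi.
Proof.
rewrite -[beta]add0r ctr_phase add0r /ctr2; have := cos2Dsin2 beta.
move: (cos beta) (sin beta) (ctr 0 xi) (ctr (pi / 2) xi) => c s A B h.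
rewrite -[leRHS]mulr1 -h -subr_ge0 (_ : _ - _ = (s * A - c * B) ^+ 2); last by ring.
exact: sqr_ge0.
Qed.

Lemma rint_ctr2 : rint mu ctr2.
Proof.
have [i i2] := fint.
have h beta : rint mu (fun xi => ctr beta xi ^+ 2).
  apply/rint_ltyP; first by apply: meas_exp; exact: meas_ctr.
  apply: (@le_lt_trans _ _ (((2 * pi) ^+ n)%:E * \int[mu]_x (f x ^+ 2)%:E)%E).
    apply: le_trans (ft_bessel beta mf i); rewrite le_eqVlt; apply/orP; left; apply/eqP.
    by apply: eq_integral => y _; rewrite ger0_norm ?sqr_ge0.
  by rewrite rintE// -EFinM ltry.
exact: rintD.
Qed.

Let coord_ctr2 (i : 'I_n) : rint mu (fun xi => xi ord0 i ^+ 2 * ctr2 xi).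
Proof.
have mc : measurable_fun setT ctr2 by apply: rint_meas; exact: rint_ctr2.
have c0 xi : 0 <= ctr2 xi by rewrite addr_ge0 ?sqr_ge0.
apply/rint_ltyP.
  by apply: meas_mul => //; apply: meas_exp; exact: measurable_rV_coord.
have [M [M0 hM]] := diff_quotient_decay i sf n.
pose C := \int[mu]_x ((M * Q x ^- n) ^+ 2).
have iC : rint mu (fun x => (M * Q x ^- n) ^+ 2).
  rewrite (_ : (fun _ => _) = (fun x => M ^+ 2 * Q x ^- (n + n))).
    by apply: rintZ; apply: rint_QX; exact: leq_addr.
  by apply/funext => x; rewrite exprMn exprVn -exprM addnn muln2.
apply: (@le_lt_trans _ _ (2 * (2 * pi) ^+ n * C)%:E); last exact: ltry.
rewrite (_ : (\int[mu]_x _)%E = \int[mu]_x (x ord0 i ^+ 2 * ctr2 x)%:E)%E; last first.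
  by apply: eq_integral => x _; rewrite ger0_norm// mulr_ge0// sqr_ge0.
pose h (k : nat) : R := k.+1%:R^-1.
have h0 k : 0 < h k by rewrite invr_gt0.
have h1 k : h k <= 1 by rewrite invf_le1// ler1n.
apply: (@fatou_le _ _ _ mu (fun k xi => (k.+1%:R * sin (h k * xi ord0 i)) ^+ 2 * ctr2 xi)).
- move=> k; apply: meas_mul => //; apply: meas_exp; apply: meas_mul; first exact: meas_cst.
  by apply: meas_sin; apply: meas_mul; [exact: meas_cst|exact: measurable_rV_coord].
- by move=> k x; rewrite mulr_ge0// sqr_ge0.
- move=> x; apply: cvgM; last exact: cvg_cst.
  apply: (@continuous_cvg _ _ _ _ _ _ (fun s : R => s ^+ 2)); first exact: exprn_continuous.
  exact: cvg_sin_scaled.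
- move=> k.
  pose v := h k *: (delta_mx ord0 i : 'rV[R]_n).
  pose g x := k.+1%:R * (f (x + v) - f x).
  have [i1 i2] := fint.
  have [iv _] := rintegral_shift v i1.
  have ig : rint mu g by apply: rintZ; exact: rintB.
  have mg := rint_meas ig.
  have gM x : `|g x| <= M * Q x ^- n.
    rewrite normrM ger0_norm// -ler_pdivlMl//; exact: hM.
  have b beta : (\int[mu]_y ((\int[mu]_x (g x * cos (dotp y x + beta))) ^+ 2)%:E <= ((2 * pi) ^+ n * C)%:E)%E.
    apply: le_trans (ft_bessel beta mg ig) _.
    rewrite EFinM /C -(rintE iC) lee_wpmul2l ?lee_fin ?exprn_ge0 ?mulr_ge0 ?pi_ge0//.
    apply: ge0_le_integral => //.
    + by move=> x _; rewrite lee_fin sqr_ge0.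
    + by apply/measurable_EFinP; exact: meas_exp.
    + by apply/measurable_EFinP; exact: rint_meas iC.
    + by move=> x _; rewrite lee_fin -[leLHS]real_normK ?num_real// lerXn2r ?nnegrE ?(le_trans _ (gM x)).
  have Tg beta xi : \int[mu]_x (g x * cos (dotp xi x + beta)) =
      k.+1%:R * (ctr (beta - h k * xi ord0 i) xi - ctr beta xi).
    have e1 : dotp xi v = h k * xi ord0 i.
      rewrite /dotp /v (bigD1 i)//= !mxE !eqxx/= mulr1 big1 ?addr0 1?mulrC// => j ji.
      by rewrite !mxE eqxx/= (negbTE ji) !mulr0.
    have j1 : rint mu (fun x => f (x + v) * cos (dotp xi x + beta)) by apply: rint_bd => // x; exact: cos_max.
    rewrite -e1 -ctr_shift /ctr -(RintegralB measurableT j1 (rint_ctr beta xi)).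
    rewrite -(RintegralZl k.+1%:R measurableT (rintB j1 (rint_ctr beta xi))).
    by apply: eq_Rintegral => x _; rewrite /g; ring.
  have mT beta : measurable_fun setT (fun xi => \int[mu]_x (g x * cos (dotp xi x + beta))).
    exact: (@meas_Rint _ _ _ _ _ mu g (fun xi x => cos (dotp xi x + beta)) ig (mcos beta) (fun _ _ => cos_max _)).
  apply: (@le_trans _ _ (\int[mu]_xi (((\int[mu]_x (g x * cos (dotp xi x + 0))) ^+ 2)%:E +
      ((\int[mu]_x (g x * cos (dotp xi x + pi / 2))) ^+ 2)%:E))%E).
    apply: ge0_le_integral => //.
    + by move=> x _; rewrite lee_fin mulr_ge0// sqr_ge0.
    + apply/measurable_EFinP; apply: meas_mul => //; apply: meas_exp; apply: meas_mul; first exact: meas_cst.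
      by apply: meas_sin; apply: meas_mul; [exact: meas_cst|exact: measurable_rV_coord].
    + by apply/measurable_EFinP; apply: meas_add; apply: meas_exp; exact: mT.
    + move=> xi _; rewrite -EFinD lee_fin !Tg; set th := h k * xi ord0 i.
      rewrite (ctr_phase 0 (- th)) (ctr_phase (pi / 2) (- th)) cosN sinN !add0r /ctr2.
      have -> : ctr (pi / 2 + pi / 2) xi = - ctr 0 xi.
        by rewrite -(splitr pi) -[X in ctr X _]add0r ctr_phase cospi sinpi mul0r addr0 mulN1r.
      have := cos2Dsin2 th.
      move: (cos th) (sin th) (ctr 0 xi) (ctr (pi / 2) xi) (k.+1%:R : R) => c s A B K e.
      rewrite [leRHS](_ : _ = (K ^+ 2 * (A ^+ 2 + B ^+ 2)) * ((c - 1) ^+ 2 + s ^+ 2)); last by ring.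
      rewrite exprMn mulrAC ler_wpM2l ?lerDr ?sqr_ge0//.
      by rewrite mulr_ge0 ?addr_ge0 ?sqr_ge0.
  rewrite ge0_integralD//; first last.
  + by apply/measurable_EFinP; apply: meas_exp; exact: mT.
  + by move=> x _; rewrite lee_fin sqr_ge0.
  + by apply/measurable_EFinP; apply: meas_exp; exact: mT.
  + by move=> x _; rewrite lee_fin sqr_ge0.
  rewrite (_ : 2 * (2 * pi) ^+ n * C = (2 * pi) ^+ n * C + (2 * pi) ^+ n * C); last by ring.
  by rewrite EFinD leeD.
Qed.

Lemma rint_Q_ctr2 : rint mu (fun xi => Q xi * ctr2 xi).
Proof.
rewrite (_ : (fun _ => _) = (fun xi => ctr2 xi + \sum_i xi ord0 i ^+ 2 * ctr2 xi)).
  apply: rintD; first exact: rint_ctr2.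
  apply: rint_sum => i; exact: coord_ctr2.
by apply/funext => xi; rewrite /Q mulrDl mul1r /dotp mulr_suml.
Qed.

End transform.
End schwartz_fourier.

Section plancherel.
Context {R : realType} (n : nat).
Local Notation mu := (@lebesgue_rV R n).
Implicit Types (p : 'rV[R]_n -> R) (x y xi : 'rV[R]_n).

Lemma Rint_ext d (T : measurableType d) (m : {measure set T -> \bar R}) (F G : T -> R) :
  (forall t, F t = G t) -> \int[m]_t F t = \int[m]_t G t.
Proof. by move=> h; congr (Rintegral m setT _); apply/funext. Qed.

Lemma rint_ext d (T : measurableType d) (m : {measure set T -> \bar R}) (F G : T -> R) :
  (forall t, F t = G t) -> rint m G -> rint m F.
Proof. by move=> h; rewrite (_ : F = G)//; apply/funext. Qed.

Lemma rint_lin d (T : measurableType d) (m : {measure set T -> \bar R}) (a b : R) (F G : T -> R) :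
  rint m F -> rint m G -> rint m (fun t => a * F t + b * G t) /\
  \int[m]_t (a * F t + b * G t) = a * \int[m]_t F t + b * \int[m]_t G t.
Proof.
move=> iF iG; split; first by apply: rintD; exact: rintZ.
rewrite -(RintegralZl a measurableT iF) -(RintegralZl b measurableT iG).
exact: (RintegralD measurableT (rintZ a iF) (rintZ b iG)).
Qed.

Lemma rint_mulL2 d (T : measurableType d) (m : {measure set T -> \bar R}) (F G : T -> R) :
  measurable_fun setT F -> measurable_fun setT G ->
  rint m (fun t => F t ^+ 2) -> rint m (fun t => G t ^+ 2) -> rint m (fun t => F t * G t).
Proof.
move=> mF mG iF iG; apply: rint_le (rintD iF iG) _; first exact: meas_mul.
move=> t; rewrite normrM -[F t ^+ 2]real_normK ?num_real// -[G t ^+ 2]real_normK ?num_real//.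
move: `|F t| `|G t| => u v.
have := sqr_ge0 (u - v); have := sqr_ge0 u; have := sqr_ge0 v; rewrite !expr2; nra.
Qed.

Lemma meas_gn_shift (b : R) y : measurable_fun setT (fun x => gn b (x - y)).
Proof.
apply: (measurableT_comp (@meas_gn R b n)).
exact: (measurableT_comp (@measurable_rV_sub R n) (@pair2_measurable _ _ _ _ y)).
Qed.

Definition gconv p y := \int[mu]_xi (p xi * gn 1 (xi - y)).

Lemma rint_gn_sq (b : R) y : 0 < b -> rint mu (fun x => gn b (x - y) ^+ 2).
Proof.
move=> b0; have [i _] := @int_gn R b n b0.
have [j _] := rintegral_shift (- y) i.
have mj := rint_meas j.
apply: rint_le j _; first exact: meas_exp.
move=> x; rewrite normrX expr2 ger0_norm ?gn_ge0// ler_piMl ?gn_ge0//.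
by rewrite /gn -(@expR0 R) ler_expR oppr_le0 divr_ge0// mulr_ge0 ?dotp_ge0// ltW.
Qed.

Lemma rint_gconv p y : measurable_fun setT p -> rint mu (fun x => p x ^+ 2) ->
  rint mu (fun xi => p xi * gn 1 (xi - y)).
Proof.
move=> mp ip; apply: rint_mulL2 => //; last exact: rint_gn_sq.
exact: meas_gn_shift.
Qed.

Lemma ft_ext p beta : measurable_fun setT p -> rint mu (fun x => p x ^+ 2) ->
  exists U : 'rV[R]_n -> R, [/\ measurable_fun setT U,
    (\int[mu]_y (U y ^+ 2)%:E <= ((2 * pi) ^+ n * \int[mu]_x (p x ^+ 2))%:E)%E &
    forall y gamma, rint mu (fun x => U x * (gn 1 x * cos (dotp x y + gamma))) /\
      \int[mu]_x (U x * (gn 1 x * cos (dotp x y + gamma))) =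
      gc 1 ^+ n / 2 * (cos (gamma - beta) * gconv p y + cos (gamma + beta) * gconv p (- y))].
Proof.
move=> mp ip.
pose k y x : R := cos (dotp y x + beta).
have mk : measurable_fun setT (fun z => k z.1 z.2).
  by apply: meas_cos; apply: meas_add; [apply: meas_dotp|exact: meas_cst].
have k1 y x : `|k y x| <= 1 by exact: cos_max.
have B0 : 0 <= (2 * pi) ^+ n :> R by rewrite exprn_ge0// mulr_ge0 ?pi_ge0.
have bes (q : 'rV[R]_n -> R) : measurable_fun setT q -> rint mu (fun x => 1 * q x) ->
    (\int[mu]_y ((\int[mu]_x (1 * q x * k y x)) ^+ 2)%:E <= ((2 * pi) ^+ n)%:E * \int[mu]_x (q x ^+ 2)%:E)%E.
  move=> mq; rewrite (_ : (fun x => 1 * q x) = q); last by apply/funext => x; rewrite mul1r.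
  move=> iq; have := ft_bessel beta mq iq.
  rewrite (_ : (fun y => _) = (fun y => ((\int[mu]_x (1 * q x * k y x)) ^+ 2)%:E))//.
  apply/funext => y; congr ((_ ^+ 2)%:E); apply: eq_Rintegral => x _; by rewrite mul1r.
have ichi j : rint mu (fun x => (fun=> 1) x * p x * chi j x).
  by apply: rint_chi => // x; rewrite expr1n Q_ge1.
have [sg [U [D [mU mD D0 Dfin [sgk cS bS iU]]]]] :=
  L2ext mk k1 B0 bes mp ip (@meas_chi R n) (@chi_ge0 R n) (@chi_le1 R n) (@cvg_chi R n) ichi.
exists U; split => // y gamma.
pose phi x := gn 1 x * cos (dotp x y + gamma) : R.
have g1 : 0 < 1 :> R by [].
have iphi : rint mu phi by exact: rint_gn_cos.
have mphi := rint_meas iphi.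
have iphi2 : rint mu (fun x => phi x ^+ 2).
  have [ig _] := @int_gn R 1 n g1.
  apply: rint_le ig _; first exact: meas_exp.
  move=> x; rewrite normrX /phi normrM exprMn (ger0_norm (gn_ge0 _ _)).
  have h1 : gn 1 x <= 1 by have := @chi_le1 R n 0 x; rewrite /chi invr1.
  have h2 : `|cos (dotp x y + gamma)| <= 1 by exact: cos_max.
  apply: (@le_trans _ _ (gn 1 x ^+ 2)); first by rewrite ler_piMr ?sqr_ge0// expr_le1.
  by rewrite expr2 ler_piMl ?gn_ge0.
have inner xi : \int[mu]_x (phi x * k x xi) =
    gc 1 ^+ n / 2 * cos (gamma - beta) * gn 1 (xi - y) + gc 1 ^+ n / 2 * cos (gamma + beta) * gn 1 (xi - - y).
  have e x : phi x * k x xi = 2^-1 * (gn 1 x * cos (dotp x (y - xi) + (gamma - beta))) +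
      2^-1 * (gn 1 x * cos (dotp x (y + xi) + (gamma + beta))).
    rewrite /phi /k !dotpDr dotpNr.
    move: (dotp x y) (dotp x xi) (gn 1 x) => A B g.
    rewrite (_ : A - B + _ = (A + gamma) - (B + beta)); last by ring.
    rewrite (_ : A + B + _ = (A + gamma) + (B + beta)); last by ring.
    rewrite (cosB (A + gamma) (B + beta)) (cosD (A + gamma) (B + beta)).
    by move: (cos (A + gamma)) (cos (B + beta)) (sin _) (sin _) => c1 c2 s1 s2; field.
  rewrite (Rint_ext _ e).
  have [_ ->] := rint_lin 2^-1 2^-1 (@rint_gn_cos R 1 n (gamma - beta) (y - xi) g1) (@rint_gn_cos R 1 n (gamma + beta) (y + xi) g1).
  rewrite !int_gn_cos// invr1 gn_sub opprK (addrC y xi); ring.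
have ih z := rint_gconv z mp ip.
have eT xi : 1 * p xi * \int[mu]_x (phi x * k x xi) =
    (gc 1 ^+ n / 2 * cos (gamma - beta)) * (p xi * gn 1 (xi - y)) +
    (gc 1 ^+ n / 2 * cos (gamma + beta)) * (p xi * gn 1 (xi - - y)).
  by rewrite inner; ring.
have [j1 j2] := rint_lin (gc 1 ^+ n / 2 * cos (gamma - beta)) (gc 1 ^+ n / 2 * cos (gamma + beta)) (ih y) (ih (- y)).
have ipT : rint mu (fun xi => (fun=> 1) xi * p xi * \int[mu]_x (phi x * k x xi)).
  exact: rint_ext eT j1.
have [r1 r2] := pairing mk k1 (@meas_chi R n) (@chi_ge0 R n) (@chi_le1 R n) (@cvg_chi R n) ichi sgk mU mD D0 Dfin cS bS iphi iphi2 ipT.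
split; first exact: r1.
apply: (etrans r2); apply: (etrans (Rint_ext mu eT)); apply: (etrans j2).
rewrite -/(gconv p y) -/(gconv p (- y)).
move: (gconv p y) (gconv p (- y)) (cos _) (cos _) (gc 1 ^+ n) => u v c1 c2 g; ring.
Qed.

Lemma ft_eq0 (r : 'rV[R]_n -> R) : rint mu r ->
  (forall y beta, \int[mu]_x (r x * cos (dotp x y + beta)) = 0) -> {ae mu, forall x, r x = 0}.
Proof.
move=> ir H; apply: gauss_conv_eq0 => // k z.
have k0 : 0 < k.+1%:R^-1 :> R by rewrite invr_gt0.
have [ig _] := @int_gn R k.+1%:R^-1 n k0.
have [||_ _ e] := @fub_bd _ _ _ _ R mu mu (@gn R k.+1%:R^-1 n) r (fun y x => cos (dotp y x + - dotp y z)) ig ir.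
- apply: meas_cos; apply: meas_add; first by apply: meas_dotp.
  apply: meas_opp; apply: meas_dotp => //; exact: measurable_cst.
- by move=> y x; exact: cos_max.
have c0 : gc k.+1%:R^-1 ^+ n != 0 :> R by rewrite expf_neq0// gt_eqF// gc_gt0.
apply: (mulfI c0); rewrite mulr0.
have eg x : \int[mu]_y (gn k.+1%:R^-1 y * cos (dotp y x + - dotp y z)) = gc k.+1%:R^-1 ^+ n * gn k.+1%:R (x - z).
  have := @int_gn_cos R k.+1%:R^-1 n 0 (x - z) k0; rewrite cos0 mul1r invrK => <-.
  by apply: eq_Rintegral => y _; rewrite dotpDr dotpNr addr0.
have ic : rint mu (fun x => r x * gn k.+1%:R (x - z)).
  apply: rint_bd => //.
    exact: meas_gn_shift.
  move=> x; rewrite ger0_norm ?gn_ge0// /gn -(@expR0 R) ler_expR oppr_le0 divr_ge0// mulr_ge0 ?dotp_ge0//.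
rewrite -(RintegralZl _ measurableT ic).
transitivity (\int[mu]_x (r x * \int[mu]_y (gn k.+1%:R^-1 y * cos (dotp y x + - dotp y z)))).
  by apply: eq_Rintegral => x _; rewrite eg mulrCA.
rewrite -e (_ : (fun y => _) = fun=> 0).
  by rewrite Rintegral_cst// mul0r.
apply/funext => y; rewrite (_ : \int[mu]_x _ = 0) ?mulr0//.
by rewrite -[RHS](H y (- dotp y z)); apply: eq_Rintegral => x _; rewrite dotpC.
Qed.

End plancherel.

Section plancherel_le.
Context {R : realType} (n : nat).
Local Notation mu := (@lebesgue_rV R n).
Implicit Types (p G : 'rV[R]_n -> R) (x y xi : 'rV[R]_n).

Definition gtr G (gamma : R) y := \int[mu]_x (G x * gn 1 x * cos (dotp x y + gamma)).

Section one_function.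
Variable G : 'rV[R]_n -> R.
Hypothesis iG : rint mu (fun x => G x * gn 1 x).

Lemma rint_gtr gamma y : rint mu (fun x => G x * gn 1 x * cos (dotp x y + gamma)).
Proof.
apply: rint_bd => // [|x]; last exact: cos_max.
by apply: meas_cos; apply: meas_add; [apply: meas_dotp => //; exact: measurable_cst|exact: meas_cst].
Qed.

Lemma gtrN gamma y : gtr G gamma (- y) = gtr G (- gamma) y.
Proof.
apply: Rint_ext => x; rewrite dotpNr -[in RHS]cosN opprD opprK; congr (_ * cos _).
Qed.

Lemma gtr_phase gamma y : gtr G gamma y = cos gamma * gtr G 0 y - sin gamma * gtr G (- (pi / 2)) y.
Proof.
have [_ e] := rint_lin (cos gamma) (- sin gamma) (rint_gtr 0 y) (rint_gtr (- (pi / 2)) y).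
rewrite -mulNr /gtr -e; apply: Rint_ext => x.
rewrite addr0 cosBpihalf cosD; ring.
Qed.
End one_function.

Lemma plancherel_le (G1 G2 h1 h2 : 'rV[R]_n -> R) :
  measurable_fun setT G1 -> rint mu (fun x => G1 x * gn 1 x) -> rint mu (fun x => G2 x * gn 1 x) ->
  measurable_fun setT h1 -> measurable_fun setT h2 ->
  rint mu (fun x => h1 x ^+ 2) -> rint mu (fun x => h2 x ^+ 2) ->
  (forall y, gtr G1 0 y - gtr G2 (- (pi / 2)) y = gc 1 ^+ n * gconv h1 y) ->
  (forall y, gtr G2 0 y + gtr G1 (- (pi / 2)) y = gc 1 ^+ n * gconv h2 y) ->
  (\int[mu]_x (G1 x ^+ 2)%:E <=
   (2 * (2 * pi) ^+ n * (\int[mu]_x (h1 x ^+ 2) + \int[mu]_x (h2 x ^+ 2)))%:E)%E.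
Proof.
move=> mG iG1 iG2 mh1 mh2 ih1 ih2 H1 H2.
have C1 y : gtr G1 0 y = gc 1 ^+ n / 2 * (gconv h1 y + gconv h1 (- y)).
  have e1 := H1 y; have := H1 (- y); rewrite !gtrN oppr0 opprK (gtr_phase iG2 (pi / 2)) cos_pihalf sin_pihalf.
  move: e1; move: (gtr G1 0 y) (gtr G2 0 y) (gtr G2 _ y) (gconv _ y) (gconv _ (- y)) (gc 1 ^+ n) => a b c d e f; lra.
have S1 y : gtr G1 (- (pi / 2)) y = gc 1 ^+ n / 2 * (gconv h2 y - gconv h2 (- y)).
  have e1 := H2 y; have := H2 (- y); rewrite !gtrN oppr0 opprK (gtr_phase iG1 (pi / 2)) cos_pihalf sin_pihalf.
  move: e1; move: (gtr G2 0 y) (gtr G1 0 y) (gtr G1 _ y) (gconv _ y) (gconv _ (- y)) (gc 1 ^+ n) => a b c d e f; lra.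
have [U [mU iU pU]] := ft_ext 0 mh1 ih1.
have [V [mV iV pV]] := ft_ext (- (pi / 2)) mh2 ih2.
have E x y gamma W : W * (gn 1 x * cos (dotp x y + gamma)) = W * gn 1 x * cos (dotp x y + gamma) by rewrite mulrA.
have ig (W : 'rV[R]_n -> R) : (forall y gamma, rint mu (fun x => W x * (gn 1 x * cos (dotp x y + gamma)))) ->
    rint mu (fun x => W x * gn 1 x).
  move=> h; apply: rint_ext (h 0 0) => x.
  by rewrite /dotp big1 ?addr0 ?cos0 ?mulr1// => i _; rewrite mxE mulr0.
have iUg : rint mu (fun x => U x * gn 1 x) by apply: ig => y gamma; have [] := pU y gamma.
have iVg : rint mu (fun x => V x * gn 1 x) by apply: ig => y gamma; have [] := pV y gamma.
have Z : {ae mu, forall x, (G1 x - (U x + V x)) * gn 1 x = 0}.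
  have ir : rint mu (fun x => (G1 x - (U x + V x)) * gn 1 x).
    apply: rint_ext (rintB iG1 (rintD iUg iVg)) => x; ring.
  apply: ft_eq0 ir _ => y gamma.
  have iA := rint_gtr iG1 gamma y; have iB := rint_gtr iUg gamma y; have iC := rint_gtr iVg gamma y.
  transitivity (gtr G1 gamma y - (gtr U gamma y + gtr V gamma y)).
    rewrite /gtr -(RintegralD measurableT iB iC) -(RintegralB measurableT iA (rintD iB iC)).
    apply: Rint_ext => x; ring.
  have -> : gtr U gamma y = gc 1 ^+ n / 2 * (cos (gamma - 0) * gconv h1 y + cos (gamma + 0) * gconv h1 (- y)).
    by rewrite -(proj2 (pU y gamma)); apply: Rint_ext => x; rewrite mulrA.
  have -> : gtr V gamma y = gc 1 ^+ n / 2 * (cos (gamma - - (pi / 2)) * gconv h2 y + cos (gamma + - (pi / 2)) * gconv h2 (- y)).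
    by rewrite -(proj2 (pV y gamma)); apply: Rint_ext => x; rewrite mulrA.
  rewrite (gtr_phase iG1 gamma y) (C1 y) (S1 y) opprK.
  rewrite (cosDpihalf gamma) (cosBpihalf gamma) subr0 addr0.
  move: (gconv h1 y) (gconv h1 (- y)) (gconv h2 y) (gconv h2 (- y)) (cos gamma) (sin gamma) (gc 1 ^+ n).
  by move=> a b c d e f g; ring.
have Gae : ae_eq mu setT (fun x => (G1 x ^+ 2)%:E) (fun x => ((U x + V x) ^+ 2)%:E).
  apply: filterS Z => x /= h _; congr ((_ ^+ 2)%:E); apply/eqP; rewrite -subr_eq0.
  by move/eqP: h; rewrite mulf_eq0 => /orP[//|]; rewrite gt_eqF// /gn expR_gt0.
rewrite (ae_eq_integral _ _ _ _ _ Gae)//; first last.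
- by apply/measurable_EFinP; apply: meas_exp; exact: meas_add.
- by apply/measurable_EFinP; exact: meas_exp.
have [c [c0 ce]] : exists c : R, 0 <= c /\ c = 2 by exists 2.
apply: (@le_trans _ _ (\int[mu]_x (c%:E * (U x ^+ 2)%:E + c%:E * (V x ^+ 2)%:E))%E).
  apply: ge0_le_integral => //.
  + by move=> x _; rewrite lee_fin sqr_ge0.
  + by apply/measurable_EFinP; apply: meas_exp; exact: meas_add.
  + by apply/measurable_EFinP; apply: meas_add; apply: meas_mul => //; try exact: meas_cst; exact: meas_exp.
  + move=> x _; rewrite -!EFinM -EFinD lee_fin ce.
    have := sqr_ge0 (U x - V x); rewrite -subr_ge0; move: (U x) (V x) => u v h.
    by rewrite (_ : _ - _ = (u - v) ^+ 2); [exact: sqr_ge0|ring].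
have m2 (W : 'rV[R]_n -> R) : measurable_fun setT W -> measurable_fun setT (fun x => (W x ^+ 2)%:E).
  by move=> mW; apply/measurable_EFinP; exact: meas_exp.
have n2 (W : 'rV[R]_n -> R) x : (0 <= (W x ^+ 2)%:E)%E by rewrite lee_fin sqr_ge0.
rewrite ge0_integralD//; first last.
- by apply: measurable_funeM; exact: m2.
- by move=> x _; rewrite mule_ge0// lee_fin.
- by apply: measurable_funeM; exact: m2.
- by move=> x _; rewrite mule_ge0// lee_fin.
rewrite (ge0_integralZl _ measurableT (m2 U mU) (fun x _ => n2 U x))// (ge0_integralZl _ measurableT (m2 V mV) (fun x _ => n2 V x))//.
set A := \int[mu]_x (h1 x ^+ 2) in iU *; set B := \int[mu]_x (h2 x ^+ 2) in iV *.
rewrite (_ : 2 * _ * _ = c * ((2 * pi) ^+ n * A) + c * ((2 * pi) ^+ n * B)); last by rewrite ce; ring.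
by rewrite EFinD; apply: leeD; rewrite EFinM; apply: lee_wpmul2l => //; rewrite lee_fin.
Qed.
End plancherel_le.

Section gauss_uniqueness.
Context {R : realType} (n : nat).
Local Notation mu := (@lebesgue_rV R n).

Lemma gn_mul (a k : R) (z x : 'rV[R]_n) : 0 < a -> 0 < k ->
  gn a x * gn k (x - z) = gn (a * k / (a + k)) z * gn (a + k) (x - (k / (a + k)) *: z).
Proof.
move=> a0 k0; have s0 : a + k != 0 by rewrite gt_eqF// addr_gt0.
rewrite /gn -!expRD; congr expR.
have dZ c (u v : 'rV[R]_n) : dotp (c *: u) v = c * dotp u v.
  by rewrite /dotp mulr_sumr; apply: eq_bigr => i _; rewrite mxE mulrA.
rewrite !(dotpDl, dotpDr, dotpNl, dotpNr) (dotpC z x) (dotpC _ (_ *: z)) !dZ (dotpC z x) (dotpC z (_ *: z)) !dZ.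
by move: (dotp x x) (dotp x z) (dotp z z) => u v w; field.
Qed.

Lemma gauss_pairing_eq0 (r : 'rV[R]_n -> R) :
  (forall a y, 0 < a -> rint mu (fun x => r x * gn a (x - y))) ->
  (forall a y, 0 < a -> \int[mu]_x (r x * gn a (x - y)) = 0) -> {ae mu, forall x, r x = 0}.
Proof.
move=> ir H.
have ir1 : rint mu (fun x => r x * gn 1 x).
  by apply: rint_ext (ir 1 0 ltr01) => x; rewrite subr0.
have := gauss_conv_eq0 ir1; move=> Z.
have {Z} : {ae mu, forall x, r x * gn 1 x = 0}.
  apply: Z => k z.
  have k0 : 0 < k.+1%:R :> R by rewrite ltr0n.
  have s0 : 0 < 1 + k.+1%:R :> R by rewrite addr_gt0.
  have i := ir (1 + k.+1%:R) ((k.+1%:R / (1 + k.+1%:R)) *: z) s0.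
  have e := RintegralZl (gn (1 * k.+1%:R / (1 + k.+1%:R)) z) measurableT i.
  rewrite H// mulr0 in e; rewrite -[RHS]e; apply: Rint_ext => x.
  by rewrite -mulrA gn_mul// mulrCA.
apply: filterS => x /eqP; rewrite mulf_eq0 => /orP[/eqP//|].
by rewrite gt_eqF// /gn expR_gt0.
Qed.
End gauss_uniqueness.

Section spacetime.
Context {R : realType} (m : nat) (alpha : R).
Hypothesis ha : 1 / 2 < alpha.
Local Notation leb := (@lebesgue_measure R).
Local Notation mu := (@lebesgue_rV R m.+1).
Implicit Types (psi p : 'rV[R]_m.+1 -> R) (x xi : 'rV[R]_m.+1) (t : R).

Lemma enorm_le_Q1 x : enorm x <= Q x.
Proof.
have : enorm x ^+ 2 = dotp x x by exact: enorm2.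
rewrite /Q => <-; have : 0 <= enorm x by exact: sqrtr_ge0.
move: (enorm x) => s; nra.
Qed.

Lemma meas_ctr_phase psi beta t : real_schwartz psi ->
  measurable_fun setT (fun xi => ctr psi (t * phs xi + beta) xi).
Proof.
move=> sp; rewrite (_ : (fun _ => _) = (fun xi => cos (t * phs xi + beta) * ctr psi 0 xi +
    sin (t * phs xi + beta) * ctr psi (pi / 2) xi)); last first.
  by apply/funext => xi; rewrite -[X in ctr psi X _]add0r ctr_phase// add0r.
have mp : measurable_fun setT (fun xi => t * phs xi + beta).
  by apply: meas_add; [apply: meas_mul; [exact: meas_cst|exact: meas_phs]|exact: meas_cst].
apply: meas_add; apply: meas_mul; try exact: meas_ctr; [exact: meas_cos|exact: meas_sin].
Qed.

Lemma rint_amp_ctr psi p beta t : real_schwartz psi -> measurable_fun setT p ->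
  rint mu (fun x => p x ^+ 2) ->
  rint mu (fun xi => amp xi * p xi * ctr psi (t * phs xi + beta) xi).
Proof.
move=> sp mp ip; have mc := meas_ctr_phase beta t sp.
apply: (@rint_ext R _ _ mu _ (fun xi => p xi * (amp xi * ctr psi (t * phs xi + beta) xi))).
  by move=> xi; ring.
have ma := @meas_amp R m.
apply: rint_mulL2 => //; first exact: meas_mul.
apply: rint_le (rint_Q_ctr2 sp) _; first by apply: meas_exp; exact: meas_mul.
move=> xi; rewrite ger0_norm ?sqr_ge0// exprMn amp2 ler_pM ?sqrtr_ge0 ?sqr_ge0//.
  exact: enorm_le_Q1.
exact: ctr_le_ctr2.
Qed.

Lemma Wt_inv : exists K, forall x, `|(Wt alpha x)^-1| <= Q x ^+ K.
Proof.
exists (Num.truncn alpha).+1 => x.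
have a0 : 0 < alpha by apply: lt_trans ha; rewrite divr_gt0.
rewrite ger0_norm ?invr_ge0 ?(ltW (Wt_gt0 _ _))// -[leRHS]invrK lef_pV2 ?posrE ?invr_gt0 ?exprn_gt0 ?Q_gt0 ?Wt_gt0//.
have W1 := Wt_le1 ha x; have W0 := Wt_gt0 alpha x.
apply: (@le_trans _ _ (Wt alpha x ^+ 2)); last by rewrite expr2 ler_piMl ?(ltW W0).
rewrite Wt2 lef_pV2 ?posrE ?exprn_gt0 ?powR_gt0 ?Q_gt0//.
rewrite -powR_mulrn ?Q_ge0//; apply: ler_powR; first exact: Q_ge1.
exact/ltW/truncnS_gt.
Qed.

Lemma spacetime_solution p beta : measurable_fun setT p -> rint mu (fun x => p x ^+ 2) ->
  exists U : R * 'rV[R]_m.+1 -> R, [/\ measurable_fun setT U,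
    (\int[(leb \x mu)%E]_q ((U q * Wt alpha q.2) ^+ 2)%:E <=
       (@Bst R m alpha * \int[mu]_x (p x ^+ 2))%:E)%E &
    {ae leb, forall t, forall psi, real_schwartz psi ->
      rint mu (fun x => U (t, x) * psi x) /\
      \int[mu]_x (U (t, x) * psi x) =
      \int[mu]_xi (amp xi * p xi * ctr psi (t * phs xi + beta) xi)}].
Proof.
move=> mp ip.
have ichi j : rint mu (fun x => amp x * p x * chi j x).
  apply: rint_chi => //; first exact: meas_amp.
  by move=> x; rewrite amp2 enorm_le_Q1.
have [sg [U [D [mU mD D0 Dfin [sgk cS bS iU]]]]] :=
  @L2ext _ _ _ _ R (leb \x mu)%E mu (stk alpha beta) (@amp R m) p (@Bst R m alpha) (@chi R m.+1) (meas_stk alpha beta) (stk_le1 ha beta) (@Bst_ge0 R m alpha) (smoothing_bessel ha beta) mp ip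
    (@meas_chi R m.+1) (@chi_ge0 R m.+1) (@chi_le1 R m.+1) (@cvg_chi R m.+1) ichi.
have W0 x : Wt alpha x != 0 by rewrite gt_eqF// Wt_gt0.
have mW := @meas_Wt R m alpha.
have mWi : measurable_fun setT (fun x => (Wt alpha x)^-1).
  by apply: meas_inv => // x; exact/ltW/Wt_gt0.
exists (fun q => U q * (Wt alpha q.2)^-1); split.
- by apply: meas_mul => //; exact: (measurableT_comp mWi measurable_snd).
- by under eq_integral => q _ do rewrite mulfVK//.
have iD : (leb \x mu)%E.-integrable setT D.
  apply/integrableP; split => //; apply: le_lt_trans Dfin.
  by rewrite le_eqVlt; apply/orP; left; apply/eqP; apply: eq_integral => y _; rewrite gee0_abs.
have := ae_integrable1 iD; apply: filterS => t /= iDt psi sp.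
have Dt : (\int[mu]_z D (t, z) < +oo)%E.
  move/integrableP : iDt => [_]; apply: le_lt_trans.
  by rewrite le_eqVlt; apply/orP; left; apply/eqP; apply: eq_integral => y _; rewrite gee0_abs.
have pt : measurable_fun setT (fun z : 'rV[R]_m.+1 => (t, z)) by exact: pair1_measurable.
have mpsi := schwartz_measurable sp.
have [K hK] := Wt_inv.
have [i1 i2] := decays_rint (schwartz_decays [::] sp) mpsi mWi hK.
have mk : measurable_fun setT (fun z : 'rV[R]_m.+1 * 'rV[R]_m.+1 => stk alpha beta (t, z.1) z.2).
  have h : measurable_fun setT (fun z : 'rV[R]_m.+1 * 'rV[R]_m.+1 => ((t, z.1), z.2)).
    apply/measurable_fun_pairP; split; last exact: measurable_snd.
    exact: (measurableT_comp pt measurable_fst).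
  exact: (measurableT_comp (meas_stk alpha beta) h).
have inner xi : amp xi * p xi * \int[mu]_z (psi z * (Wt alpha z)^-1 * stk alpha beta (t, z) xi) =
    amp xi * p xi * ctr psi (t * phs xi + beta) xi.
  congr (_ * _); apply: Rint_ext => z; rewrite /stk/= dotpC.
  by rewrite mulrA mulfVK.
have [r1 r2] := @pairing _ _ _ _ R mu mu (fun z x => stk alpha beta (t, z) x) (fun x => amp x * p x) (@chi R m.+1) sg
  (fun z => U (t, z)) (fun z => psi z * (Wt alpha z)^-1) (fun z => D (t, z))
  mk (fun z x => stk_le1 ha beta (t, z) x) (@meas_chi R m.+1) (@chi_ge0 R m.+1) (@chi_le1 R m.+1) (@cvg_chi R m.+1) ichi sgk
  (measurableT_comp mU pt) (measurableT_comp mD pt) (fun z => D0 (t, z)) Dt (fun z => cS (t, z))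
  (fun j z => bS j (t, z)) i1 i2 (rint_ext inner (rint_amp_ctr beta t sp mp ip)).
split.
  by apply: rint_ext r1 => z /=; ring.
transitivity (\int[mu]_z (U (t, z) * (psi z * (Wt alpha z)^-1))).
  by apply: Rint_ext => z /=; ring.
by rewrite r2; apply: Rint_ext => xi; exact: inner.
Qed.

End spacetime.

Section complex_parts.
Context {R : realType}.
Implicit Types z w : R[i].

Lemma Re_mul z w : complex.Re (z * w) = complex.Re z * complex.Re w - complex.Im z * complex.Im w.
Proof. by case: z w => a b [c d]. Qed.

Lemma Im_mul z w : complex.Im (z * w) = complex.Re z * complex.Im w + complex.Im z * complex.Re w.
Proof. by case: z w => a b [c d]. Qed.

Lemma normc2 z : normc z ^+ 2 = complex.Re z ^+ 2 + complex.Im z ^+ 2.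
Proof. by case: z => a b /=; rewrite sqr_sqrtr// addr_ge0 ?sqr_ge0. Qed.
End complex_parts.

Section complex_level.
Context {R : realType} (n : nat).
Local Notation mu := (@lebesgue_rV R n).
Implicit Types (g h G : 'rV[R]_n -> R[i]) (x y xi : 'rV[R]_n).

Lemma schwartz_real (psi : 'rV[R]_n -> R) : real_schwartz psi -> schwartz (fun x => ((psi x)%:C)%C).
Proof. by move=> sp; split => //; exact: (@real_schwartz0 R n 1 0 ltr01). Qed.

Definition cgauss (a : R) y : 'rV[R]_n -> R[i] := fun xi => ((gn a (xi - y))%:C)%C.

Lemma schwartz_cgauss a y : 0 < a -> schwartz (cgauss a y).
Proof. by move=> a0; apply: schwartz_real; apply: (@gclass_schwartz R n a y a0); exact: gclass_base. Qed.

Lemma inv_fourier_gauss y x :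
  let c := (2 * pi) ^- n * gc 1 ^+ n in
  inv_fourier (cgauss 1 y) x =
  Complex (c * (gn 1 x * cos (dotp x y))) (c * (gn 1 x * sin (dotp x y))).
Proof.
move=> c.
have I b : \int[mu]_xi (gn 1 (xi - y) * cos (dotp x xi + b)) = gc 1 ^+ n * gn 1 x * cos (dotp x y + b).
  have [_ e] := rintegral_shift (- y) (@rint_gn_cos R 1 n (dotp x y + b) x ltr01).
  transitivity (\int[mu]_xi (gn 1 xi * cos (dotp xi x + (dotp x y + b)))).
    rewrite -e; apply: Rint_ext => xi; congr (_ * cos _).
    by rewrite (dotpC _ x) dotpDr dotpNr; ring.
  by rewrite int_gn_cos// invr1; ring.
rewrite /inv_fourier /cintegral.
rewrite (_ : \int[mu]_xi complex.Re _ = gc 1 ^+ n * gn 1 x * cos (dotp x y)); last first.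
  rewrite -[dotp x y]addr0 -I; apply: Rint_ext => xi.
  by rewrite Re_mul/= mul0r subr0 addr0.
rewrite (_ : \int[mu]_xi complex.Im _ = gc 1 ^+ n * gn 1 x * sin (dotp x y)); last first.
  rewrite -cosBpihalf -I; apply: Rint_ext => xi.
  by rewrite Im_mul/= mul0r addr0 cosBpihalf.
apply/eqP; rewrite eq_complex Re_mul Im_mul/= !mul0r subr0 addr0 /c -!mulrA.
by rewrite !eqxx.
Qed.

Lemma tempered_gauss g a y : tempered_fun g -> 0 < a ->
  [/\ rint mu (fun x => complex.Re (g x) * gn a (x - y)),
      rint mu (fun x => complex.Im (g x) * gn a (x - y)) &
      of_fun g (cgauss a y) =
      Complex (\int[mu]_x (complex.Re (g x) * gn a (x - y))) (\int[mu]_x (complex.Im (g x) * gn a (x - y)))].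
Proof.
move=> [mg tg] a0; have [i1 i2] := tg _ (schwartz_cgauss y a0).
have e1 x : complex.Re (g x) * gn a (x - y) = complex.Re (g x * cgauss a y x) by rewrite Re_mul/= mulr0 subr0.
have e2 x : complex.Im (g x) * gn a (x - y) = complex.Im (g x * cgauss a y x) by rewrite Im_mul/= mulr0 add0r.
split; [exact: rint_ext e1 i1|exact: rint_ext e2 i2|].
by rewrite /of_fun /cintegral (Rint_ext _ e1) (Rint_ext _ e2).
Qed.

Lemma tempered_unique g h : tempered_fun g -> tempered_fun h ->
  (forall phi, schwartz phi -> of_fun g phi = of_fun h phi) -> {ae mu, forall x, g x = h x}.
Proof.
move=> tg th e.
have Z1 : {ae mu, forall x, complex.Re (g x) - complex.Re (h x) = 0}.
  have D a y x : (complex.Re (g x) - complex.Re (h x)) * gn a (x - y) =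
      complex.Re (g x) * gn a (x - y) - complex.Re (h x) * gn a (x - y) by rewrite mulrBl.
  apply: gauss_pairing_eq0 => a y a0; have [i1 _ E1] := tempered_gauss y tg a0;
    have [j1 _ E2] := tempered_gauss y th a0.
    exact: rint_ext (D a y) (rintB i1 j1).
  rewrite (Rint_ext _ (D a y)) (RintegralB measurableT i1 j1).
  have := e _ (schwartz_cgauss y a0); rewrite E1 E2 => -[-> _].
  by rewrite subrr.
have Z2 : {ae mu, forall x, complex.Im (g x) - complex.Im (h x) = 0}.
  have D a y x : (complex.Im (g x) - complex.Im (h x)) * gn a (x - y) =
      complex.Im (g x) * gn a (x - y) - complex.Im (h x) * gn a (x - y) by rewrite mulrBl.
  apply: gauss_pairing_eq0 => a y a0; have [_ i1 E1] := tempered_gauss y tg a0;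
    have [_ j1 E2] := tempered_gauss y th a0.
    exact: rint_ext (D a y) (rintB i1 j1).
  rewrite (Rint_ext _ (D a y)) (RintegralB measurableT i1 j1).
  have := e _ (schwartz_cgauss y a0); rewrite E1 E2 => -[_ ->].
  by rewrite subrr.
apply: filterS2 Z1 Z2 => x /eqP h1 /eqP h2; apply/eqP.
by rewrite eq_complex -subr_eq0 h1 -subr_eq0 h2.
Qed.

Lemma plancherel_tempered G h : tempered_fun G -> cmeasurable h ->
  rint mu (fun x => complex.Re (h x) ^+ 2) -> rint mu (fun x => complex.Im (h x) ^+ 2) ->
  (forall phi, schwartz phi -> of_fun G (inv_fourier phi) = of_fun h phi) ->
  let C := (2 * (2 * pi) ^+ n * (\int[mu]_x (complex.Re (h x) ^+ 2) + \int[mu]_x (complex.Im (h x) ^+ 2))) in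
  (\int[mu]_x (complex.Re (G x) ^+ 2)%:E <= C%:E)%E /\ (\int[mu]_x (complex.Im (G x) ^+ 2)%:E <= C%:E)%E.
Proof.
move=> tG [mh1 mh2] ih1 ih2 e C; have [[mG1 mG2] _] := tG.
have [i1 i2 _] := tempered_gauss 0 tG ltr01.
have {}i1 : rint mu (fun x => complex.Re (G x) * gn 1 x) by apply: rint_ext i1 => x; rewrite subr0.
have {}i2 : rint mu (fun x => complex.Im (G x) * gn 1 x) by apply: rint_ext i2 => x; rewrite subr0.
pose c : R := (2 * pi) ^- n * gc 1 ^+ n.
have cE : gc 1 ^+ n * c = 1.
  have := @gcV R 1 ltr01; rewrite invr1 => g2.
  rewrite /c mulrCA -exprMn g2 mulVf// expf_neq0// mulf_neq0 ?pnatr_eq0//.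
  by rewrite gt_eqF// pi_gt0.
have S y x : sin (dotp x y) = cos (dotp x y + - (pi / 2)) by rewrite cosBpihalf.
have H y : c * (gtr (fun x => complex.Re (G x)) 0 y - gtr (fun x => complex.Im (G x)) (- (pi / 2)) y) =
      gconv (fun x => complex.Re (h x)) y /\
    c * (gtr (fun x => complex.Im (G x)) 0 y + gtr (fun x => complex.Re (G x)) (- (pi / 2)) y) =
      gconv (fun x => complex.Im (h x)) y.
  have j1 := rint_gtr i1; have j2 := rint_gtr i2.
  have e1 : of_fun h (cgauss 1 y) = Complex (gconv (fun x => complex.Re (h x)) y) (gconv (fun x => complex.Im (h x)) y).
    rewrite /of_fun /cintegral; congr Complex; apply: Rint_ext => x.
      by rewrite Re_mul/= mulr0 subr0.
    by rewrite Im_mul/= mulr0 add0r.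
  have := e _ (schwartz_cgauss y ltr01); rewrite e1 => -[<- <-]; split.
    have [_ r] := rint_lin c (- c) (j1 0 y) (j2 (- (pi / 2)) y).
    rewrite mulrBr -mulNr -r; apply: Rint_ext => x.
    by rewrite Re_mul inv_fourier_gauss/= S addr0 /c; ring.
  have [_ r] := rint_lin c c (j2 0 y) (j1 (- (pi / 2)) y).
  rewrite mulrDr -r; apply: Rint_ext => x.
  by rewrite Im_mul inv_fourier_gauss/= S addr0 /c; ring.
split.
  have := @plancherel_le R n (fun x => complex.Re (G x)) (fun x => complex.Im (G x)) (fun x => complex.Re (h x))
    (fun x => complex.Im (h x)) mG1 i1 i2 mh1 mh2 ih1 ih2.
  by apply => y; have [h1 h2] := H y; [rewrite -h1|rewrite -h2]; rewrite mulrA cE mul1r.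
have i3 : rint mu (fun x => - complex.Re (G x) * gn 1 x).
  by apply: rint_ext (rintZ (-1) i1) => x; ring.
have mh3 : measurable_fun setT (fun x => - complex.Re (h x)) by exact: meas_opp.
have ih3 : rint mu (fun x => (- complex.Re (h x)) ^+ 2) by apply: rint_ext ih1 => x; rewrite sqrrN.
have neg gam y : gtr (fun x => - complex.Re (G x)) gam y = - gtr (fun x => complex.Re (G x)) gam y.
  rewrite -mulN1r -(RintegralZl (-1) measurableT (rint_gtr i1 gam y)).
  by apply: Rint_ext => x; ring.
have negc y : gconv (fun x => - complex.Re (h x)) y = - gconv (fun x => complex.Re (h x)) y.
  rewrite -mulN1r -(RintegralZl (-1) measurableT (rint_gconv y mh1 ih1)).
  by apply: Rint_ext => x; ring.
have := @plancherel_le R n (fun x => complex.Im (G x)) (fun x => - complex.Re (G x)) (fun x => complex.Im (h x))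
  (fun x => - complex.Re (h x)) mG2 i2 i3 mh2 mh3 ih2 ih3.
rewrite (_ : 2 * _ * _ = C); last first.
  by rewrite /C addrC; congr (_ * (_ + _)); apply: Rint_ext => x; rewrite sqrrN.
apply => y; have [h1 h2] := H y.
  by rewrite neg opprK -h2 mulrA cE mul1r.
by rewrite neg negc -h1 mulrN mulrA cE mul1r; ring.
Qed.

Lemma L2norm_sq h : (L2norm h ^+ 2 = \int[mu]_x (normc (h x) ^+ 2)%:E)%E.
Proof.
have h2 : (2 : R) != 0 by rewrite pnatr_eq0.
have e := @poweR_Lnorm _ _ R mu (fun x => (normc (h x))%:E) 2 h2.
transitivity (L2norm h `^ 2)%E.
  have := @Lnorm_ge0 _ _ R mu 2%:E (fun x => (normc (h x))%:E); rewrite -/(L2norm h).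
  case: (L2norm h) => [r| |]//.
    by rewrite lee_fin => r0; rewrite poweR_EFin powR_mulrn.
  by move=> _; rewrite poweRyr.
rewrite [LHS]e; apply: eq_integral => x _.
by rewrite abse_EFin poweR_EFin powR_mulrn// real_normK// num_real.
Qed.

End complex_level.

Section integrals.
Context d (T : measurableType d) (R : realType) (m : {measure set T -> \bar R}).
Implicit Types F G : T -> R.

Lemma ae_imply (A B : T -> Prop) : (forall x, A x -> B x) ->
  {ae m, forall x, A x} -> {ae m, forall x, B x}.
Proof. by move=> AB; apply: filterS. Qed.

Lemma ae_and (A B : T -> Prop) : {ae m, forall x, A x} -> {ae m, forall x, B x} ->
  {ae m, forall x, A x /\ B x}.
Proof. by apply: filterS2. Qed.

Lemma Rint_ae_ext F G : measurable_fun setT F -> measurable_fun setT G ->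
  {ae m, forall x, F x = G x} -> \int[m]_x F x = \int[m]_x G x.
Proof.
move=> mF mG h; rewrite /Rintegral; congr fine; apply: ae_eq_integral => //.
- exact/measurable_EFinP.
- exact/measurable_EFinP.
- by apply: filterS h => x /= -> _.
Qed.

Lemma rint_lin4 (a b c e : R) F1 F2 F3 F4 : rint m F1 -> rint m F2 -> rint m F3 -> rint m F4 ->
  rint m (fun x => a * F1 x + b * F2 x + (c * F3 x + e * F4 x)) /\
  \int[m]_x (a * F1 x + b * F2 x + (c * F3 x + e * F4 x)) =
  a * \int[m]_x F1 x + b * \int[m]_x F2 x + (c * \int[m]_x F3 x + e * \int[m]_x F4 x).
Proof.
move=> i1 i2 i3 i4; have [j1 e1] := rint_lin a b i1 i2; have [j2 e2] := rint_lin c e i3 i4.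
split; first exact: rintD.
by rewrite (RintegralD measurableT j1 j2) e1 e2.
Qed.

Lemma rint_of_le F (c : R) : measurable_fun setT F -> (forall x, 0 <= F x) ->
  (\int[m]_x (F x)%:E <= c%:E)%E -> rint m F /\ \int[m]_x F x <= c.
Proof.
move=> mF F0 h; have i : rint m F.
  apply/rint_ltyP => //; under eq_integral => x _ do rewrite ger0_norm//.
  exact: le_lt_trans h (ltry _).
by split => //; rewrite -lee_fin -rintE.
Qed.
End integrals.

Section propagator.
Context {R : realType} (m : nat) (alpha : R).
Hypothesis ha : 1 / 2 < alpha.
Local Notation leb := (@lebesgue_measure R).
Local Notation mu := (@lebesgue_rV R m.+1).
Implicit Types (x xi : 'rV[R]_m.+1) (t : R).
Local Notation K := ((2 * pi) ^- m.+1 : R).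

Lemma ctr_rot (psi : 'rV[R]_m.+1 -> R) gamma xi : real_schwartz psi ->
  ctr psi (gamma + 0) xi = cos gamma * ctr psi 0 xi - sin gamma * ctr psi (- (pi / 2)) xi /\
  ctr psi (gamma + - (pi / 2)) xi = cos gamma * ctr psi (- (pi / 2)) xi + sin gamma * ctr psi 0 xi.
Proof.
move=> sp; have e : ctr psi (0 + pi / 2) xi = - ctr psi (- (pi / 2)) xi.
  rewrite (_ : 0 + pi / 2 = - (pi / 2) + pi); last by field.
  by rewrite ctr_phase// cospi sinpi mul0r addr0 mulN1r.
split; first by rewrite addrC ctr_phase// e mulrN.
by rewrite addrC ctr_phase// addNr.
Qed.

Lemma inv_fourier_ctr (phi : 'rV[R]_m.+1 -> R[i]) xi : schwartz phi ->
  let a := fun x => complex.Re (phi x) in let b := fun x => complex.Im (phi x) in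
  inv_fourier phi xi = Complex (K * (ctr a 0 xi - ctr b (- (pi / 2)) xi))
    (K * (ctr a (- (pi / 2)) xi + ctr b 0 xi)).
Proof.
move=> [sa sb] a b; rewrite /inv_fourier /cintegral.
rewrite (_ : \int[mu]_x complex.Re _ = ctr a 0 xi - ctr b (- (pi / 2)) xi); last first.
  rewrite /ctr -(RintegralB measurableT (rint_ctr sa 0 xi) (rint_ctr sb (- (pi / 2)) xi)).
  by apply: Rint_ext => x; rewrite Re_mul/= addr0 cosBpihalf.
rewrite (_ : \int[mu]_x complex.Im _ = ctr a (- (pi / 2)) xi + ctr b 0 xi); last first.
  rewrite /ctr -(RintegralD measurableT (rint_ctr sa (- (pi / 2)) xi) (rint_ctr sb 0 xi)).
  by apply: Rint_ext => x; rewrite Im_mul/= addr0 cosBpihalf.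
by apply/eqP; rewrite eq_complex Re_mul Im_mul/= !mul0r subr0 addr0 !eqxx.
Qed.

Lemma tempered_mul_phase (theta : 'rV[R]_m.+1 -> R) (g : 'rV[R]_m.+1 -> R[i]) :
  measurable_fun setT theta -> tempered_fun g -> tempered_fun (fun xi => expi (theta xi) * g xi).
Proof.
move=> mth [[mg1 mg2] tg].
have mc : measurable_fun setT (fun xi => cos (theta xi)) by exact: meas_cos.
have ms : measurable_fun setT (fun xi => sin (theta xi)) by exact: meas_sin.
split.
  split.
    apply: (eq_measurable_fun (fun xi => cos (theta xi) * complex.Re (g xi) + - (sin (theta xi) * complex.Im (g xi)))).
      by move=> xi _; rewrite Re_mul.
    by apply: meas_add; [exact: meas_mul|apply: meas_opp; exact: meas_mul].
  apply: (eq_measurable_fun (fun xi => cos (theta xi) * complex.Im (g xi) + sin (theta xi) * complex.Re (g xi))).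
    by move=> xi _; rewrite Im_mul.
  by apply: meas_add; exact: meas_mul.
move=> phi sp; have [i1 i2] := tg phi sp.
have c1 xi : `|cos (theta xi)| <= 1 by exact: cos_max.
have s1 xi : `|sin (theta xi)| <= 1 by exact: sin_max.
have a1 := rint_bd i1 mc c1; have a2 := rint_bd i1 ms s1.
have b1 := rint_bd i2 mc c1; have b2 := rint_bd i2 ms s1.
split.
  by apply: rint_ext (rintB a1 b2) => xi; rewrite !(Re_mul, Im_mul)/=; ring.
by apply: rint_ext (rintD b1 a2) => xi; rewrite !(Re_mul, Im_mul)/=; ring.
Qed.

Lemma propagator_solution (g : 'rV[R]_m.+1 -> R[i]) (p1 p2 : 'rV[R]_m.+1 -> R) :
  tempered_fun g -> measurable_fun setT p1 -> measurable_fun setT p2 ->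
  rint mu (fun x => p1 x ^+ 2) -> rint mu (fun x => p2 x ^+ 2) ->
  {ae mu, forall xi, complex.Re (g xi) = amp xi * p1 xi /\ complex.Im (g xi) = amp xi * p2 xi} ->
  exists u : R * 'rV[R]_m.+1 -> R[i], [/\ cmeasurable u,
    {ae leb, forall t, tempered_fun (fun x => u (t, x)) /\ forall phi, schwartz phi ->
       of_fun (fun xi => expi (t * phs xi) * g xi) (inv_fourier phi) = of_fun (fun x => u (t, x)) phi} &
    (\int[(leb \x mu)%E]_q (normc (u q) ^+ 2 * Wt alpha q.2 ^+ 2)%:E <=
      (4 * K ^+ 2 * @Bst R m alpha * (\int[mu]_x (p1 x ^+ 2) + \int[mu]_x (p2 x ^+ 2)))%:E)%E].
Proof.
move=> tg mp1 mp2 ip1 ip2 hg; have [[mg1 mg2] _] := tg.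
have [U1 [mU1 bU1 zU1]] := spacetime_solution ha 0 mp1 ip1.
have [V1 [mV1 bV1 zV1]] := spacetime_solution ha (- (pi / 2)) mp1 ip1.
have [U2 [mU2 bU2 zU2]] := spacetime_solution ha 0 mp2 ip2.
have [V2 [mV2 bV2 zV2]] := spacetime_solution ha (- (pi / 2)) mp2 ip2.
pose u q := Complex (K * (U1 q - V2 q)) (K * (U2 q + V1 q)).
have mu1 : measurable_fun setT (fun q => K * (U1 q - V2 q)).
  by apply: meas_mul; [exact: meas_cst|apply: meas_add => //; exact: meas_opp].
have mu2 : measurable_fun setT (fun q => K * (U2 q + V1 q)).
  by apply: meas_mul; [exact: meas_cst|exact: meas_add].
exists u; split; first by split.
- apply: ae_imply (ae_and (ae_and zU1 zV1) (ae_and zU2 zV2)) => t [[hU1 hV1] [hU2 hV2]].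
  have pt : measurable_fun setT (fun z : 'rV[R]_m.+1 => (t, z)) by exact: pair1_measurable.
  split.
    split.
      by split; [exact: (measurableT_comp mu1 pt)|exact: (measurableT_comp mu2 pt)].
    move=> phi [sa sb].
    have [a1 _] := hU1 _ sa; have [a2 _] := hV1 _ sa; have [a3 _] := hU2 _ sa; have [a4 _] := hV2 _ sa.
    have [b1 _] := hU1 _ sb; have [b2 _] := hV1 _ sb; have [b3 _] := hU2 _ sb; have [b4 _] := hV2 _ sb.
    split.
      apply: rint_ext (proj1 (rint_lin4 K (- K) (- K) (- K) a1 a4 b3 b2)) => x.
      by rewrite Re_mul/=; ring.
    apply: rint_ext (proj1 (rint_lin4 K (- K) K K b1 b4 a3 a2)) => x.
    by rewrite Im_mul/=; ring.
  move=> phi sphi; have [sa sb] := sphi.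
  have [a1 a1E] := hU1 _ sa; have [a2 a2E] := hV1 _ sa; have [a3 a3E] := hU2 _ sa; have [a4 a4E] := hV2 _ sa.
  have [b1 b1E] := hU1 _ sb; have [b2 b2E] := hV1 _ sb; have [b3 b3E] := hU2 _ sb; have [b4 b4E] := hV2 _ sb.
  pose a x := complex.Re (phi x); pose b x := complex.Im (phi x).
  have A0 := meas_ctr sa 0; have A1 := meas_ctr sa (- (pi / 2)).
  have B0 := meas_ctr sb 0; have B1 := meas_ctr sb (- (pi / 2)).
  have mth : measurable_fun setT (fun xi => t * phs xi).
    by apply: meas_mul; [exact: meas_cst|exact: meas_phs].
  have mc := meas_cos mth; have ms := meas_sin mth.
  rewrite /of_fun /cintegral; congr Complex.
  + have [i r] := rint_lin4 K (- K) (- K) (- K) a1 a4 b3 b2.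
    rewrite [RHS](_ : _ = \int[mu]_x (K * (U1 (t, x) * a x) + - K * (V2 (t, x) * a x) +
       (- K * (U2 (t, x) * b x) + - K * (V1 (t, x) * b x)))); last first.
      by apply: Rint_ext => x; rewrite Re_mul/=; ring.
    rewrite [RHS]r a1E a4E b3E b2E.
    have [j s] := rint_lin4 K (- K) (- K) (- K) (rint_amp_ctr 0 t sa mp1 ip1) (rint_amp_ctr (- (pi / 2)) t sa mp2 ip2)
      (rint_amp_ctr 0 t sb mp2 ip2) (rint_amp_ctr (- (pi / 2)) t sb mp1 ip1).
    rewrite -s; apply: Rint_ae_ext.
    * apply: (eq_measurable_fun (fun xi => (cos (t * phs xi) * complex.Re (g xi) + - (sin (t * phs xi) * complex.Im (g xi))) *
          (K * (ctr a 0 xi + - ctr b (- (pi / 2)) xi)) +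
          - ((cos (t * phs xi) * complex.Im (g xi) + sin (t * phs xi) * complex.Re (g xi)) *
          (K * (ctr a (- (pi / 2)) xi + ctr b 0 xi))))).
        by move=> xi _; rewrite (inv_fourier_ctr _ sphi) !(Re_mul, Im_mul).
      by apply: meas_add; [|apply: meas_opp]; apply: meas_mul; do ?[apply: meas_add|apply: meas_opp|apply: meas_mul|exact: meas_cst].
    * exact: rint_meas j.
    apply: filterS hg => xi [e1 e2].
    have [ra1 ra2] := ctr_rot (t * phs xi) xi sa; have [rb1 rb2] := ctr_rot (t * phs xi) xi sb.
    rewrite (inv_fourier_ctr _ sphi) !(Re_mul, Im_mul)/= e1 e2 ra1 ra2 rb1 rb2.
    rewrite -/a -/b; move: (ctr a _ _) (ctr a _ _) (ctr b _ _) (ctr b _ _) (cos _) (sin _) (amp xi) (p1 xi) (p2 xi).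
    by move=> *; ring.
  + have [i r] := rint_lin4 K (- K) K K b1 b4 a3 a2.
    rewrite [RHS](_ : _ = \int[mu]_x (K * (U1 (t, x) * b x) + - K * (V2 (t, x) * b x) +
       (K * (U2 (t, x) * a x) + K * (V1 (t, x) * a x)))); last first.
      by apply: Rint_ext => x; rewrite Im_mul/=; ring.
    rewrite [RHS]r b1E b4E a3E a2E.
    have [j s] := rint_lin4 K (- K) K K (rint_amp_ctr 0 t sb mp1 ip1) (rint_amp_ctr (- (pi / 2)) t sb mp2 ip2)
      (rint_amp_ctr 0 t sa mp2 ip2) (rint_amp_ctr (- (pi / 2)) t sa mp1 ip1).
    rewrite -s; apply: Rint_ae_ext.
    * apply: (eq_measurable_fun (fun xi => (cos (t * phs xi) * complex.Re (g xi) + - (sin (t * phs xi) * complex.Im (g xi))) *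
          (K * (ctr a (- (pi / 2)) xi + ctr b 0 xi)) +
          ((cos (t * phs xi) * complex.Im (g xi) + sin (t * phs xi) * complex.Re (g xi)) *
          (K * (ctr a 0 xi + - ctr b (- (pi / 2)) xi))))).
        by move=> xi _; rewrite (inv_fourier_ctr _ sphi) !(Re_mul, Im_mul).
      by apply: meas_add; apply: meas_mul; do ?[apply: meas_add|apply: meas_opp|apply: meas_mul|exact: meas_cst].
    * exact: rint_meas j.
    apply: filterS hg => xi [e1 e2].
    have [ra1 ra2] := ctr_rot (t * phs xi) xi sa; have [rb1 rb2] := ctr_rot (t * phs xi) xi sb.
    rewrite (inv_fourier_ctr _ sphi) !(Re_mul, Im_mul)/= e1 e2 ra1 ra2 rb1 rb2.
    rewrite -/a -/b; move: (ctr a _ _) (ctr a _ _) (ctr b _ _) (ctr b _ _) (cos _) (sin _) (amp xi) (p1 xi) (p2 xi).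
    by move=> *; ring.
have mW : measurable_fun setT (fun q : R * 'rV[R]_m.+1 => Wt alpha q.2).
  exact: (measurableT_comp (@meas_Wt R m alpha) measurable_snd).
have sq (U : R * 'rV[R]_m.+1 -> R) c : measurable_fun setT U ->
    (\int[(leb \x mu)%E]_q ((U q * Wt alpha q.2) ^+ 2)%:E <= c%:E)%E ->
    rint (leb \x mu)%E (fun q => (U q * Wt alpha q.2) ^+ 2) /\ \int[(leb \x mu)%E]_q ((U q * Wt alpha q.2) ^+ 2) <= c.
  move=> mU; apply: rint_of_le; first by apply: meas_exp; exact: meas_mul.
  by move=> q; exact: sqr_ge0.
have [i1 l1] := sq _ _ mU1 bU1; have [i2 l2] := sq _ _ mV1 bV1.
have [i3 l3] := sq _ _ mU2 bU2; have [i4 l4] := sq _ _ mV2 bV2.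
pose k2 : R := 2 * K ^+ 2.
have k0 : 0 <= k2 by rewrite mulr_ge0// sqr_ge0.
have [i r] := rint_lin4 k2 k2 k2 k2 i1 i2 i3 i4.
apply: (@le_trans _ _ (\int[(leb \x mu)%E]_q (k2 * (U1 q * Wt alpha q.2) ^+ 2 + k2 * (V1 q * Wt alpha q.2) ^+ 2 +
   (k2 * (U2 q * Wt alpha q.2) ^+ 2 + k2 * (V2 q * Wt alpha q.2) ^+ 2))%:E)%E).
  apply: ge0_le_integral => //.
  - by move=> q _; rewrite lee_fin mulr_ge0// sqr_ge0.
  - apply/measurable_EFinP; apply: (eq_measurable_fun (fun q => ((K * (U1 q - V2 q)) ^+ 2 + (K * (U2 q + V1 q)) ^+ 2) * Wt alpha q.2 ^+ 2)).
      by move=> q _; rewrite normc2.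
    by apply: meas_mul; [apply: meas_add|]; exact: meas_exp.
  - by apply/measurable_EFinP; exact: rint_meas i.
  - move=> q _; rewrite lee_fin normc2/= /k2.
    move: (U1 q) (V1 q) (U2 q) (V2 q) (Wt alpha q.2) (K : R) => a b c d w k; rewrite -subr_ge0.
    rewrite (_ : _ - _ = (k * w * (a + d)) ^+ 2 + (k * w * (c - b)) ^+ 2); last by ring.
    by rewrite addr_ge0 ?sqr_ge0.
rewrite rintE// lee_fin r.
apply: (@le_trans _ _ (k2 * (@Bst R m alpha * \int[mu]_x (p1 x ^+ 2)) + k2 * (@Bst R m alpha * \int[mu]_x (p1 x ^+ 2)) +
  (k2 * (@Bst R m alpha * \int[mu]_x (p2 x ^+ 2)) + k2 * (@Bst R m alpha * \int[mu]_x (p2 x ^+ 2))))).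
  by apply: lerD; apply: lerD; apply: ler_wpM2l.
move: (\int[mu]_x _) (\int[mu]_x _) (@Bst R m alpha) => A B D; rewrite /k2 le_eqVlt; apply/orP; left; apply/eqP; ring.
Qed.
End propagator.

Section energy.
Context {R : realType} (n : nat).
Local Notation mu := (@lebesgue_rV R n).

Lemma rint_L2norm (h : 'rV[R]_n -> R[i]) : cmeasurable h -> (L2norm h < +oo)%E ->
  [/\ rint mu (fun x => complex.Re (h x) ^+ 2), rint mu (fun x => complex.Im (h x) ^+ 2) &
   (L2norm h ^+ 2 = (\int[mu]_x (complex.Re (h x) ^+ 2) + \int[mu]_x (complex.Im (h x) ^+ 2))%:E)%E].
Proof.
move=> [m1 m2] hoo; have e := L2norm_sq h.
have N0 : (0 <= L2norm h)%E by exact: Lnorm_ge0.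
have fin : (\int[mu]_x (normc (h x) ^+ 2)%:E < +oo)%E.
  by rewrite -e; move: N0 hoo; case: (L2norm h) => // r _ _; rewrite -EFin_expe ltry.
have mn : measurable_fun setT (fun x => complex.Re (h x) ^+ 2 + complex.Im (h x) ^+ 2).
  by apply: meas_add; exact: meas_exp.
have i : rint mu (fun x => complex.Re (h x) ^+ 2 + complex.Im (h x) ^+ 2).
  apply/rint_ltyP => //; apply: le_lt_trans fin; rewrite le_eqVlt; apply/orP; left; apply/eqP.
  by apply: eq_integral => x _; rewrite normc2 ger0_norm// addr_ge0 ?sqr_ge0.
have i1 : rint mu (fun x => complex.Re (h x) ^+ 2).
  apply: rint_le i _; first exact: meas_exp.
  by move=> x; rewrite ger0_norm ?sqr_ge0// lerDl sqr_ge0.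
have i2 : rint mu (fun x => complex.Im (h x) ^+ 2).
  apply: rint_le i _; first exact: meas_exp.
  by move=> x; rewrite ger0_norm ?sqr_ge0// lerDr sqr_ge0.
split => //; rewrite e -(RintegralD measurableT i1 i2) -(rintE (rintD i1 i2)).
by apply: eq_integral => x _; rewrite normc2.
Qed.

Lemma energy_le (k : 'rV[R]_n -> R) (f v : functional R n) (g0 g h : 'rV[R]_n -> R[i]) :
  represented_by (dfourier f) g0 -> represented_by (dfourier f) g ->
  tempered_fun (fun xi => ((k xi)%:C)%C * g0 xi) ->
  tempered_fun (fun xi => ((k xi)%:C)%C * g xi) ->
  (forall phi, schwartz phi -> v phi = dinv_fourier (of_fun (fun xi => ((k xi)%:C)%C * g xi)) phi) ->
  represented_by v h ->
  (\int[mu]_x (complex.Re (((k x)%:C)%C * g0 x) ^+ 2)%:E <= (2 * (2 * pi) ^+ n)%:E * L2norm h ^+ 2 /\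
   \int[mu]_x (complex.Im (((k x)%:C)%C * g0 x) ^+ 2)%:E <= (2 * (2 * pi) ^+ n)%:E * L2norm h ^+ 2)%E.
Proof.
move=> [tg0 eg0] [tg eg] tG0 tG ev [th eh].
have c0 : 0 < 2 * (2 * pi) ^+ n :> R by rewrite mulr_gt0// exprn_gt0// mulr_gt0// pi_gt0.
have N0 : (0 <= L2norm h)%E by exact: Lnorm_ge0.
have [hoo|hoo] := ltP (L2norm h) +oo%E; last first.
  have -> : L2norm h = +oo%E by apply/eqP; rewrite eq_le hoo leey.
  by rewrite /expe/= mulyy gt0_muley ?lte_fin// !leey.
have [mh _] := th.
have [i1 i2 ->] := rint_L2norm mh hoo.
have gg : {ae mu, forall x, g x = g0 x}.
  by apply: tempered_unique => // phi sp; rewrite -eg// -eg0.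
have [le1 le2] := plancherel_tempered tG mh i1 i2 (fun phi sp => etrans (esym (ev phi sp)) (eh phi sp)).
have [[mG1 mG2] _] := tG; have [[mG01 mG02] _] := tG0.
rewrite -EFinM; split.
  apply: le_trans le1; rewrite le_eqVlt; apply/orP; left; apply/eqP.
  apply: ae_eq_integral => //; [by apply/measurable_EFinP; exact: meas_exp|by apply/measurable_EFinP; exact: meas_exp|].
  by apply: filterS gg => x /= -> _.
apply: le_trans le2; rewrite le_eqVlt; apply/orP; left; apply/eqP.
apply: ae_eq_integral => //; [by apply/measurable_EFinP; exact: meas_exp|by apply/measurable_EFinP; exact: meas_exp|].
by apply: filterS gg => x /= -> _.
Qed.

Lemma le_ereal_inf_sq (S : set (\bar R)) (a b c : R) : 0 <= a -> 0 <= b -> 0 < c ->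
  (forall s, S s -> 0 <= s)%E -> (ereal_inf S < +oo)%E ->
  (forall s, S s -> a%:E <= c%:E * s ^+ 2)%E -> ((b * a)%:E <= (b * c)%:E * ereal_inf S ^+ 2)%E.
Proof.
move=> a0 b0 c0 S0 Soo h.
have l : ((Num.sqrt (a / c))%:E <= ereal_inf S)%E.
  apply: le_ereal_inf_tmp => s Ss; have := h s Ss; have := S0 s Ss.
  case: s {Ss} => [r| |]//; last by move=> *; rewrite leey.
  rewrite lee_fin => r0; rewrite -EFin_expe -EFinM !lee_fin => le.
  rewrite -(@ler_pXn2r _ 2)// ?nnegrE ?sqrtr_ge0// sqr_sqrtr ?divr_ge0 ?(ltW c0)//.
  by rewrite ler_pdivrMr// mulrC.
move: l Soo; case: (ereal_inf S) => [r| |]//; rewrite lee_fin => l _.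
rewrite -EFin_expe -EFinM lee_fin -mulrA ler_wpM2l//.
rewrite mulrC -ler_pdivrMr// -[leLHS]sqr_sqrtr ?divr_ge0 ?(ltW c0)//.
by rewrite lerXn2r ?nnegrE ?sqrtr_ge0// (le_trans _ l) ?sqrtr_ge0.
Qed.
End energy.

Theorem theorem1p2 (R : realType) (d : nat) (hd : (2 <= d)%N) (alpha : R)
    (halpha : 1 / 2 < alpha) :
  exists C : R, forall f : functional R d,
    homogeneous_sobolev (- (1 / 2)) f ->
    exists u : R * 'rV[R]_d -> R[i],
      [/\ cmeasurable u,
          {ae @lebesgue_measure R, forall t : R, exists2 v : functional R d,
             riesz_propagator (Ordinal (ltnW hd)) t f v
             & represented_by v (fun x => u (t, x))}
        & (\int[@lebesgue_measure R \x^ @lebesgue_rV R d]_p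
             (normc (u p) ^+ 2 / (1 + enorm p.2 ^+ 2) `^ alpha)%:E
           <= C%:E * sobolev_norm (- (1 / 2)) f ^+ 2)%E].
Proof.
case: d hd => [//|m] hd.
set j := Ordinal (ltnW hd); have j0 : j = ord0 by exact: val_inj.
pose B : R := 4 * (2 * pi) ^- m.+1 ^+ 2 * @Bst R m alpha.
pose c : R := 4 * (2 * pi) ^+ m.+1.
exists (B * c) => f [_ foo].
have [_ [h0 [v0 [[g [rg tG ev0]] rv0]] <-] h0oo] := ereal_inf_lt foo.
set k := fun xi : 'rV[R]_m.+1 => enorm xi `^ (2 * (- (1 / 2) / 2)) in tG ev0.
pose p1 xi := complex.Re (((k xi)%:C)%C * g xi); pose p2 xi := complex.Im (((k xi)%:C)%C * g xi).
have c2 : 0 < 2 * (2 * pi) ^+ m.+1 :> R by rewrite mulr_gt0// exprn_gt0// mulr_gt0// pi_gt0.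
have [[mp1 mp2] _] := tG.
have bd v h : frac_laplacian (- (1 / 2) / 2) f v -> represented_by v h ->
    (\int[@lebesgue_rV R m.+1]_x (p1 x ^+ 2)%:E <= (2 * (2 * pi) ^+ m.+1)%:E * L2norm h ^+ 2 /\
     \int[@lebesgue_rV R m.+1]_x (p2 x ^+ 2)%:E <= (2 * (2 * pi) ^+ m.+1)%:E * L2norm h ^+ 2)%E.
  by move=> [g' [rg' tG' ev']] rv'; exact: (energy_le rg rg' tG tG' ev' rv').
have [ip1 ip2] : rint (@lebesgue_rV R m.+1) (fun x => p1 x ^+ 2) /\ rint (@lebesgue_rV R m.+1) (fun x => p2 x ^+ 2).
  have [[mh0 _] _] := rv0; have [_ _ e] := rint_L2norm mh0 h0oo.
  have [b1 b2] := bd v0 h0 (ex_intro _ g (And3 rg tG ev0)) rv0.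
  rewrite e -EFinM in b1 b2.
  split; [apply: (proj1 (rint_of_le _ _ b1))|apply: (proj1 (rint_of_le _ _ b2))];
    try exact: meas_exp; by move=> x; exact: sqr_ge0.
have [tg _] := rg.
have gp : {ae @lebesgue_rV R m.+1, forall xi, complex.Re (g xi) = amp xi * p1 xi /\ complex.Im (g xi) = amp xi * p2 xi}.
  apply: filterS (@ae_neq0 R m) => xi xi0.
  have e0 : 0 < enorm xi by rewrite sqrtr_gt0 lt_def xi0 dotp_ge0.
  have ak : amp xi * k xi = 1.
    rewrite /amp /k -powR12_sqrt ?(ltW e0)// -powRD; last by rewrite (gt_eqF e0) implybT.
    by rewrite (_ : _ + _ = 0) ?powRr0//; field.
  by rewrite /p1 /p2 Re_mul Im_mul/= !mul0r subr0 addr0 !mulrA ak !mul1r.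
have [u [mu hu bu]] := propagator_solution halpha tg mp1 mp2 ip1 ip2 gp.
exists u; split => //.
- apply: ae_imply hu => t [tu eu].
  exists (dinv_fourier (of_fun (fun xi => expi (t * (xi ord0 j * enorm xi)) * g xi))).
    exists g; split => //.
    apply: tempered_mul_phase => //; apply: meas_mul; first exact: meas_cst.
    by apply: meas_mul; [exact: measurable_rV_coord|exact: meas_enorm].
  by split => // phi sp; rewrite j0; exact: eu.
rewrite integral_prod2.
apply: (@le_trans _ _ (B * (\int[@lebesgue_rV R m.+1]_x (p1 x ^+ 2) + \int[@lebesgue_rV R m.+1]_x (p2 x ^+ 2)))%:E).
  apply: le_trans bu; rewrite le_eqVlt; apply/orP; left; apply/eqP.
  by apply: eq_integral => q _; rewrite Wt2 /Q enorm2.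
apply: le_ereal_inf_sq => //.
- by apply: addr_ge0; apply: Rintegral_ge0 => x _; exact: sqr_ge0.
- by rewrite mulr_ge0 ?Bst_ge0// mulr_ge0// sqr_ge0.
- by rewrite mulr_gt0// exprn_gt0// mulr_gt0// pi_gt0.
- by move=> _ [h _ <-]; exact: Lnorm_ge0.
move=> _ [h [v [fv rv]] <-]; have [b1 b2] := bd v h fv rv.
rewrite EFinD -!rintE//; apply: (le_trans (leeD b1 b2)).
rewrite -ge0_muleDl ?lee_fin ?(ltW c2)//.
by rewrite -EFinD le_eqVlt; apply/orP; left; apply/eqP; congr (_%:E * _)%E; rewrite /c; ring.
Qed.
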